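(* Let $f=f(x^1,x^3)$ be smooth with $f_3\ne0$, let $g_{\mathcal D_f}=2\theta^1\theta^4+2\theta^2\theta^5+2\theta^3\theta^6$, with Schouten tensor $P$, and let $$\tilde g_{f,S}=2\,d(\varrho t)\,dt+t^2\big(g_{\mathcal D_f}+2\varrho P+S(x^1,x^3,\varrho)\big),$$ where $$S=S_{22}(\theta^2)^2+2S_{24}\theta^2\theta^4+2S_{26}\theta^2\theta^6+S_{44}(\theta^4)^2+2S_{46}\theta^4\theta^6+S_{66}(\theta^6)^2$$ with functions $S_{ij}=S_{ij}(x^1,x^3,\varrho)$ satisfying the initial conditions $S_{ij}(x^1,x^3,0)=0$. Then $\tilde g_{f,S}$ is an ambient metric for the conformal class of Bryant's metrics $[g_{\mathcal D_f}]$ if and only if all the functions $S_{ij}$ satisfy the same linear PDE $$\varrho\frac{\partial^2S_{ij}}{\partial\varrho^2}-2\frac{\partial S_{ij}}{\partial\varrho}=0.$$ The general solution $S$ satisfying the initial conditions $S_{ij}(x^1,x^3,0)=0$ is given by $S=\varrho^3Q$ with $$Q(x^1,x^3)=Q_{22}(\theta^2)^2+2Q_{24}\theta^2\theta^4+2Q_{26}\theta^2\theta^6+Q_{44}(\theta^4)^2+2Q_{46}\theta^4\theta^6+Q_{66}(\theta^6)^2,$$ where the functions $Q_{ij}(x^1,x^3)$ are arbitrary. Every such $Q$ gives an ambient metric for $g_{\mathcal D_f}$ by $$\tilde g_{f,Q}=2\,d(\varrho t)\,dt+t^2\Big(g_{\mathcal D_f}+2\varrho P+\varrho^3Q(x^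1,x^3)\Big).$$
   Context: Coordinates on an open set of $\mathbb R^6$ near the origin are $(x^1,x^2,x^3,y^1,y^2,y^3)$; $f_i=\partial f/\partial x^i$ etc. For $f=f(x^1,x^3)$ the co-frame is $\theta^1=dy^1+x^2dx^3$, $\theta^2=dy^2+f\,dx^1$, $\theta^3=dy^3+x^1dx^2$, $\theta^4=\tfrac32f_3^2dx^1$, $\theta^5=\tfrac32f_3dx^2-\tfrac12f_{33}\theta^1$, $\theta^6=\tfrac32f_3^2dx^3+\tfrac12f_{13}\theta^2$. The Schouten tensor in dimension 6 is $P=\frac14\big(Ric-\frac{Scal}{10}g\big)$; for $g_{\mathcal D_f}$ it is a combination of $\theta^i\theta^j$, $i,j\in\{2,4,6\}$, with coefficients depending only on $x^1,x^3$. An ambient metric for $g_0$ is a Ricci-flat metric of the form $2\,dt\,d(\varrho t)+t^2g(x^i,\varrho)$, $t>0$, with $g(x^i,0)=g_0$. *)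

(* Defs.v *)
From mathcomp Require Import all_boot all_order all_algebra.
From mathcomp Require Import all_classical all_reals all_analysis.

Set Implicit Arguments.
Unset Strict Implicit.
Unset Printing Implicit Defensive.

Import Order.TTheory GRing.Theory Num.Theory.
Import numFieldNormedType.Exports.

Local Open Scope classical_set_scope.
Local Open Scope ring_scope.

Section PseudoRiemannian.
Variables (R : realType) (n : nat).
Implicit Types (U : set 'rV[R]_n) (F : 'rV[R]_n -> R).
Implicit Types (g h : 'rV[R]_n -> 'M[R]_n).

Definition pder (i : 'I_n) F : 'rV[R]_n -> R := 'D_(delta_mx 0 i) F.

(* On an open set U this is C^k: the partial derivatives of order <= k exist
   and are continuous. *)
Fixpoint Ck_on (k : nat) U F : Prop :=
  (forall x, U x -> {for x, continuous F}) /\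
  (if k is k'.+1 then
     forall i, (forall x, U x -> derivable F x (delta_mx 0 i)) /\
               Ck_on k' U (pder i F)
   else True).

Definition smooth_on U F : Prop := forall k, Ck_on k U F.

Definition pseudo_metric_on U g : Prop :=
  [/\ forall i j, smooth_on U (fun x => g x i j),
      forall x, U x -> (g x)^T = g x
    & forall x, U x -> g x \in unitmx].

(* christoffel g k i j is Gamma^k_ij *)
Definition christoffel g (k i j : 'I_n) : 'rV[R]_n -> R := fun x =>
  2^-1 * \sum_l invmx (g x) k l *
    (pder i (fun y => g y j l) x + pder j (fun y => g y i l) x
     - pder l (fun y => g y i j) x).

(* Ric_jk = d_i Gamma^i_jk - d_k Gamma^i_ij
            + Gamma^i_ip Gamma^p_jk - Gamma^i_kp Gamma^p_ij;
   round spheres have Ric > 0. *)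
Definition ricci g : 'rV[R]_n -> 'M[R]_n := fun x => \matrix_(j, k)
  (\sum_i pder i (christoffel g i j k) x
   - \sum_i pder k (christoffel g i i j) x
   + \sum_i \sum_p christoffel g i i p x * christoffel g p j k x
   - \sum_i \sum_p christoffel g i k p x * christoffel g p i j x).

Definition scal g : 'rV[R]_n -> R := fun x => \tr (invmx (g x) *m ricci g x).

Definition ricci_flat_on U g : Prop := forall x, U x -> ricci g x = 0.

(* Covectors are rows of components; a b is the symmetric product
   (a (x) b + b (x) a) / 2. *)
Definition sprod (a b : 'rV[R]_n) : 'M[R]_n :=
  2^-1 *: (a^T *m b + b^T *m a).

Definition conformal_class U g : set ('rV[R]_n -> 'M[R]_n) :=
  [set h | exists u, smooth_on U u /\
                     forall x, U x -> h x = expR (2 * u x) *: g x].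

End PseudoRiemannian.

(* (n - 2)^-1 (Ric - Scal / (2 (n - 1)) g) at n = 6 *)
Definition schouten6 (R : realType) (g : 'rV[R]_6 -> 'M[R]_6) :
    'rV[R]_6 -> 'M[R]_6 :=
  fun x => 4^-1 *: (ricci g x - (scal g x / 10) *: g x).

(* Coordinates (x^1, x^2, x^3, y^1, y^2, y^3) on R^6, (x^1, x^3) on R^2,
   (x^1, x^3, rho) on R^3 and (t, x^1, x^2, x^3, y^1, y^2, y^3, rho) on R^8. *)
Definition ix1 : 'I_6 := @Ordinal 6 0 isT.
Definition ix2 : 'I_6 := @Ordinal 6 1 isT.
Definition ix3 : 'I_6 := @Ordinal 6 2 isT.
Definition iy1 : 'I_6 := @Ordinal 6 3 isT.
Definition iy2 : 'I_6 := @Ordinal 6 4 isT.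
Definition iy3 : 'I_6 := @Ordinal 6 5 isT.
Definition jx1 : 'I_2 := @Ordinal 2 0 isT.
Definition jx3 : 'I_2 := @Ordinal 2 1 isT.
Definition krho : 'I_3 := @Ordinal 3 2 isT.
Definition at_ : 'I_8 := @Ordinal 8 0 isT.
Definition arho : 'I_8 := @Ordinal 8 7 isT.

Section Bryant.
Variable R : realType.
Implicit Types (x : 'rV[R]_6) (z : 'rV[R]_8) (rho : R).

Definition x13 x : 'rV[R]_2 := \row_j nth 0 [:: x 0 ix1; x 0 ix3] j.

Definition x13rho x rho : 'rV[R]_3 :=
  \row_j nth 0 [:: x 0 ix1; x 0 ix3; rho] j.

Definition dX (i : 'I_6) : 'rV[R]_6 := delta_mx 0 i.

Section Coframe.
Variable f : 'rV[R]_2 -> R.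

Definition f_3 x : R := pder jx3 f (x13 x).
Definition f_33 x : R := pder jx3 (pder jx3 f) (x13 x).
Definition f_13 x : R := pder jx3 (pder jx1 f) (x13 x).

Definition theta1 x : 'rV[R]_6 := dX iy1 + x 0 ix2 *: dX ix3.
Definition theta2 x : 'rV[R]_6 := dX iy2 + f (x13 x) *: dX ix1.
Definition theta3 x : 'rV[R]_6 := dX iy3 + x 0 ix1 *: dX ix2.
Definition theta4 x : 'rV[R]_6 := (3 / 2 * f_3 x ^+ 2) *: dX ix1.
Definition theta5 x : 'rV[R]_6 :=
  (3 / 2 * f_3 x) *: dX ix2 - (2^-1 * f_33 x) *: theta1 x.
Definition theta6 x : 'rV[R]_6 :=
  (3 / 2 * f_3 x ^+ 2) *: dX ix3 + (2^-1 * f_13 x) *: theta2 x.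

Definition bryant x : 'M[R]_6 :=
  2 *: sprod (theta1 x) (theta4 x) + 2 *: sprod (theta2 x) (theta5 x)
  + 2 *: sprod (theta3 x) (theta6 x).

End Coframe.

Inductive idx246 : Type := i22 | i24 | i26 | i44 | i46 | i66.

Definition tensor246 (f : 'rV[R]_2 -> R) (s : idx246 -> R) x : 'M[R]_6 :=
  let th2 := theta2 f x in let th4 := theta4 f x in let th6 := theta6 f x in
  s i22 *: sprod th2 th2 + (2 * s i24) *: sprod th2 th4
  + (2 * s i26) *: sprod th2 th6 + s i44 *: sprod th4 th4
  + (2 * s i46) *: sprod th4 th6 + s i66 *: sprod th6 th6.

Definition S_tensor f (S : idx246 -> 'rV[R]_3 -> R) x rho : 'M[R]_6 :=
  tensor246 f (fun k => S k (x13rho x rho)) x.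

Definition Q_tensor f (Q : idx246 -> 'rV[R]_2 -> R) x : 'M[R]_6 :=
  tensor246 f (fun k => Q k (x13 x)) x.

(* Matrix of the projection (t, x, rho) |-> x acting on rows; it also pulls
   back 2-tensors, by congruence. *)
Definition xmx : 'M[R]_(8, 6) := \matrix_(i, j) (i == j.+1 :> nat)%:R.
Definition xpart z : 'rV[R]_6 := z *m xmx.
Definition tpart z : R := z 0 at_.
Definition rhopart z : R := z 0 arho.

(* 2 d(rho t) dt + t^2 g(x, rho), with d(rho t) = rho dt + t drho *)
Definition ambient_form (g : 'rV[R]_6 -> R -> 'M[R]_6) z : 'M[R]_8 :=
  let dt : 'rV[R]_8 := delta_mx 0 at_ in
  let drho : 'rV[R]_8 := delta_mx 0 arho in
  2 *: sprod (rhopart z *: dt + tpart z *: drho) dt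
  + tpart z ^+ 2 *: (xmx *m g (xpart z) (rhopart z) *m xmx^T).

(* W is a neighbourhood, in {t > 0} x U x R, of the hypersurface rho = 0. *)
Definition ambient_domain (U : set 'rV[R]_6) (W : set 'rV[R]_8) : Prop :=
  [/\ open W,
      forall z, W z -> 0 < tpart z /\ U (xpart z)
    & forall z, 0 < tpart z -> U (xpart z) -> rhopart z = 0 -> W z].

Definition ambient_metric (U : set 'rV[R]_6) (g0 : 'rV[R]_6 -> 'M[R]_6)
    (W : set 'rV[R]_8) (G : 'rV[R]_8 -> 'M[R]_8) : Prop :=
  [/\ ambient_domain U W, pseudo_metric_on W G, ricci_flat_on W G
    & exists g : 'rV[R]_6 -> R -> 'M[R]_6,
        (forall x, U x -> g x 0 = g0 x) /\
        (forall z, W z -> G z = ambient_form g z)].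

Definition ambient_metric_of_class (U : set 'rV[R]_6)
    (c : set ('rV[R]_6 -> 'M[R]_6)) (W : set 'rV[R]_8)
    (G : 'rV[R]_8 -> 'M[R]_8) : Prop :=
  exists2 g0, c g0 & ambient_metric U g0 W G.

(* Without connected rho-fibres a solution of the PDE vanishing at rho = 0 need
   not be rho^3 Q. *)
Definition rho_region (U : set 'rV[R]_6) (D : set 'rV[R]_3) : Prop :=
  [/\ open D,
      forall q, D q -> exists2 x, U x & q = x13rho x (q 0 krho),
      forall x, U x -> D (x13rho x 0)
    & forall x, U x -> is_interval [set rho | D (x13rho x rho)]].

Definition region8 (U : set 'rV[R]_6) (D : set 'rV[R]_3) : set 'rV[R]_8 :=
  [set z | [/\ 0 < tpart z, U (xpart z) & D (x13rho (xpart z) (rhopart z))]].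

Definition g_fS f (S : idx246 -> 'rV[R]_3 -> R) : 'rV[R]_8 -> 'M[R]_8 :=
  ambient_form (fun x rho =>
    bryant f x + (2 * rho) *: schouten6 (bryant f) x + S_tensor f S x rho).

Definition g_fQ f (Q : idx246 -> 'rV[R]_2 -> R) : 'rV[R]_8 -> 'M[R]_8 :=
  ambient_form (fun x rho =>
    bryant f x + (2 * rho) *: schouten6 (bryant f) x
    + rho ^+ 3 *: Q_tensor f Q x).

Definition initial_condition (D : set 'rV[R]_3) (S : 'rV[R]_3 -> R) : Prop :=
  forall q, D q -> q 0 krho = 0 -> S q = 0.

Definition rho_pde (D : set 'rV[R]_3) (S : 'rV[R]_3 -> R) : Prop :=
  forall q, D q ->
    q 0 krho * pder krho (pder krho S) q - 2 * pder krho S q = 0.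

End Bryant.

(* Main.v *)
Require Import Defs.
From mathcomp Require Import all_boot all_order all_algebra.
From mathcomp Require Import all_classical all_reals all_analysis.
From mathcomp Require Import ring lra.
Import Order.TTheory GRing.Theory Num.Theory.
Import numFieldNormedType.Exports.
Local Open Scope classical_set_scope.
Local Open Scope ring_scope.

Set Implicit Arguments.
Unset Strict Implicit.
Unset Printing Implicit Defensive.

(* Bryant's metric is a Walker metric: d/dx^2, d/dy^1, d/dy^3 span an integrable
   null distribution V equal to its orthogonal, and the metric is affine along
   the leaves.  Let L be the span of dx^1, dx^3, dy^2, the annihilator of V.  The
   Christoffel symbols of such a metric vanish in so many slots that Ric lies in
   S^2 L, the scalar curvature vanishes, and adding a tensor h in S^2 L that is
   constant along V does not change Ric.  As moving along d/dx^2 adds such an h,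
   Ric itself is constant along V, and so is the Schouten tensor P = Ric / 4.

   For h(x, rho) = 2 rho P + S, the traces g^kl h'_kl and the squares
   g^kl h'_ik h'_jl drop out of the Ricci tensor of 2 d(rho t) dt + t^2 (g + h),
   as does the divergence of h'.  Its only possibly nonzero components are
   rho h''_ij - 2 h'_ij + Ric_ij(g) = rho S''_ij - 2 S'_ij.

   Along a rho-fibre, differentiating rho S'' = 2 S' gives rho S''' = S'' and
   rho S'''' = 0, hence S''' is constant and S = rho^3 S''' / 6. *)

(** * Smooth functions *)

(** Neither Ric nor P of Bryant's metric is ever computed: it is enough that Ric = 4P lies in S^2 L
    and is constant along V. The term 2 rho P then contributes -4P + Ric = 0 to the x-block, which
    leaves a homogeneous equation for S. It splits into six scalar equations because theta^2,
    theta^4, theta^6 form a basis of L where f_3 is nonzero.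

    The coefficient 2 is n/2 - 1 for n = 6, and the exponent 3 is n/2, the order at which the
    Fefferman-Graham expansion is undetermined in even dimension.

    The equation is singular at rho = 0, where uniqueness for regular ODEs fails: different
    multiples of rho^3 on the two sides glue to a C^2 solution. Smoothness across rho = 0 forces a
    single coefficient, hence the passage to the fourth derivative and, at rho = 0 itself, to the
    fifth.

    Calculus is done with partial derivatives only. The changes of coordinates are affine and send
    each coordinate vector to 0 or to a coordinate vector, so composing with them only renames or
    kills partial derivatives. *)

Section Smooth.
Variables (R : realType) (n : nat).
Implicit Types (U : set 'rV[R]_n) (F G : 'rV[R]_n -> R) (x : 'rV[R]_n) (i : 'I_n).

Definition pderivable (i : 'I_n) F x := derivable F x (delta_mx 0 i).

Lemma near_open U x (P : 'rV[R]_n -> Prop) :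
  open U -> U x -> (forall y, U y -> P y) -> \forall y \near x, P y.
Proof. by move=> oU Ux UP; apply: filterS (open_nbhs_nbhs (conj oU Ux)). Qed.

Lemma pder_eq U i F G x : open U -> (forall y, U y -> F y = G y) -> U x ->
  pder i F x = pder i G x.
Proof. by move=> oU FG Ux; apply: near_eq_derive; exact: near_open FG. Qed.

Lemma pderivable_eq U i F G x : open U -> (forall y, U y -> F y = G y) -> U x ->
  pderivable i F x -> pderivable i G x.
Proof. by move=> oU FG Ux; apply: near_eq_derivable; exact: near_open FG. Qed.

Lemma pder_ext i F G x : F =1 G -> pder i F x = pder i G x.
Proof. by move=> /funext ->. Qed.

Lemma pder_cst i (c : R) : pder i (fun=> c) = fun=> 0.
Proof. by apply/funext => x; exact: derive_cst. Qed.

Lemma pderD i F G x : pderivable i F x -> pderivable i G x ->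
  pder i (fun y => F y + G y) x = pder i F x + pder i G x.
Proof. exact: deriveD. Qed.

Lemma pderB i F G x : pderivable i F x -> pderivable i G x ->
  pder i (fun y => F y - G y) x = pder i F x - pder i G x.
Proof. exact: deriveB. Qed.

Lemma pderivable_cst i (c : R) x : pderivable i (fun=> c) x.
Proof. exact: derivable_cst. Qed.

Lemma pderivableM i F G x : pderivable i F x -> pderivable i G x ->
  pderivable i (fun y => F y * G y) x.
Proof. exact: derivableM. Qed.

Lemma pderM i F G x : pderivable i F x -> pderivable i G x ->
  pder i (fun y => F y * G y) x = pder i F x * G x + F x * pder i G x.
Proof.
by move=> dF dG; rewrite /pder (deriveM dF dG) addrC mulrC; congr (_ + _); rewrite mulrC.
Qed.

Lemma pderV i F x : F x != 0 -> pderivable i F x ->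
  pder i (fun y => (F y)^-1) x = - (pder i F x * ((F x)^-1 * (F x)^-1)).
Proof.
move=> F0 dF; rewrite /pder (deriveV F0 dF) scaleNr -exprVn expr2; congr (- _).
exact: mulrC.
Qed.

Lemma Ck_cont k U F x : Ck_on k U F -> U x -> {for x, continuous F}.
Proof. by case: k => [|k] [+ _]; apply. Qed.

Lemma CkP k U F : Ck_on k.+1 U F <-> [/\ forall x, U x -> {for x, continuous F},
  forall i x, U x -> pderivable i F x & forall i, Ck_on k U (pder i F)].
Proof.
split=> [[cF dF]|[cF dF dF']]; split=> //.
- by move=> i; have [] := dF i.
- by move=> i; have [] := dF i.
- by move=> i; split=> //; exact: dF.
Qed.

Lemma Ck_S k U F : Ck_on k.+1 U F -> Ck_on k U F.
Proof.
elim: k F => [|k IH] F; first by move=> [].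
move/CkP => [cF dF dF']; apply/CkP; split=> // i; exact/IH/dF'.
Qed.

Lemma cont_eq U F G x : open U -> (forall y, U y -> F y = G y) -> U x ->
  {for x, continuous F} -> {for x, continuous G}.
Proof.
move=> oU FG Ux cF; change (G @ x --> G x); rewrite -FG //.
have FGx : \forall y \near x, F y = G y by exact: near_open FG.
exact: cvg_trans (near_eq_cvg FGx) cF.
Qed.

Lemma Ck_eq k U F G : open U -> (forall y, U y -> F y = G y) ->
  Ck_on k U F -> Ck_on k U G.
Proof.
move=> oU; elim: k F G => [|k IH] F G FG.
  by case=> cF _; split=> // x Ux; exact: cont_eq FG Ux (cF x Ux).
move/CkP => [cF dF dF']; apply/CkP; split=> [x Ux|i x Ux|i].
- exact: cont_eq FG Ux (cF x Ux).
- exact: pderivable_eq FG Ux (dF i x Ux).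
- by apply: IH (dF' i) => y Uy; exact: pder_eq FG Uy.
Qed.

Lemma Ck_cst k U (c : R) : Ck_on k U (fun=> c).
Proof.
elim: k c => [|k IH] c; first by split=> // x _; exact: cst_continuous.
apply/CkP; split=> [x _|i x _|i]; first exact: cst_continuous.
  exact: derivable_cst.
by rewrite pder_cst.
Qed.

Lemma CkD k U F G : open U -> Ck_on k U F -> Ck_on k U G ->
  Ck_on k U (fun x => F x + G x).
Proof.
move=> oU; elim: k F G => [|k IH] F G.
  by move=> [cF _] [cG _]; split=> // x Ux; apply: continuousD; [exact: cF|exact: cG].
move=> /CkP[cF dF dF'] /CkP[cG dG dG']; apply/CkP; split=> [x Ux|i x Ux|i].
- by apply: continuousD; [exact: cF|exact: cG].
- by apply: derivableD; [exact: dF|exact: dG].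
- apply: (@Ck_eq _ _ (fun x => pder i F x + pder i G x)) => //.
    by move=> y Uy; rewrite pderD //; [exact: dF|exact: dG].
  exact: IH.
Qed.

Lemma CkM k U F G : open U -> Ck_on k U F -> Ck_on k U G ->
  Ck_on k U (fun x => F x * G x).
Proof.
move=> oU; elim: k F G => [|k IH] F G.
  by move=> [cF _] [cG _]; split=> // x Ux; apply: continuousM; [exact: cF|exact: cG].
move=> kF kG; have := kF; have := kG.
move=> /CkP[cG dG dG'] /CkP[cF dF dF']; apply/CkP; split=> [x Ux|i x Ux|i].
- by apply: continuousM; [exact: cF|exact: cG].
- by apply: derivableM; [exact: dF|exact: dG].
- apply: (@Ck_eq _ _ (fun x => pder i F x * G x + F x * pder i G x)) => //.
    by move=> y Uy; rewrite pderM //; [exact: dF|exact: dG].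
  by apply: CkD => //; apply: IH => //; exact: Ck_S.
Qed.

(** The derivative of the reciprocal contains the reciprocal again, so the induction on [k] feeds
    order [k] of 1/F into the derivative of 1/F. *)
Lemma CkV k U F : open U -> (forall x, U x -> F x != 0) -> Ck_on k U F ->
  Ck_on k U (fun x => (F x)^-1).
Proof.
move=> oU F0; elim: k => [|k IH].
  by move=> [cF _]; split=> // x Ux; apply: continuousV; [exact: F0|exact: cF].
move=> kF; have := kF => /CkP[cF dF dF']; apply/CkP; split=> [x Ux|i x Ux|i].
- by apply: continuousV; [exact: F0|exact: cF].
- by apply: derivableV; [exact: F0|exact: dF].
- apply: (@Ck_eq _ _ (fun x => (- 1) * (pder i F x * ((F x)^-1 * (F x)^-1)))) => //.
    by move=> y Uy; rewrite mulN1r pderV //; [exact: F0|exact: dF].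
  have kV := IH (Ck_S kF).
  by do 2?[apply: CkM => //]; [exact: Ck_cst|exact: CkM].
Qed.

Lemma smooth_pderivable U F i x : smooth_on U F -> U x -> pderivable i F x.
Proof. by move=> /(_ 1%N)/CkP[_ + _] Ux; exact. Qed.

Lemma smooth_cont U F x : smooth_on U F -> U x -> {for x, continuous F}.
Proof. by move=> /(_ 0%N)/Ck_cont; exact. Qed.

Lemma smooth_pder U F i : smooth_on U F -> smooth_on U (pder i F).
Proof. by move=> sF k; have /CkP[_ _] := sF k.+1; exact. Qed.

Lemma smooth_eq U F G : open U -> (forall y, U y -> F y = G y) ->
  smooth_on U F -> smooth_on U G.
Proof. by move=> oU FG sF k; exact: Ck_eq FG (sF k). Qed.

Lemma smooth_cst U (c : R) : smooth_on U (fun=> c).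
Proof. by move=> k; exact: Ck_cst. Qed.

Lemma smoothD U F G : open U -> smooth_on U F -> smooth_on U G ->
  smooth_on U (fun x => F x + G x).
Proof. by move=> oU sF sG k; exact: CkD. Qed.

Lemma smoothM U F G : open U -> smooth_on U F -> smooth_on U G ->
  smooth_on U (fun x => F x * G x).
Proof. by move=> oU sF sG k; exact: CkM. Qed.

Lemma smoothV U F : open U -> (forall x, U x -> F x != 0) -> smooth_on U F ->
  smooth_on U (fun x => (F x)^-1).
Proof. by move=> oU F0 sF k; exact: CkV. Qed.

Lemma smoothN U F : open U -> smooth_on U F -> smooth_on U (fun x => - F x).
Proof.
move=> oU sF; apply: (@smooth_eq _ (fun x => -1 * F x)) => //.
  by move=> y _; rewrite mulN1r.
by apply: smoothM => //; exact: smooth_cst.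
Qed.

Lemma smoothB U F G : open U -> smooth_on U F -> smooth_on U G ->
  smooth_on U (fun x => F x - G x).
Proof. by move=> oU sF sG; apply: smoothD => //; exact: smoothN. Qed.

Lemma smoothX U F k : open U -> smooth_on U F -> smooth_on U (fun x => F x ^+ k).
Proof.
move=> oU sF; elim: k => [|k IH]; first exact: smooth_cst.
apply: (@smooth_eq _ (fun x => F x * F x ^+ k)) => //.
  by move=> y _; rewrite exprS.
exact: smoothM.
Qed.

Lemma smooth_sum (I : Type) (r : seq I) (P : pred I) U (F : I -> 'rV[R]_n -> R) :
  open U -> (forall j, P j -> smooth_on U (F j)) ->
  smooth_on U (fun x => \sum_(j <- r | P j) F j x).
Proof.
move=> oU sF; elim: r => [|a r IH].
  by apply: (@smooth_eq _ (fun=> 0)) (smooth_cst _ _) => // y _; rewrite big_nil.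
case Pa : (P a); last first.
  by apply: (@smooth_eq _ _ _ oU _ IH) => y _; rewrite big_cons Pa.
apply: (@smooth_eq _ (fun x => F a x + \sum_(j <- r | P j) F j x)) => //.
  by move=> y _; rewrite big_cons Pa.
by apply: smoothD => //; exact: sF.
Qed.

Lemma smooth_prod (I : Type) (r : seq I) (P : pred I) U (F : I -> 'rV[R]_n -> R) :
  open U -> (forall j, P j -> smooth_on U (F j)) ->
  smooth_on U (fun x => \prod_(j <- r | P j) F j x).
Proof.
move=> oU sF; elim: r => [|a r IH].
  by apply: (@smooth_eq _ (fun=> 1)) (smooth_cst _ _) => // y _; rewrite big_nil.
case Pa : (P a); last first.
  by apply: (@smooth_eq _ _ _ oU _ IH) => y _; rewrite big_cons Pa.
apply: (@smooth_eq _ (fun x => F a x * \prod_(j <- r | P j) F j x)) => //.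
  by move=> y _; rewrite big_cons Pa.
by apply: smoothM => //; exact: sF.
Qed.

Lemma pder_sum (I : finType) U (F : I -> 'rV[R]_n -> R) i x : open U -> U x ->
  (forall k, smooth_on U (F k)) ->
  pder i (fun y => \sum_k F k y) x = \sum_k pder i (F k) x.
Proof.
move=> oU Ux sF.
(* The derivative of a sum splits only when both parts are derivable, so the induction over the
   enumeration carries both facts. *)
suff [] : pderivable i (fun y => \sum_k F k y) x /\
  pder i (fun y => \sum_k F k y) x = \sum_k pder i (F k) x by [].
rewrite !unlock /index_enum; elim: (Finite.enum I) => /= [|a r [IH1 IH2]].
  by split; [exact: derivable_cst|rewrite pder_cst].
have da : pderivable i (F a) x by exact: smooth_pderivable (sF a) Ux.
by split; [exact: derivableD | rewrite pderD // IH2].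
Qed.

End Smooth.

(** * Composition with affine maps *)

Section AffineComposition.
Variables (R : realType) (V W : normedModType R).
Variables (F : W -> R) (L : V -> W) (x v : V) (w : W).
Hypothesis affL : forall h : R, L (h *: v + x) = h *: w + L x.

Let quotient : (fun h : R => h^-1 *: (((F \o L) \o shift x) (h *: v) - (F \o L) x)) =
  (fun h : R => h^-1 *: ((F \o shift (L x)) (h *: w) - F (L x))).
Proof. by apply/funext => h /=; rewrite affL. Qed.

(** Both difference quotients are the same function of [h], so the limits agree even where they are
    only default values. *)
Lemma derive_affine : 'D_v (F \o L) x = 'D_w F (L x).
Proof. by rewrite /derive quotient. Qed.

Lemma derivable_affine : derivable F (L x) w -> derivable (F \o L) x v.
Proof. by rewrite /derivable quotient. Qed.

End AffineComposition.

Section AffineChangeOfVariables.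
Variables (R : realType) (m n : nat) (L L0 : 'rV[R]_m -> 'rV[R]_n).
Hypothesis affL : forall (h : R) u v, L (h *: u + v) = h *: L0 u + L v.

Lemma pder_comp F i j x : L0 (delta_mx 0 i) = delta_mx 0 j ->
  pder i (F \o L) x = pder j F (L x).
Proof.
by move=> Li; rewrite /pder -Li; apply: derive_affine => h; rewrite affL.
Qed.

Lemma pder_comp0 F i x : L0 (delta_mx 0 i) = 0 -> pder i (F \o L) x = 0.
Proof.
move=> Li; rewrite /pder (@derive_affine _ _ _ F L x _ 0) ?derive0 // => h.
by rewrite affL Li.
Qed.

(** Each partial derivative of [F \o L] is 0 or a partial derivative of [F] composed with the same
    [L], so the induction on the order closes without a general chain rule. The projections and
    embeddings used below have this shape. *)
Lemma smooth_comp (U : set 'rV[R]_m) (V : set 'rV[R]_n) F : continuous L ->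
  (forall i, L0 (delta_mx 0 i) = 0 \/ exists j, L0 (delta_mx 0 i) = delta_mx 0 j) ->
  (forall x, U x -> V (L x)) -> smooth_on V F -> smooth_on U (F \o L).
Proof.
move=> contL Lb UV sF k; elim: k F sF => [|k IH] F sF.
  split=> // x Ux; apply: continuous_comp; first exact: contL.
  exact: smooth_cont sF (UV _ Ux).
apply/CkP; split=> [x Ux|i x Ux|i].
- apply: continuous_comp; first exact: contL.
  exact: smooth_cont sF (UV _ Ux).
- apply: (@derivable_affine _ _ _ F L x _ (L0 (delta_mx 0 i))).
    by move=> h; rewrite affL.
  case: (Lb i) => [->|[j ->]]; first exact: derivable0.
  exact: smooth_pderivable sF (UV _ Ux).
- case: (Lb i) => [Li|[j Li]].
    rewrite (_ : pder i _ = fun=> 0); first exact: Ck_cst.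
    by apply/funext => x; exact: pder_comp0.
  rewrite (_ : pder i _ = pder j F \o L); last first.
    by apply/funext => x; rewrite (pder_comp _ _ Li).
  by apply: IH; exact: smooth_pder.
Qed.

End AffineChangeOfVariables.

Section Coordinates.
Variables (R : realType) (n : nat).

Lemma coord_affine (i : 'I_n) (v x : 'rV[R]_n) (h : R) :
  (h *: v + x) 0 i = h *: (v 0 i) + x 0 i.
Proof. by rewrite !mxE. Qed.

Lemma pder_coord (i j : 'I_n) :
  pder j (fun x : 'rV[R]_n => x 0 i) = fun=> (i == j)%:R.
Proof.
apply/funext => x; rewrite /pder.
have -> := @derive_affine R _ _ id (fun y : 'rV[R]_n => y 0 i) x (delta_mx 0 j) _
  (coord_affine i _ x).
by rewrite derive_id mxE eqxx.
Qed.

Lemma smooth_coord (U : set 'rV[R]_n) (i : 'I_n) : smooth_on U (fun x => x 0 i).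
Proof.
case=> [|k]; first by split=> // x _; exact: coord_continuous.
apply/CkP; split=> [x _|j x _|j]; first exact: coord_continuous.
  apply: (@derivable_affine R _ _ id (fun y : 'rV[R]_n => y 0 i) x _ _
    (coord_affine i _ x)); exact: derivable_id.
by rewrite pder_coord; exact: Ck_cst.
Qed.

Lemma continuous_rV (T : topologicalType) (L : T -> 'rV[R]_n) :
  (forall j, continuous (fun x => L x 0 j)) -> continuous L.
Proof.
move=> cL x; apply/cvg_ballP => e e0.
have : \forall y \near x, forall j, ball (L x 0 j) e (L y 0 j).
  by apply: filter_forall => j; have /cvg_ballP/(_ e e0) := cL j x.
by apply: filterS => y Ly; split=> // i j; rewrite !ord1.
Qed.

End Coordinates.

Lemma continuous_mulmxr (R : realType) m n (A : 'M[R]_(m, n)) : continuous (fun x : 'rV[R]_m => x *m A).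
Proof.
apply: continuous_rV => j x.
have s : smooth_on setT (fun x : 'rV[R]_m => \sum_i x 0 i * A i j).
  apply: smooth_sum => [|i _]; first exact: openT.
  by apply: smoothM; [exact: openT|exact: smooth_coord|exact: smooth_cst].
have -> : (fun x : 'rV[R]_m => (x *m A) 0 j) = fun x => \sum_i x 0 i * A i j.
  by apply/funext => y; rewrite mxE.
exact: (smooth_cont s).
Qed.

(** * Symmetry of second partial derivatives *)

Section Schwarz.
Variables (R : realType) (n : nat).
Implicit Types (U : set 'rV[R]_n) (F : 'rV[R]_n -> R) (x y v : 'rV[R]_n) (i j : 'I_n).

Lemma MVT_direction F y v (s : R) : 0 < s ->
  (forall h, 0 <= h <= s -> derivable F (h *: v + y) v) ->
  exists2 h, 0 <= h <= s & F (s *: v + y) - F y = 'D_v F (h *: v + y) * s.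
Proof.
move=> s0 dF; pose L (h : R) := h *: v + y.
have aL (x h : R) : L (h *: (1 : R) + x) = h *: v + L x.
  by rewrite /L scalerDl addrA; congr (_ *: _ + _ + _); rewrite /GRing.scale /= mulr1.
have dFL h : 0 <= h <= s -> derivable (F \o L) h (1 : R).
  by move=> hs; apply: (derivable_affine (aL h)); exact: dF.
have [h||h hs] := @MVT R (F \o L) (fun h => 'D_v F (L h)) 0 s s0.
- rewrite in_itv /= => /andP[h0 hs]; apply: DeriveDef.
    by apply: dFL; rewrite !ltW.
  exact: (derive_affine _ (aL h)).
- apply: derivable_within_continuous => h; rewrite in_itv /=; exact: dFL.
rewrite /= /L scale0r add0r subr0 => E; exists h => //.
by move: hs; rewrite in_itv /= => /andP[h0 hs]; rewrite !ltW.
Qed.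

(** The mean value theorem is used twice: in direction i for the increment of [F] in direction j,
    then in direction j for the i-th partial derivative. The left side is symmetric in i and j, and
    the bound on [s] keeps the parallelogram inside the ball of radius [r]. *)
Lemma second_difference U F x i j (r s : R) : smooth_on U F ->
  (forall y, `|x - y| < r -> U y) -> 0 < s ->
  s * (`|delta_mx 0 i : 'rV[R]_n| + `|delta_mx 0 j : 'rV[R]_n|) < r ->
  exists2 p, `|x - p| < r &
  F (s *: delta_mx 0 j + (s *: delta_mx 0 i + x)) - F (s *: delta_mx 0 i + x)
  - (F (s *: delta_mx 0 j + x) - F x) = s * s * pder j (pder i F) p.
Proof.
move=> sF rU s0 sr.
have near_x h k : 0 <= h <= s -> 0 <= k <= s ->
    `|x - (k *: delta_mx 0 j + (h *: delta_mx 0 i + x))| < r.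
  move=> /andP[h0 hs] /andP[k0 ks]; apply: le_lt_trans sr.
  rewrite addrA opprD addrCA subrr addr0 normrN.
  apply: (le_trans (ler_normD _ _)); rewrite !normrZ !ger0_norm // mulrDr addrC.
  by apply: lerD; apply: ler_wpM2r.
have sC0 : 0 <= s <= s by rewrite ltW /=.
have z0 : (0 : R) <= 0 <= s by rewrite lexx ltW.
pose G y := F (s *: delta_mx 0 j + y) - F y.
pose L (z : 'rV[R]_n) : 'rV[R]_n := s *: delta_mx 0 j + z.
have shiftL h k : L (k *: delta_mx 0 i + (h *: delta_mx 0 i + x)) =
   k *: delta_mx 0 i + L (h *: delta_mx 0 i + x).
  by rewrite /L addrCA.
have dFs h : 0 <= h <= s ->
    pderivable i (fun z => F (s *: delta_mx 0 j + z)) (h *: delta_mx 0 i + x).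
  move=> hs; apply: (derivable_affine (shiftL h)).
  exact: smooth_pderivable sF (rU _ (near_x _ _ hs sC0)).
have dF0 h : 0 <= h <= s -> pderivable i F (h *: delta_mx 0 i + x).
  move=> hs; apply: smooth_pderivable sF (rU _ _).
  by have := near_x _ _ hs z0; rewrite scale0r add0r.
have [|h hs] := @MVT_direction G x (delta_mx 0 i) s s0.
  by move=> h hs; apply: derivableB; [exact: dFs|exact: dF0].
have -> : 'D_(delta_mx 0 i) G (h *: delta_mx 0 i + x) =
    pder i F (s *: delta_mx 0 j + (h *: delta_mx 0 i + x)) - pder i F (h *: delta_mx 0 i + x).
  have <- : 'D_(delta_mx 0 i) (F \o L) (h *: delta_mx 0 i + x) =
      pder i F (L (h *: delta_mx 0 i + x)).
    exact: (@derive_affine _ _ _ F L _ _ _ (shiftL h)).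
  exact: (pderB (dFs h hs) (dF0 h hs)).
rewrite {1 2}/G => ->.
have [|k ks ->] := @MVT_direction (pder i F) (h *: delta_mx 0 i + x) (delta_mx 0 j) s s0.
  move=> k ks; exact: smooth_pderivable (smooth_pder i sF) (rU _ (near_x _ _ hs ks)).
exists (k *: delta_mx 0 j + (h *: delta_mx 0 i + x)); first exact: near_x.
by rewrite -mulrA mulrC.
Qed.

Lemma near_dist_lt F x (e : R) : {for x, continuous F} -> 0 < e ->
  \forall y \near x, `|F x - F y| < e.
Proof. by move/cvgr_dist_lt; exact. Qed.

(** The same second difference, read in both orders, makes the two mixed derivatives equal at two
    points [p] and [q] close to [x]. If they differed by d > 0 at [x], continuity to within d/2 of
    each would give d < d. *)
Lemma pderC U F x i j : open U -> smooth_on U F -> U x ->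
  pder i (pder j F) x = pder j (pder i F) x.
Proof.
move=> oU sF Ux; apply/eqP; rewrite -subr_eq0 -normr_eq0; apply/negPn/negP => ne.
set d := `| _ | in ne; have d0 : 0 < d / 2 by rewrite divr_gt0 // lt_neqAle eq_sym ne normr_ge0.
have cA : {for x, continuous (pder i (pder j F))}.
  exact: (smooth_cont (smooth_pder i (smooth_pder j sF)) Ux).
have cB : {for x, continuous (pder j (pder i F))}.
  exact: (smooth_cont (smooth_pder j (smooth_pder i sF)) Ux).
have Un : \forall y \near x, U y by exact: near_open Ux _.
have NA : \forall y \near x, `|pder i (pder j F) x - pder i (pder j F) y| < d / 2.
  exact: near_dist_lt.
have NB : \forall y \near x, `|pder j (pder i F) x - pder j (pder i F) y| < d / 2.
  exact: near_dist_lt.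
have [r /= r0 rP] := (nbhs_ballP _ _).1 (filterI Un (filterI NA NB)).
have inb y : `|x - y| < r -> ball x r y by rewrite -ball_normE.
set M := `|delta_mx 0 i : 'rV[R]_n| + `|delta_mx 0 j : 'rV[R]_n|.
have M0 : 0 <= M by exact: addr_ge0.
(* The summand 1 keeps the denominator positive and still gives s M < r. *)
pose s := r / 2 / (M + 1).
have s0 : 0 < s by rewrite !divr_gt0 // ltr_wpDl.
have sr : s * M < r.
  rewrite /s mulrAC ltr_pdivrMr ?ltr_wpDl //.
  by nra.
have rU y : `|x - y| < r -> U y by move=> /inb/rP[].
have [p pr E1] := second_difference sF rU s0 sr.
have [q qr] := second_difference sF rU s0 (eq_ind _ (fun M => s * M < r) sr _ (addrC _ _)).
rewrite (_ : F _ - _ - _ = s * s * pder j (pder i F) p); last first.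
  by rewrite -E1 (addrCA (s *: _)); ring.
move/mulfI => /(_ ltac:(by rewrite mulf_neq0 ?gt_eqF)) pq.
have [_ [_ Bp]] := rP p (inb p pr); have [_ [Aq _]] := rP q (inb q qr).
have : d < d / 2 + d / 2.
  apply: le_lt_trans (ltrD Aq Bp); rewrite -pq [X in _ <= _ + X]distrC.
  by apply: le_trans (ler_normD _ _); rewrite addrA subrK.
by rewrite -splitr ltxx.
Qed.

End Schwarz.

Section Translation.
Variables (R : realType) (n : nat).
Implicit Types (F : 'rV[R]_n -> R) (v x : 'rV[R]_n).

Lemma pder_shift F v i x : pder i (fun y => F (v + y)) x = pder i F (v + x).
Proof.
rewrite /pder; apply: (@derive_affine _ _ _ F (fun y => v + y)) => t.
by rewrite addrCA.
Qed.

Lemma pder_const_along F i x : (forall s : R, F (s *: delta_mx 0 i + x) = F x) ->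
  pder i F x = 0.
Proof.
move=> Fx; rewrite /pder /derive [X in X @ _](_ : _ = fun=> 0) ?lim_cst //.
by apply/funext => s /=; rewrite Fx subrr scaler0.
Qed.

End Translation.

(** * Functions constant along the rho-fibres *)

Section FiberConstancy.
Variables (R : realType) (U : set 'rV[R]_6) (D : set 'rV[R]_3).
Hypothesis DU : rho_region U D.
Implicit Types (x : 'rV[R]_6) (rho : R) (F : 'rV[R]_3 -> R).

Lemma x13rho_shift x (s rho : R) :
  x13rho x (s + rho) = s *: delta_mx 0 krho + x13rho x rho.
Proof.
apply/rowP => j; rewrite !mxE.
by case: j => [[|[|[|m]]] lt3] //=; rewrite ?mulr0 ?add0r ?mulr1.
Qed.

(** The fibre is an interval containing 0, so the segment from 0 to [rho] stays in [D] and the mean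
    value theorem applies along it. *)
Lemma fiber_const F x rho : smooth_on D F -> (forall q, D q -> pder krho F q = 0) ->
  U x -> D (x13rho x rho) -> F (x13rho x rho) = F (x13rho x 0).
Proof.
move=> sF F0 Ux Dr; have [_ _ D0 Di] := DU.
have step (a s : R) : D (x13rho x a) -> D (x13rho x (s + a)) -> 0 < s ->
    F (x13rho x (s + a)) = F (x13rho x a).
  move=> Da Ds s0.
  have inD h : 0 <= h <= s -> D (h *: delta_mx 0 krho + x13rho x a).
    move=> /andP[h0 hs]; rewrite -x13rho_shift.
    by apply: (Di x Ux _ _ Da Ds); rewrite lerDr h0 lerD2r.
  have [h hs|h hs E] := @MVT_direction _ _ F (x13rho x a) (delta_mx 0 krho) s s0.
    exact: smooth_pderivable sF (inD h hs).
  apply/eqP; rewrite -subr_eq0 x13rho_shift E.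
  by rewrite -[X in X * _]/(pder krho F _) F0 ?mul0r //; exact: inD.
have [r0|r0|-> //] := ltgtP rho 0.
  (* [step] only moves upwards, so a negative [rho] is the starting point and 0 the end. *)
  have := step rho (- rho) Dr; rewrite addNr oppr_gt0 => <- //.
  exact: D0.
by have := step 0 rho (D0 x Ux); rewrite addr0 => ->.
Qed.

End FiberConstancy.

(* Unification would otherwise unfold [pder] down to limits. *)
#[local] Opaque pder.

(** * Derivatives of metrics and Ricci tensors *)

Section MatrixFunctions.
Variables (R : realType) (n : nat) (U : set 'rV[R]_n).
Hypothesis oU : open U.

Lemma smooth_det k (A : 'rV[R]_n -> 'M[R]_k) :
  (forall i j, smooth_on U (fun x => A x i j)) ->
  smooth_on U (fun x => \det (A x)).
Proof.
move=> sA; apply: smooth_sum => // s _; apply: smoothM => //; first exact: smooth_cst.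
exact: smooth_prod.
Qed.

(** Cramer's rule: a cofactor is polynomial in the entries, and the determinant does not vanish on
    [U]. *)
Lemma smooth_invmx k (A : 'rV[R]_n -> 'M[R]_k) i j :
  (forall i j, smooth_on U (fun x => A x i j)) ->
  (forall x, U x -> A x \in unitmx) -> smooth_on U (fun x => invmx (A x) i j).
Proof.
move=> sA uA.
apply: (smooth_eq (F := fun x => (\det (A x))^-1 * cofactor (A x) j i)) => //.
  by move=> x Ux; rewrite /invmx uA // !mxE.
apply: smoothM => //.
  apply: smoothV => //; last exact: smooth_det.
  by move=> x /uA; rewrite unitmxE unitfE.
apply: smoothM => //; first exact: smooth_cst.
apply: smooth_det => a b.
by apply: (smooth_eq (F := fun x => A x (lift j a) (lift i b))) => // x _; rewrite !mxE.
Qed.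

Variables (k : nat) (g : 'rV[R]_n -> 'M[R]_k).
Hypothesis sg : forall i j, smooth_on U (fun x => g x i j).
Hypothesis ug : forall x, U x -> g x \in unitmx.

(** Differentiating g^-1 g = 1 gives (d g^-1) g = - g^-1 dg; then [g] is cancelled on the right. *)
Lemma pder_invmx m i j x : U x ->
  pder m (fun y => invmx (g y) i j) x =
  - \sum_a \sum_b invmx (g x) i a * pder m (fun y => g y a b) x * invmx (g x) b j.
Proof.
move=> Ux.
pose dg : 'M[R]_k := \matrix_(a, b) pder m (fun y => g y a b) x.
pose dH : 'M[R]_k := \matrix_(a, b) pder m (fun y => invmx (g y) a b) x.
have sH a b : smooth_on U (fun y => invmx (g y) a b) by exact: smooth_invmx.
have E : dH *m g x = - (invmx (g x) *m dg).
  apply/eqP; rewrite -addr_eq0; apply/eqP/matrixP => a b; rewrite !mxE.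
  transitivity (pder m (fun y => \sum_c invmx (g y) a c * g y c b) x).
    rewrite (pder_sum _ oU Ux); last by move=> c; exact: smoothM.
    rewrite -big_split; apply: eq_bigr => c _ /=.
    rewrite !mxE pderM //; [exact: smooth_pderivable (sH _ _) Ux
                           |exact: smooth_pderivable (sg _ _) Ux].
  rewrite (pder_eq _ (G := fun=> (1%:M : 'M[R]_k) a b) oU _ Ux) ?pder_cst //.
  by move=> y Uy; rewrite -(mulVmx (ug Uy)) mxE.
have -> : pder m (fun y => invmx (g y) i j) x = dH i j by rewrite mxE.
have -> : dH = - (invmx (g x) *m dg *m invmx (g x)).
  by rewrite -mulNmx -E mulmxK // ug.
rewrite mxE; congr (- _); rewrite mxE exchange_big /=.
apply: eq_bigr => b _; rewrite mxE big_distrl /=.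
by apply: eq_bigr => a _; rewrite mxE.
Qed.

End MatrixFunctions.

(** Separates the four blocks of the Ricci formula, so that Ricci tensors can be compared block by
    block. *)
Lemma ricci_terms_eq (R : realType) (a a' b b' c c' d d' : R) :
  a = a' -> b = b' -> c = c' -> d = d' -> a - b + c - d = a' - b' + c' - d'.
Proof. by move=> -> -> -> ->. Qed.

Section Curvature.
Variables (R : realType) (n : nat) (U : set 'rV[R]_n).
Hypothesis oU : open U.
Variable g : 'rV[R]_n -> 'M[R]_n.
Hypothesis sg : forall i j, smooth_on U (fun x => g x i j).
Hypothesis ug : forall x, U x -> g x \in unitmx.

(** Twice the Christoffel symbol of the first kind; [christoffel] is half of it with the index l
    raised. *)
Definition lowered_christoffel (i j l : 'I_n) x : R :=
  pder i (fun y => g y j l) x + pder j (fun y => g y i l) x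
     - pder l (fun y => g y i j) x.

Lemma smooth_lowered i j l : smooth_on U (lowered_christoffel i j l).
Proof. by apply: smoothB => //; [apply: smoothD => //|]; exact: smooth_pder. Qed.

Lemma smooth_christoffel k i j : smooth_on U (christoffel g k i j).
Proof.
apply: smoothM => //; first exact: smooth_cst.
apply: smooth_sum => // l _; apply: smoothM => //; last exact: smooth_lowered.
exact: smooth_invmx.
Qed.

Lemma smooth_ricci j k : smooth_on U (fun x => ricci g x j k).
Proof.
pose Gam := christoffel g.
apply: (smooth_eq (F := fun x =>
  \sum_i pder i (Gam i j k) x - \sum_i pder k (Gam i i j) x
   + \sum_i \sum_p Gam i i p x * Gam p j k x
   - \sum_i \sum_p Gam i k p x * Gam p i j x)) => //.
  by move=> x _; rewrite mxE.
have sG := smooth_christoffel.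
apply: smoothB => //; [apply: smoothD => //; first apply: smoothB => //|];
  apply: smooth_sum => // i _; (try exact: smooth_pder);
  by apply: smooth_sum => // p _; exact: smoothM.
Qed.

Hypothesis gT : forall x, U x -> (g x)^T = g x.

Lemma gram_sym x i j : U x -> g x i j = g x j i.
Proof. by move=> Ux; rewrite -{1}(gT Ux) mxE. Qed.

Lemma invmx_sym x i j : U x -> invmx (g x) i j = invmx (g x) j i.
Proof. by move=> Ux; rewrite -{1}(gT Ux) -trmx_inv mxE. Qed.

Lemma pder_gram_sym m i j x : U x ->
  pder m (fun y => g y i j) x = pder m (fun y => g y j i) x.
Proof. by move=> Ux; apply: (pder_eq _ oU) => // y /gram_sym. Qed.

Lemma christoffelC k i j x : U x -> christoffel g k i j x = christoffel g k j i x.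
Proof.
move=> Ux; congr (_ * _); apply: eq_bigr => l _; congr (_ * _).
by rewrite (pder_gram_sym l i j Ux); congr (_ - _); rewrite addrC.
Qed.

(** The other two terms of the symbol are antisymmetric in (i, l) and cancel against the symmetric
    inverse. What is left is the derivative of log sqrt |det g|. *)
Lemma trace_christoffel j x : U x -> \sum_i christoffel g i i j x =
  2^-1 * \sum_i \sum_l invmx (g x) i l * pder j (fun y => g y i l) x.
Proof.
move=> Ux; rewrite -mulr_sumr; congr (_ * _).
transitivity (\sum_i \sum_l (invmx (g x) i l * pder j (fun y => g y i l) x
   + (invmx (g x) i l * pder i (fun y => g y j l) x
      - invmx (g x) l i * pder l (fun y => g y j i) x))).
  apply: eq_bigr => i _; apply: eq_bigr => l _.
  by rewrite (invmx_sym l i Ux) (pder_gram_sym l j i Ux); ring.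
under eq_bigr => i _ do rewrite big_split /=.
rewrite big_split /= [X in _ + X](_ : _ = 0) ?addr0 //.
under eq_bigr => i _ do rewrite sumrB.
by rewrite sumrB [X in _ - X]exchange_big subrr.
Qed.

(** The traced symbol is a gradient, so its derivatives commute. Instead of introducing the
    logarithm of the determinant, the derivative of the trace formula is expanded: one part has
    second derivatives of [g], the other is quadratic in first derivatives. *)
Lemma pder_trace_christoffelC j k x : U x ->
  \sum_i pder k (christoffel g i i j) x = \sum_i pder j (christoffel g i i k) x.
Proof.
move=> Ux.
have sH a b : smooth_on U (fun y => invmx (g y) a b) by exact: smooth_invmx.
have E p q : \sum_i pder q (christoffel g i i p) x = 2^-1 *
   (\sum_i \sum_l invmx (g x) i l * pder q (pder p (fun y => g y i l)) x
   - \sum_i \sum_l \sum_a \sum_b invmx (g x) i a * pder q (fun y => g y a b) x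
      * invmx (g x) b l * pder p (fun y => g y i l) x).
  rewrite -(pder_sum _ oU Ux); last by move=> i; exact: smooth_christoffel.
  have sM i l : smooth_on U (fun y => invmx (g y) i l * pder p (fun z => g z i l) y).
    by apply: smoothM => //; exact: smooth_pder.
  have sS i : smooth_on U (fun y => \sum_l invmx (g y) i l * pder p (fun z => g z i l) y).
    by apply: smooth_sum.
  rewrite (pder_eq _ oU (@trace_christoffel p) Ux).
  rewrite pderM; [|exact: derivable_cst|]; last first.
    by apply: (smooth_pderivable _ Ux); exact: smooth_sum.
  rewrite pder_cst mul0r add0r; congr (_ * _); rewrite -sumrB.
  rewrite (pder_sum _ oU Ux) //; apply: eq_bigr => i _; rewrite -sumrB.
  rewrite (pder_sum _ oU Ux) //; apply: eq_bigr => l _.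
  rewrite pderM; [|exact: smooth_pderivable (sH _ _) Ux|]; last first.
    exact: smooth_pderivable (smooth_pder p (sg _ _)) Ux.
  rewrite (pder_invmx oU sg ug _ _ _ Ux) mulNr addrC; congr (_ - _).
  by rewrite mulr_suml; apply: eq_bigr => a _; rewrite mulr_suml.
apply: etrans (E j k) (etrans _ (esym (E k j))).
apply: (congr1 (fun c => 2^-1 * c)).
apply: (f_equal2 (fun b c => b - c)).
  by apply: eq_bigr => i _; apply: eq_bigr => l _; rewrite (pderC _ _ oU (sg i l) Ux).
(* In the quadratic part, exchanging the pairs (i, l) and (a, b) swaps the roles of j and k. *)
under eq_bigr => i _ do rewrite exchange_big /=.
rewrite exchange_big /=; apply: eq_bigr => a _.
under eq_bigr => i _ do rewrite exchange_big /=.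
rewrite exchange_big /=; apply: eq_bigr => b _.
apply: eq_bigr => i _; apply: eq_bigr => l _.
by rewrite (invmx_sym i a Ux) (invmx_sym b l Ux); ring.
Qed.

(** Three blocks are symmetric through the symmetry of the symbols in their lower indices, the last
    one after exchanging i and p. The derivative of the trace needs [pder_trace_christoffelC]. *)
Lemma ricci_sym x : U x -> (ricci g x)^T = ricci g x.
Proof.
move=> Ux; apply/matrixP => k j; rewrite !mxE; apply: ricci_terms_eq.
- apply: eq_bigr => i _; apply: (pder_eq _ oU) => // y Uy; exact: christoffelC.
- exact: pder_trace_christoffelC.
- apply: eq_bigr => i _; apply: eq_bigr => p _.
  by apply: (congr1 (fun c => _ * c)); exact: christoffelC.
- rewrite exchange_big /=; apply: eq_bigr => i _; apply: eq_bigr => p _.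
  by rewrite (christoffelC p k i Ux) (christoffelC i p j Ux) mulrC.
Qed.

End Curvature.

(** * Walker metrics *)

Section VerticalInvariance.
Variables (R : realType) (n : nat) (V : pred 'I_n) (U : set 'rV[R]_n).
Hypothesis oU : open U.
Implicit Types (F G : 'rV[R]_n -> R).

(** Constancy along the leaves in infinitesimal form, which makes sense on an open set of any
    shape. *)
Definition vertical_inv F :=
  smooth_on U F /\ forall c, V c -> forall x, U x -> pder c F x = 0.

Lemma pder_zero F i x : (forall y, U y -> F y = 0) -> U x -> pder i F x = 0.
Proof. by move=> F0 Ux; rewrite (pder_eq _ oU F0 Ux) pder_cst. Qed.

Lemma vinv_eq F G : (forall y, U y -> F y = G y) -> vertical_inv F -> vertical_inv G.
Proof.
move=> FG [sF F0]; split; first exact: smooth_eq FG sF.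
by move=> c Vc x Ux; rewrite -(F0 c Vc x Ux); apply: (pder_eq _ oU) => // y /FG.
Qed.

Lemma vinv_cst (c : R) : vertical_inv (fun=> c).
Proof. by split; [exact: smooth_cst | move=> i _ x _; rewrite pder_cst]. Qed.

Lemma vinv_zero F : (forall y, U y -> F y = 0) -> vertical_inv F.
Proof. by move=> F0; apply: vinv_eq (vinv_cst 0) => y /F0. Qed.

Lemma vinvD F G : vertical_inv F -> vertical_inv G -> vertical_inv (fun x => F x + G x).
Proof.
move=> [sF F0] [sG G0]; split; first exact: smoothD.
move=> c Vc x Ux; rewrite pderD ?F0 ?G0 ?addr0 //; exact: smooth_pderivable Ux.
Qed.

Lemma vinvM F G : vertical_inv F -> vertical_inv G -> vertical_inv (fun x => F x * G x).
Proof.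
move=> [sF F0] [sG G0]; split; first exact: smoothM.
move=> c Vc x Ux; rewrite pderM ?F0 ?G0 ?mul0r ?mulr0 ?addr0 //;
  exact: smooth_pderivable Ux.
Qed.

Lemma vinvN F : vertical_inv F -> vertical_inv (fun x => - F x).
Proof.
move=> F0; apply: vinv_eq (vinvM (vinv_cst (-1)) F0) => y _; exact: mulN1r.
Qed.

Lemma vinvB F G : vertical_inv F -> vertical_inv G -> vertical_inv (fun x => F x - G x).
Proof. by move=> vF vG; apply: vinvD => //; exact: vinvN. Qed.

Lemma vinv_sum (I : finType) (F : I -> 'rV[R]_n -> R) :
  (forall i, vertical_inv (F i)) -> vertical_inv (fun x => \sum_i F i x).
Proof.
move=> vF; split; first by apply: smooth_sum => // i _; case: (vF i).
move=> c Vc x Ux; rewrite (pder_sum _ oU Ux); last by move=> i; case: (vF i).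
by apply: big1 => i _; case: (vF i) => _; exact.
Qed.

(** Coordinate fields commute, so derivatives in nonvertical directions keep the invariance as
    well. *)
Lemma vinv_pder i F : vertical_inv F -> vertical_inv (pder i F).
Proof.
move=> [sF F0]; split; first exact: smooth_pder.
move=> c Vc x Ux; rewrite (pderC _ _ oU sF Ux).
by apply: pder_zero Ux => y; exact: F0.
Qed.

Lemma vinv_smooth F : vertical_inv F -> smooth_on U F.
Proof. by case. Qed.

End VerticalInvariance.

Section Walker.
Variables (R : realType) (n : nat) (V : pred 'I_n) (U : set 'rV[R]_n).
Hypothesis oU : open U.
Implicit Types (g h : 'rV[R]_n -> 'M[R]_n).
Local Notation vinv := (vertical_inv V U).

(* The fields d/dx^i with V i span an integrable null distribution equal to its
   own orthogonal (aw_null, aw_conull), and g is affine along its leaves. *)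
Record affine_walker g : Prop := AffineWalker {
  aw_smooth : forall i j, smooth_on U (fun x => g x i j);
  aw_sym : forall x, U x -> (g x)^T = g x;
  aw_unit : forall x, U x -> g x \in unitmx;
  aw_null : forall i j x, V i -> V j -> U x -> g x i j = 0;
  aw_conull : forall i j x, ~~ V i -> ~~ V j -> U x -> invmx (g x) i j = 0;
  aw_mixed : forall i j, V j -> vinv (fun x => g x i j);
  aw_affine : forall c i j, V c -> vinv (pder c (fun x => g x i j)) }.

Record horizontal h : Prop := Horizontal {
  hor_inv : forall i j, vinv (fun x => h x i j);
  hor_sym : forall x, U x -> (h x)^T = h x;
  hor_block : forall i j x, V i -> U x -> h x i j = 0 }.

Lemma hor_blockr h i j x : horizontal h -> V j -> U x -> h x i j = 0.
Proof. by move=> hh Vj Ux; rewrite -(hor_sym hh Ux) mxE (hor_block hh). Qed.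

Section Lowered.
Variable g : 'rV[R]_n -> 'M[R]_n.
Hypothesis wg : affine_walker g.
Local Notation H i j := (fun x => invmx (g x) i j).
Local Notation low := (lowered_christoffel g).
Local Notation Gam := (christoffel g).

Let sg := aw_smooth wg.
Let ug := aw_unit wg.

Lemma aw_mixedl i j : V i -> vinv (fun x => g x i j).
Proof.
move=> Vi; apply: (vinv_eq oU _ (aw_mixed wg j Vi)) => y Uy.
exact: (gram_sym (aw_sym wg) _ _ Uy).
Qed.

(** In d g^-1 = - g^-1 dg g^-1 along V, only components of [dg] with both indices nonvertical
    survive, and a nonvertical [i] or [j] meets them through a zero entry of the inverse. Hence only
    the vertical block of the inverse can vary along the leaves. *)
Lemma aw_inv_vinv i j : ~~ V i \/ ~~ V j -> vinv (H i j).
Proof.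
move=> Vij; split; first exact: smooth_invmx.
move=> c Vc x Ux; rewrite (pder_invmx oU sg ug) //.
apply/eqP; rewrite oppr_eq0; apply/eqP.
apply: big1 => a _; apply: big1 => b _.
have [Va|nVa] := boolP (V a).
  by rewrite (aw_mixedl b Va).2 // mulr0 mul0r.
have [Vb|nVb] := boolP (V b).
  by rewrite (aw_mixed wg a Vb).2 // mulr0 mul0r.
case: Vij => nV; last by rewrite (aw_conull wg nVb nV) // mulr0.
by rewrite (aw_conull wg nV nVa) // !mul0r.
Qed.

(** The condition says that at least two of the three indices are vertical. In each term, either one
    of them differentiates a component carrying the other, which is zero by [aw_mixed], or both
    index the component, which is zero by [aw_null]. *)
Lemma aw_low0 i j l x : V i && V l || V j && V l || V i && V j -> U x -> low i j l x = 0.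
Proof.
move=> Vijl Ux; rewrite /lowered_christoffel.
have z a b c : V a && V b || V a && V c || V b && V c ->
    pder a (fun y => g y b c) x = 0.
  case/orP => [/orP[] /andP[Va Vb]|/andP[Vb Vc]].
  - exact: (aw_mixedl c Vb).2.
  - exact: (aw_mixed wg b Vb).2.
  - by apply: (pder_zero oU) Ux => y; exact: aw_null.
by rewrite !z ?addr0 ?subrr //; move: Vijl; case: (V i); case: (V j); case: (V l).
Qed.

Lemma aw_low_vinv i j l : V i || V j || V l -> vinv (low i j l).
Proof.
move=> Vijl; have z a b c : V a || V b || V c -> vinv (pder a (fun y => g y b c)).
  case/orP => [/orP[]|] Va; first exact: (aw_affine wg).
    by apply: (vinv_pder oU); exact: aw_mixedl.
  by apply: (vinv_pder oU); exact: (aw_mixed wg).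
by apply: (vinvB oU); [apply: (vinvD oU)|]; apply: z; move: Vijl; case: (V i); case: (V j); case: (V l).
Qed.

(* Together with christoffel_vv: the leaves are totally geodesic and the
   distribution is parallel. *)
Lemma christoffel_h0 k i j x : ~~ V k -> V i || V j -> U x -> Gam k i j x = 0.
Proof.
move=> nVk Vij Ux; rewrite /christoffel big1 ?mulr0 // => l _.
have [Vl|nVl] := boolP (V l); last by rewrite (aw_conull wg nVk nVl Ux) mul0r.
rewrite -/(low i j l x) (aw_low0 (i:=i)) ?mulr0 // Vl !andbT.
by rewrite Vij.
Qed.

Lemma christoffel_vv k i j x : V i -> V j -> U x -> Gam k i j x = 0.
Proof.
move=> Vi Vj Ux; rewrite /christoffel big1 ?mulr0 // => l _.
by rewrite -/(low i j l x) (aw_low0 (i:=i)) ?mulr0 // Vi Vj !orbT.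
Qed.

Lemma christoffel_trace0 i j x : V j -> U x -> Gam i i j x = 0.
Proof.
move=> Vj Ux; have [Vi|nVi] := boolP (V i); first exact: christoffel_vv.
by apply: christoffel_h0; rewrite // Vj orbT.
Qed.

(** The factor [H k l] varies along the leaves only if k and l are vertical. The lowered symbol then
    has two vertical indices, since i or j is vertical in that case, and vanishes. *)
Lemma christoffel_vinv k i j : ~~ V k || V i || V j -> vinv (Gam k i j).
Proof.
move=> Vkij; apply: (vinvM oU) (vinv_cst _ _ _) _; apply: (vinv_sum oU) => l.
have [Vk|nVk] := boolP (V k); last first.
  have [Vl|nVl] := boolP (V l); last first.
    by apply: (vinv_zero _ oU) => y Uy; rewrite (aw_conull wg nVk nVl Uy) mul0r.
  by apply: (vinvM oU); [apply: aw_inv_vinv; left|apply: aw_low_vinv; rewrite Vl orbT].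
have {}Vkij : V i || V j by rewrite Vk in Vkij.
have [Vl|nVl] := boolP (V l); last first.
  by apply: (vinvM oU); [apply: aw_inv_vinv; right|apply: aw_low_vinv; rewrite Vkij].
apply: (vinv_zero _ oU) => y Uy; rewrite -/(low i j l y) (aw_low0 _ Uy) ?mulr0 //.
by rewrite Vl !andbT Vkij.
Qed.

(** Every term vanishes separately: it contains a symbol with nonvertical upper and vertical lower
    index, a symbol with two vertical lower indices, or an entry [Gam i i j] with [V j], or else it
    is a vertical derivative of a symbol constant along the leaves. *)
Lemma ricci_vertical j k x : V j || V k -> U x -> ricci g x j k = 0.
Proof.
move=> Vjk Ux; rewrite mxE [RHS](_ : 0 = 0 - 0 + 0 - 0); last by rewrite !subr0 addr0.
apply: ricci_terms_eq.
- apply: big1 => i _.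
  have [Vi|nVi] := boolP (V i).
    by apply: (christoffel_vinv _).2 => //; rewrite -orbA Vjk orbT.
  by apply: (pder_zero oU) Ux => y Uy; exact: christoffel_h0.
- apply: big1 => i _; have [Vj|nVj] := boolP (V j).
    by apply: (pder_zero oU) Ux => y Uy; exact: christoffel_trace0.
  move: Vjk; rewrite (negbTE nVj) /= => Vk.
  by apply: (christoffel_vinv _).2 => //; case: (V i).
- apply: big1 => i _; apply: big1 => p _; have [Vp|nVp] := boolP (V p).
    by rewrite (christoffel_trace0 _ Vp Ux) mul0r.
  by rewrite (christoffel_h0 nVp Vjk Ux) mulr0.
apply: big1 => i _; apply: big1 => p _.
have [Vi|nVi] := boolP (V i).
  have [Vp|nVp] := boolP (V p); last first.
    by rewrite [Gam p _ _ _]christoffel_h0 ?mulr0 // Vi.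
  case/orP : Vjk => [Vj|Vk]; first by rewrite [Gam p _ _ _]christoffel_vv ?mulr0.
  by rewrite christoffel_vv ?mul0r.
have [Vp|nVp] := boolP (V p).
  by rewrite christoffel_h0 ?mul0r // Vp orbT.
case/orP : Vjk => [Vj|Vk]; last by rewrite christoffel_h0 ?mul0r // Vk.
by rewrite [Gam p _ _ _]christoffel_h0 ?mulr0 // Vj orbT.
Qed.

(** Ric is confined to the nonvertical block, which is where the inverse metric is zero. *)
Lemma scal_walker x : U x -> scal g x = 0.
Proof.
move=> Ux; rewrite /scal /mxtrace big1 // => i _; rewrite mxE big1 // => j _.
have [Vj|nVj] := boolP (V j); first by rewrite ricci_vertical ?mulr0 // Vj.
have [Vi|nVi] := boolP (V i); first by rewrite ricci_vertical ?mulr0 // Vi orbT.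
by rewrite (aw_conull wg nVi nVj Ux) mul0r.
Qed.

End Lowered.
End Walker.

Lemma mulmx1_invmx (R : comUnitRingType) n (A B : 'M[R]_n) :
  A *m B = 1%:M -> A \in unitmx /\ invmx A = B.
Proof.
move=> AB; have [uA _] := mulmx1_unit AB; split=> //.
by rewrite -[RHS](mulKmx uA) AB mulmx1.
Qed.

(** * Adding a horizontal tensor to a Walker metric *)

Section HorizontalPerturbation.
Variables (R : realType) (n : nat) (V : pred 'I_n) (U : set 'rV[R]_n).
Hypothesis oU : open U.
Variables g h : 'rV[R]_n -> 'M[R]_n.
Hypothesis wg : affine_walker V U g.
Hypothesis hh : horizontal V U h.
Local Notation vinv := (vertical_inv V U).
Local Notation gh := (fun x => g x + h x).
Local Notation H i j x := (invmx (g x) i j).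
Local Notation K i j x := ((invmx (g x) *m h x *m invmx (g x)) i j).

Let sg := aw_smooth wg.
Let ug := aw_unit wg.
Let sh i j := vinv_smooth (hor_inv hh i j).

Lemma horizontal_sandwich x : U x -> h x *m invmx (g x) *m h x = 0.
Proof.
move=> Ux; apply/matrixP => i j; rewrite !mxE big1 // => b _.
rewrite mxE; have [Vb|nVb] := boolP (V b); first by rewrite (hor_block hh) ?mulr0.
rewrite big1 ?mul0r // => a _.
have [Va|nVa] := boolP (V a); first by rewrite (hor_blockr _ hh) ?mul0r.
by rewrite (aw_conull wg) ?mulr0.
Qed.

(** The Neumann series of the inverse stops after the linear term because h g^-1 h = 0. *)
Lemma invmx_perturb x : U x -> g x + h x \in unitmx /\
  invmx (g x + h x) = invmx (g x) - invmx (g x) *m h x *m invmx (g x).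
Proof.
move=> Ux; apply: mulmx1_invmx.
rewrite mulmxBr !mulmxDl !mulmxA (mulmxV (ug Ux)) horizontal_sandwich //.
by rewrite mul1mx mul0mx addr0 addrK.
Qed.

Lemma invmx_perturbE i j x : U x -> invmx (g x + h x) i j = H i j x - K i j x.
Proof. by move=> Ux; rewrite (invmx_perturb Ux).2 !mxE. Qed.

Lemma sandwich_entry i j x : K i j x = \sum_b (\sum_a H i a x * h x a b) * H b j x.
Proof. by rewrite mxE; apply: eq_bigr => b _; rewrite mxE. Qed.

Lemma sandwich0 i j x : ~~ V i || ~~ V j -> U x -> K i j x = 0.
Proof.
move=> nV Ux; rewrite sandwich_entry big1 // => b _.
have [Vb|nVb] := boolP (V b).
  by rewrite big1 ?mul0r // => a _; rewrite (hor_blockr _ hh) ?mulr0.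
case/orP : nV => nV; last by rewrite (aw_conull wg nVb nV) // mulr0.
rewrite big1 ?mul0r // => a _.
have [Va|nVa] := boolP (V a); first by rewrite (hor_block hh) ?mulr0.
by rewrite (aw_conull wg nV nVa) // mul0r.
Qed.

(** The sum meets [h] at nonvertical indices only, so it uses only entries of the inverse that have
    a nonvertical index, and these are constant along the leaves. *)
Lemma sandwich_vinv i j : vinv (fun x => K i j x).
Proof.
apply: (vinv_eq oU (F := fun x => \sum_b (\sum_a H i a x * h x a b) * H b j x)).
  by move=> x _; rewrite sandwich_entry.
apply: (vinv_sum oU) => b.
have [Vb|nVb] := boolP (V b).
  apply: (vinv_zero _ oU) => x Ux.
  by rewrite big1 ?mul0r // => a _; rewrite (hor_blockr _ hh) ?mulr0.
apply: (vinvM oU); last by apply: (aw_inv_vinv oU wg); left.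
apply: (vinv_sum oU) => a; have [Va|nVa] := boolP (V a).
  by apply: (vinv_zero _ oU) => x Ux; rewrite (hor_block hh) ?mulr0.
by apply: (vinvM oU); [apply: (aw_inv_vinv oU wg); right|exact: hor_inv].
Qed.

Lemma pder_perturb m i j x : U x -> pder m (fun y => gh y i j) x =
  pder m (fun y => g y i j) x + pder m (fun y => h y i j) x.
Proof.
move=> Ux; rewrite -pderD; [|exact: smooth_pderivable (sg _ _) Ux
                            |exact: smooth_pderivable (sh _ _) Ux].
by apply: (pder_eq _ oU) => // y _; rewrite mxE.
Qed.

(** Walker metrics are stable under the perturbation, so all vanishing results above hold for g + h
    as well. *)
Lemma affine_walkerD : affine_walker V U gh.
Proof.
split.
- move=> i j; apply: (smooth_eq (F := fun x => g x i j + h x i j)) => //.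
    by move=> y _; rewrite mxE.
  exact: smoothD.
- by move=> x Ux; rewrite linearD /= (aw_sym wg) // (hor_sym hh).
- by move=> x /invmx_perturb[].
- by move=> i j x Vi Vj Ux; rewrite mxE (aw_null wg) // (hor_block hh) // addr0.
- move=> i j x nVi nVj Ux.
  by rewrite invmx_perturbE // sandwich0 ?nVi // (aw_conull wg) ?subr0.
- move=> i j Vj; apply: (vinv_eq oU (F := fun x => g x i j + h x i j)).
    by move=> y _; rewrite mxE.
  by apply: (vinvD oU); [exact: aw_mixed|exact: hor_inv].
- move=> c i j Vc.
  apply: (vinv_eq oU (F := fun x => pder c (fun y => g y i j) x
                                  + pder c (fun y => h y i j) x)).
    by move=> y Uy; rewrite pder_perturb.
  apply: (vinvD oU); first exact: (aw_affine wg).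
  by apply: (vinv_pder oU); exact: hor_inv.
Qed.

Local Notation low := (lowered_christoffel g).
Local Notation lowh := (lowered_christoffel h).

Lemma lowered_perturb i j l x : U x ->
  lowered_christoffel gh i j l x = low i j l x + lowh i j l x.
Proof.
by move=> Ux; rewrite /lowered_christoffel !pder_perturb //; ring.
Qed.

Lemma lowered_horizontal0 i j l x : V i || V j || V l -> U x -> lowh i j l x = 0.
Proof.
have z a b c : V a || V b || V c -> U x -> pder a (fun y => h y b c) x = 0.
  case/orP => [/orP[]|] Va Ux; first exact: (hor_inv hh b c).2.
  - by apply: (pder_zero oU) Ux => y; exact: (hor_block hh).
  - by apply: (pder_zero oU) Ux => y; exact: (hor_blockr _ hh).
move=> Vijl Ux; rewrite /lowered_christoffel !z ?addr0 ?subrr //;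
  by move: Vijl; case: (V i); case: (V j); case: (V l).
Qed.

Lemma lowered_horizontal_vinv i j l : vinv (lowh i j l).
Proof.
apply: (vinvB oU); [apply: (vinvD oU)|]; apply: (vinv_pder oU); exact: hor_inv.
Qed.

(** The difference tensor of the two Levi-Civita connections, with (H - K)(low + lowh) - H low
    expanded. *)
Definition christoffel_diff k i j x : R := 2^-1 * \sum_l
  (H k l x * lowh i j l x - K k l x * (low i j l x + lowh i j l x)).

Lemma christoffel_perturb k i j x : U x ->
  christoffel gh k i j x = christoffel g k i j x + christoffel_diff k i j x.
Proof.
move=> Ux; rewrite /christoffel /christoffel_diff -mulrDr -big_split /=.
apply: (congr1 (fun c => _ * c)); apply: eq_bigr => l _.
rewrite -/(lowered_christoffel gh i j l x) -/(low i j l x).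
by rewrite lowered_perturb // invmx_perturbE //; ring.
Qed.

(** Only symbols with vertical upper and two nonvertical lower indices change under the
    perturbation. *)
Lemma christoffel_diff0 k i j x : ~~ V k || V i || V j -> U x ->
  christoffel_diff k i j x = 0.
Proof.
move=> Vkij Ux; rewrite /christoffel_diff big1 ?mulr0 // => l _.
have [Vij|] := boolP (V i || V j).
  rewrite (lowered_horizontal0 _ Ux) ?Vij // mulr0 add0r addr0.
  have [Vl|nVl] := boolP (V l); last by rewrite sandwich0 ?nVl ?orbT // mul0r oppr0.
  by rewrite (aw_low0 oU wg) ?mulr0 ?oppr0 // Vl !andbT Vij.
rewrite negb_or => /andP[nVi nVj].
have nVk : ~~ V k by move: Vkij; rewrite (negbTE nVi) (negbTE nVj) !orbF.
rewrite sandwich0 ?nVk // mul0r subr0.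
have [Vl|nVl] := boolP (V l); last by rewrite (aw_conull wg) ?mul0r.
by rewrite lowered_horizontal0 ?mulr0 // Vl !orbT.
Qed.

Lemma christoffel_diff_vinv k i j : vinv (christoffel_diff k i j).
Proof.
apply: (vinvM oU) (vinv_cst _ _ _) _; apply: (vinv_sum oU) => l.
apply: (vinvB oU).
  have [Vl|nVl] := boolP (V l).
    apply: (vinv_zero _ oU) => x Ux.
    by rewrite lowered_horizontal0 ?mulr0 // Vl !orbT.
  apply: (vinvM oU); last exact: lowered_horizontal_vinv.
  by apply: (aw_inv_vinv oU wg); right.
have [Vl|nVl] := boolP (V l); last first.
  by apply: (vinv_zero _ oU) => x Ux; rewrite sandwich0 ?nVl ?orbT // mul0r.
apply: (vinvM oU); first exact: sandwich_vinv.
apply: (vinvD oU); last exact: lowered_horizontal_vinv.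
by apply: (aw_low_vinv oU wg); rewrite Vl !orbT.
Qed.

Lemma christoffel_perturb0 k i j x : ~~ V k || V i || V j -> U x ->
  christoffel gh k i j x = christoffel g k i j x.
Proof. by move=> Vkij Ux; rewrite christoffel_perturb // christoffel_diff0 ?addr0. Qed.

(** The changed symbols enter the divergence block through a vertical derivative, which kills their
    change. In the quadratic blocks they are always multiplied by a symbol that is zero for both
    metrics. *)
Lemma ricci_perturb x : U x -> ricci gh x = ricci g x.
Proof.
move=> Ux; apply/matrixP => j k; rewrite !mxE.
have wgh := affine_walkerD.
apply: ricci_terms_eq.
- apply: eq_bigr => i _; have [Vi|nVi] := boolP (V i); last first.
    by apply: (pder_eq _ oU) Ux => y Uy; rewrite christoffel_perturb0 ?nVi.
  rewrite (pder_eq i oU (@christoffel_perturb i j k) Ux) pderD.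
  + by rewrite (christoffel_diff_vinv i j k).2 ?addr0.
  + exact: smooth_pderivable (smooth_christoffel oU sg ug _ _ _) Ux.
  + exact: smooth_pderivable (vinv_smooth (christoffel_diff_vinv _ _ _)) Ux.
- apply: eq_bigr => i _; apply: (pder_eq _ oU) Ux => y Uy.
  by rewrite christoffel_perturb0 //; case: (V i).
- apply: eq_bigr => i _; apply: eq_bigr => p _.
  rewrite christoffel_perturb0 //; last by case: (V i).
  have [Vp|nVp] := boolP (V p); last by rewrite (christoffel_perturb0 _ Ux) ?nVp.
  by rewrite (christoffel_trace0 oU wg _ Vp Ux) !mul0r.
apply: eq_bigr => i _; apply: eq_bigr => p _.
have [Vi|nVi] := boolP (V i); have [Vp|nVp] := boolP (V p).
- by rewrite !(christoffel_perturb0 _ Ux) ?Vi ?Vp ?orbT.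
- rewrite (christoffel_h0 oU wg nVp _ Ux) ?Vi // (christoffel_h0 oU wgh nVp _ Ux) ?Vi //.
  by rewrite !mulr0.
- rewrite (christoffel_h0 oU wg nVi _ Ux) ?Vp ?orbT //.
  by rewrite (christoffel_h0 oU wgh nVi _ Ux) ?Vp ?orbT // !mul0r.
- by rewrite !(christoffel_perturb0 _ Ux) ?nVi ?nVp.
Qed.

End HorizontalPerturbation.

(** * Translations along the leaves *)

Section RicciTranslation.
Variables (R : realType) (n : nat).
Implicit Types (g : 'rV[R]_n -> 'M[R]_n) (v x : 'rV[R]_n).

Lemma christoffel_shift g v k i j x :
  christoffel (fun y => g (v + y)) k i j x = christoffel g k i j (v + x).
Proof.
rewrite /christoffel; apply: (congr1 (fun c => _ * c)); apply: eq_bigr => l _.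
apply: (congr1 (fun c => _ * c)); apply: (f_equal2 (fun b c => b - c)).
  by apply: (f_equal2 (fun b c => b + c));
    [exact: (pder_shift (fun y => g y j l))|exact: (pder_shift (fun y => g y i l))].
exact: (pder_shift (fun y => g y i j)).
Qed.

Lemma ricci_shift g v x : ricci (fun y => g (v + y)) x = ricci g (v + x).
Proof.
have shiftE k i j : christoffel (fun y => g (v + y)) k i j =
    fun x => christoffel g k i j (v + x).
  by apply/funext => y; exact: christoffel_shift.
apply/matrixP => j k; rewrite !mxE; apply: ricci_terms_eq; apply: eq_bigr => i _.
- by rewrite shiftE; exact: pder_shift.
- by rewrite shiftE; exact: pder_shift.
- by apply: eq_bigr => p _; rewrite !christoffel_shift.
- by apply: eq_bigr => p _; rewrite !christoffel_shift.
Qed.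

End RicciTranslation.

Section RicciVertical.
Variables (R : realType) (n : nat) (V : pred 'I_n) (U : set 'rV[R]_n).
Hypothesis oU : open U.
Variable g : 'rV[R]_n -> 'M[R]_n.
Hypothesis wg : affine_walker V U g.

(** Translating the metric by [s] along a vertical axis is a horizontal perturbation, which Ric does
    not see. The first hypothesis holds on all of R^n, so the perturbation lemma is applied at [x]
    itself and the translated point may leave [U]. *)
Lemma ricci_vinv (A : 'I_n -> 'rV[R]_n -> 'M[R]_n) :
  (forall c (s : R) y, V c -> g (s *: delta_mx 0 c + y) = g y + s *: A c y) ->
  (forall c (s : R), V c -> horizontal V U (fun y => s *: A c y)) ->
  forall j k, vertical_inv V U (fun x => ricci g x j k).
Proof.
move=> gA hA j k; split.
  exact: (smooth_ricci oU (aw_smooth wg) (aw_unit wg)).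
move=> c Vc x Ux; apply: pder_const_along => s.
have gs : (fun y => g (s *: delta_mx 0 c + y)) = fun y => g y + s *: A c y.
  by apply/funext => y; rewrite gA.
by rewrite -ricci_shift gs (ricci_perturb oU wg (hA c s Vc) Ux).
Qed.

End RicciVertical.

(** * Coordinates on R^8 *)

Definition xi (i : 'I_6) : 'I_8 := lift ord0 (widen_ord (leqnSn 6) i).

Lemma ind8 (P : 'I_8 -> Prop) : P at_ -> (forall i, P (xi i)) -> P arho ->
  forall a, P a.
Proof.
move=> Pt Px Pr a; have [j ->|->] := unliftP ord0 a; last first.
  by rewrite (_ : ord0 = at_) //; exact: val_inj.
have [k ->|->] := unliftP ord_max j; last first.
  by rewrite (_ : lift _ _ = arho) //; exact: val_inj.
have -> : lift ord_max k = widen_ord (leqnSn 6) k.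
  by apply: val_inj; rewrite /= /bump leqNgt ltn_ord.
exact: Px.
Qed.

Lemma sum8 (R : nmodType) (F : 'I_8 -> R) :
  \sum_a F a = F at_ + \sum_i F (xi i) + F arho.
Proof.
rewrite big_ord_recl big_ord_recr /= addrA.
by congr (F _ + _ + F _); exact: val_inj.
Qed.

Lemma xi_eq i j : (xi i == xi j) = (i == j).
Proof. by []. Qed.
Lemma xi_at i : (xi i == at_) = false. Proof. by []. Qed.
Lemma at_xi i : (at_ == xi i) = false. Proof. by []. Qed.
Lemma xi_arho i : (xi i == arho) = false.
Proof. by apply/eqP => /(congr1 val) /=; rewrite /bump /= => -[E]; have := ltn_ord i; rewrite -[nat_of_ord i]add0n E. Qed.
Lemma arho_xi i : (arho == xi i) = false. Proof. by rewrite eq_sym xi_arho. Qed.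
Definition ix8 := (xi_eq, xi_at, at_xi, xi_arho, arho_xi).

Section Coordinates8.
Variable R : realType.
Implicit Types (z : 'rV[R]_8) (y : 'rV[R]_6) (M : 'M[R]_6).
Local Notation X := (xmx R).

Lemma xmx_xi i j : X (xi i) j = (i == j)%:R. Proof. by rewrite mxE. Qed.
Lemma xmx_at j : X at_ j = 0. Proof. by rewrite mxE. Qed.
Lemma xmx_arho j : X arho j = 0.
Proof.
rewrite mxE; case: eqP => // /= E; have := ltn_ord j.
by case: (j) E => k /= _ [<-].
Qed.

Lemma xpartE z j : xpart z 0 j = z 0 (xi j).
Proof.
rewrite mxE sum8 xmx_at xmx_arho !mulr0 add0r addr0 (bigD1 j) //= xmx_xi eqxx mulr1.
by rewrite big1 ?addr0 // => k /negbTE kj; rewrite xmx_xi kj mulr0.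
Qed.

Lemma xpart_affine (h : R) z1 z2 : xpart (h *: z1 + z2) = h *: xpart z1 + xpart z2.
Proof. by rewrite /xpart mulmxDl -scalemxAl. Qed.

Lemma xpart_xi i : xpart (delta_mx 0 (xi i)) = delta_mx 0 i :> 'rV[R]_6.
Proof. by apply/rowP => j; rewrite xpartE !mxE eqxx ix8 eq_sym. Qed.
Lemma xpart_at : xpart (delta_mx 0 at_) = 0 :> 'rV[R]_6.
Proof. by apply/rowP => j; rewrite xpartE !mxE eqxx ix8. Qed.
Lemma xpart_arho : xpart (delta_mx 0 arho) = 0 :> 'rV[R]_6.
Proof. by apply/rowP => j; rewrite xpartE !mxE eqxx ix8. Qed.

Lemma xpart_cont : continuous (@xpart R).
Proof. exact: continuous_mulmxr. Qed.

Lemma xpart_basis a : xpart (delta_mx 0 a) = 0 :> 'rV[R]_6 \/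
  exists j, xpart (delta_mx 0 a) = delta_mx 0 j :> 'rV[R]_6.
Proof.
elim/ind8: a => [|i|]; first by left; exact: xpart_at.
  by right; exists i; exact: xpart_xi.
by left; exact: xpart_arho.
Qed.

Lemma trX_mulX : X^T *m X = 1%:M.
Proof.
apply/matrixP => i j; rewrite mxE sum8 ![X^T _ _]mxE xmx_at xmx_arho !mul0r add0r addr0.
rewrite (bigD1 i) //= [X^T _ _]mxE !xmx_xi eqxx mul1r big1 ?addr0 ?mxE //.
by move=> k /negbTE ki; rewrite mxE xmx_xi ki mul0r.
Qed.

(* The affine embedding y |-> (t, y, rho) with t and rho those of z. *)
Definition slice z y : 'rV[R]_8 := y *m X^T + (z - xpart z *m X^T).

Lemma slice_self z : slice z (xpart z) = z.
Proof. by rewrite /slice addrCA subrr addr0. Qed.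

Lemma trX_at y : (y *m X^T) 0 at_ = 0.
Proof. by rewrite mxE big1 // => j _; rewrite mxE xmx_at mulr0. Qed.
Lemma trX_arho y : (y *m X^T) 0 arho = 0.
Proof. by rewrite mxE big1 // => j _; rewrite mxE xmx_arho mulr0. Qed.

Let rV_addB (u v w : 'rV[R]_8) a : (u + (v - w)) 0 a = u 0 a + (v 0 a - w 0 a).
Proof. by rewrite !mxE. Qed.

Lemma rhopart_slice z y : rhopart (slice z y) = rhopart z.
Proof. by rewrite /rhopart /slice rV_addB !trX_arho add0r subr0. Qed.

Lemma xpart_slice z y : xpart (slice z y) = y.
Proof.
by rewrite /xpart /slice mulmxDl mulmxBl -!mulmxA trX_mulX !mulmx1 subrr addr0.
Qed.

Lemma slice_slice z y : slice (slice z y) = slice z.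
Proof.
by apply/funext => y'; rewrite /slice -/(slice z y) xpart_slice /slice addrAC subrr add0r.
Qed.

Lemma slice_affine z (h : R) y1 y2 :
  slice z (h *: y1 + y2) = h *: (y1 *m X^T) + slice z y2.
Proof. by rewrite /slice mulmxDl -scalemxAl -addrA. Qed.

Lemma trX_delta i : delta_mx 0 i *m X^T = delta_mx 0 (xi i) :> 'rV[R]_8.
Proof.
apply/rowP => a; rewrite mxE (bigD1 i) //= big1 ?addr0 => [|k /negbTE ki]; last first.
  by rewrite !mxE ki andbF mul0r.
rewrite !mxE !eqxx mul1r; elim/ind8: a => [|j|].
- by rewrite ix8.
- by rewrite ix8.
- by rewrite ix8; have := xmx_arho i; rewrite mxE.
Qed.

Lemma slice_cont z : continuous (slice z).
Proof.
move=> y; apply: (@continuousD _ _ _ (fun y => y *m X^T) (fun=> z - xpart z *m X^T)).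
  exact: continuous_mulmxr.
exact: cst_continuous.
Qed.

(** Reduces x-derivatives on R^8 to derivatives on R^6 with t and rho frozen, where the Walker
    results apply. *)
Lemma pder_xi F i z : pder (xi i) F z = pder i (fun y => F (slice z y)) (xpart z).
Proof.
rewrite -[in LHS](slice_self z); symmetry.
exact: (pder_comp (slice_affine z) _ _ (trX_delta i)).
Qed.

Lemma smooth_slice (W : set 'rV[R]_8) z F : smooth_on W F ->
  smooth_on [set y | W (slice z y)] (fun y => F (slice z y)).
Proof.
apply: (smooth_comp (slice_affine z)) => //; first exact: slice_cont.
by move=> i; right; exists (xi i); exact: trX_delta.
Qed.

Lemma open_slice (W : set 'rV[R]_8) z : open W -> open [set y | W (slice z y)].
Proof. by apply: open_comp => y _; exact: slice_cont. Qed.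

(** Block form: [a], [b], [c] are the (t, t), (t, rho), (rho, rho) entries, [M] is the x-block, and
    x does not mix with t and rho. *)
Definition mx8 (a b c : R) M : 'M[R]_8 :=
  a *: ((delta_mx 0 at_ : 'rV[R]_8)^T *m (delta_mx 0 at_ : 'rV[R]_8))
  + b *: ((delta_mx 0 at_ : 'rV[R]_8)^T *m (delta_mx 0 arho : 'rV[R]_8)
          + (delta_mx 0 arho : 'rV[R]_8)^T *m (delta_mx 0 at_ : 'rV[R]_8))
  + c *: ((delta_mx 0 arho : 'rV[R]_8)^T *m (delta_mx 0 arho : 'rV[R]_8))
  + X *m M *m X^T.

Lemma delta_rr (a b p q : 'I_8) :
  ((delta_mx 0 a : 'rV[R]_8)^T *m (delta_mx 0 b : 'rV[R]_8)) p q =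
  (p == a)%:R * (q == b)%:R.
Proof. by rewrite mxE big_ord1 !mxE. Qed.

Lemma congX_entry M a b : (X *m M *m X^T) a b = \sum_j (\sum_i X a i * M i j) * X b j.
Proof. by rewrite mxE; apply: eq_bigr => j _; rewrite !mxE. Qed.

Lemma congX_xi M i j : (X *m M *m X^T) (xi i) (xi j) = M i j.
Proof.
rewrite congX_entry (bigD1 j) //= xmx_xi eqxx mulr1 [X in _ + X]big1 ?addr0; last first.
  by move=> k /negbTE kj; rewrite xmx_xi eq_sym kj mulr0.
rewrite (bigD1 i) //= xmx_xi eqxx mul1r big1 ?addr0 // => k /negbTE ki.
by rewrite xmx_xi eq_sym ki mul0r.
Qed.

Lemma congX_atl M b : (X *m M *m X^T) at_ b = 0.
Proof.
by rewrite congX_entry big1 // => j _; rewrite big1 ?mul0r // => i _; rewrite xmx_at mul0r.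
Qed.
Lemma congX_arhol M b : (X *m M *m X^T) arho b = 0.
Proof.
by rewrite congX_entry big1 // => j _; rewrite big1 ?mul0r // => i _; rewrite xmx_arho mul0r.
Qed.
Lemma congX_atr M a : (X *m M *m X^T) a at_ = 0.
Proof. by rewrite congX_entry big1 // => j _; rewrite xmx_at mulr0. Qed.
Lemma congX_arhor M a : (X *m M *m X^T) a arho = 0.
Proof. by rewrite congX_entry big1 // => j _; rewrite xmx_arho mulr0. Qed.

Lemma mx8_entry a b c M p q : mx8 a b c M p q =
  a * ((p == at_)%:R * (q == at_)%:R) +
  b * ((p == at_)%:R * (q == arho)%:R + (p == arho)%:R * (q == at_)%:R) +
  c * ((p == arho)%:R * (q == arho)%:R) + (X *m M *m X^T) p q.
Proof.
rewrite /mx8; set C := X *m M *m X^T.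
by rewrite !mxE -!delta_rr !mxE.
Qed.

Lemma mx8_tt a b c M : mx8 a b c M at_ at_ = a.
Proof. by rewrite mx8_entry congX_atl /= !mulr1 !mulr0 !addr0 !mulr0 !addr0. Qed.
Lemma mx8_tr a b c M : mx8 a b c M at_ arho = b.
Proof. by rewrite mx8_entry congX_atl /= !(mulr1, mulr0, mul0r, addr0, add0r). Qed.
Lemma mx8_rt a b c M : mx8 a b c M arho at_ = b.
Proof. by rewrite mx8_entry congX_arhol /= !(mulr1, mulr0, mul0r, addr0, add0r). Qed.
Lemma mx8_rr a b c M : mx8 a b c M arho arho = c.
Proof. by rewrite mx8_entry congX_arhol /= !(mulr1, mulr0, mul0r, addr0, add0r). Qed.
Lemma mx8_tx a b c M i : mx8 a b c M at_ (xi i) = 0.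
Proof. by rewrite mx8_entry congX_atl !ix8 !(mulr1, mulr0, mul0r, addr0, add0r). Qed.
Lemma mx8_xt a b c M i : mx8 a b c M (xi i) at_ = 0.
Proof. by rewrite mx8_entry congX_atr !ix8 !(mulr1, mulr0, mul0r, addr0, add0r). Qed.
Lemma mx8_rx a b c M i : mx8 a b c M arho (xi i) = 0.
Proof. by rewrite mx8_entry congX_arhol !ix8 !(mulr1, mulr0, mul0r, addr0, add0r). Qed.
Lemma mx8_xr a b c M i : mx8 a b c M (xi i) arho = 0.
Proof. by rewrite mx8_entry congX_arhor !ix8 !(mulr1, mulr0, mul0r, addr0, add0r). Qed.
Lemma mx8_xx a b c M i j : mx8 a b c M (xi i) (xi j) = M i j.
Proof. by rewrite mx8_entry congX_xi !ix8 !(mulr1, mulr0, mul0r, addr0, add0r). Qed.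

Definition mx8E :=
  (mx8_tt, mx8_tr, mx8_rt, mx8_rr, mx8_tx, mx8_xt, mx8_rx, mx8_xr, mx8_xx).

(** 2 d(rho t) dt = 2 rho dt^2 + 2 t dt drho, and the symmetric product distributes 2 t over two
    off-diagonal entries. *)
Lemma ambient_formE (g : 'rV[R]_6 -> R -> 'M[R]_6) z : ambient_form g z =
  mx8 (2 * rhopart z) (tpart z) 0 (tpart z ^+ 2 *: g (xpart z) (rhopart z)).
Proof.
rewrite /ambient_form /mx8 /sprod scale0r addr0 -scalemxAr -scalemxAl; congr (_ + _).
rewrite scalerA divff ?pnatr_eq0 // scale1r.
rewrite linearD /= !linearZ /= mulmxDl mulmxDr -!scalemxAl -!scalemxAr.
rewrite scalerDr (mulrDl 1 1 (rhopart z)) mul1r scalerDl.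
by rewrite addrACA [X in _ + X]addrC.
Qed.

(** The (t, rho) block has rows (2r, t) and (t, 0), with inverse rows (0, 1/t) and (1/t,
    -2r/t^2). *)
Lemma mx8_inv (t r : R) M N : t != 0 -> M *m N = 1%:M ->
  mx8 (2 * r) t 0 (t ^+ 2 *: M) *m mx8 0 t^-1 (- (2 * r) / t ^+ 2) (t ^- 2 *: N) = 1%:M.
Proof.
move=> t0 MN; apply/matrixP => a b; rewrite mxE sum8.
elim/ind8: a => [|i|]; elim/ind8: b => [|j|];
  rewrite !mx8E; (under eq_bigr do rewrite ?mx8E ?(mul0r, mulr0));
  rewrite ?big1_eq ?(mulr0, mul0r, addr0, add0r) ?mxE ?ix8 //.
- by rewrite divff.
- by rewrite (_ : (at_ == arho) = false) // mulr0n; field.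
- under eq_bigr do rewrite !mxE mulrACA divff ?expf_neq0 // mul1r.
  by have := congr1 (fun A : 'M[R]_6 => A i j) MN; rewrite !mxE.
- by rewrite divff.
Qed.

End Coordinates8.

(** * Ricci tensor of the ambient form *)

Section AmbientTable.
Variables (R : realType) (V : pred 'I_6) (t r : R) (g dh N : 'I_6 -> 'I_6 -> R).
Variables (L : 'I_6 -> 'I_6 -> 'I_6 -> R) (Gm : 'I_8 -> 'I_8 -> 'I_8 -> R).

(* Values at a point of the Christoffel symbols of 2 d(rho t) dt + t^2 g(x, rho),
   where dh = dg/drho, N k i = g^kl dh_il / 2 and L are those of g( , rho). *)
Record ambient_table : Prop := AmbientTable {
  at_C : forall a b c, Gm a b c = Gm a c b;
  at_tt : forall a, Gm a at_ at_ = 0;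
  at_rr : forall a, Gm a arho arho = 0;
  at_ttr : Gm at_ at_ arho = 0;
  at_xtr : forall k, Gm (xi k) at_ arho = 0;
  at_rtr : Gm arho at_ arho = t^-1;
  at_ttx : forall i, Gm at_ at_ (xi i) = 0;
  at_xtx : forall k i, Gm (xi k) at_ (xi i) = (k == i)%:R / t;
  at_rtx : forall i, Gm arho at_ (xi i) = 0;
  at_trx : forall i, Gm at_ arho (xi i) = 0;
  at_xrx : forall k i, Gm (xi k) arho (xi i) = N k i;
  at_rrx : forall i, Gm arho arho (xi i) = 0;
  at_txx : forall i j, Gm at_ (xi i) (xi j) = - (t / 2 * dh i j);
  at_xxx : forall k i j, Gm (xi k) (xi i) (xi j) = L k i j;
  at_rxx : forall i j, Gm arho (xi i) (xi j) = - g i j + r * dh i j }.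

Hypothesis T : ambient_table.
Hypothesis t0 : t != 0.
Hypothesis N0 : forall k i, ~~ V k || V i -> N k i = 0.
Hypothesis L0 : forall k i j, ~~ V k -> V i || V j -> L k i j = 0.
Hypothesis Ltr0 : forall i j, V j -> L i i j = 0.
Hypothesis dh0 : forall i j, V i || V j -> dh i j = 0.
Hypothesis dhC : forall i j, dh i j = dh j i.
Hypothesis gC : forall i j, g i j = g j i.
Hypothesis Ng : forall i j, \sum_m N m j * g m i = 2^-1 * dh i j.

Let at_xt k : Gm (xi k) arho at_ = 0. Proof. by rewrite (at_C T) (at_xtr T). Qed.
Let at_tt' : Gm at_ arho at_ = 0. Proof. by rewrite (at_C T) (at_ttr T). Qed.
Let at_rt' : Gm arho arho at_ = t^-1. Proof. by rewrite (at_C T) (at_rtr T). Qed.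
Let at_txt i : Gm at_ (xi i) at_ = 0. Proof. by rewrite (at_C T) (at_ttx T). Qed.
Let at_xxt k i : Gm (xi k) (xi i) at_ = (k == i)%:R / t.
Proof. by rewrite (at_C T) (at_xtx T). Qed.
Let at_rxt i : Gm arho (xi i) at_ = 0. Proof. by rewrite (at_C T) (at_rtx T). Qed.
Let at_txr i : Gm at_ (xi i) arho = 0. Proof. by rewrite (at_C T) (at_trx T). Qed.
Let at_xxr k i : Gm (xi k) (xi i) arho = N k i.
Proof. by rewrite (at_C T) (at_xrx T). Qed.
Let at_rxr i : Gm arho (xi i) arho = 0. Proof. by rewrite (at_C T) (at_rrx T). Qed.

Let TE := (at_tt T, at_rr T, at_ttr T, at_xtr T, at_rtr T, at_ttx T, at_xtx T,
  at_rtx T, at_trx T, at_xrx T, at_rrx T, at_txx T, at_xxx T, at_rxx T,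
  at_xt, at_tt', at_rt', at_txt, at_xxt, at_rxt, at_txr, at_xxr, at_rxr).
Let Z := (mulr0, mul0r, addr0, add0r, oppr0, @big1_eq).

Let Nii i : N i i = 0.
Proof. by apply: N0; case: (V i). Qed.

Let trN (k : 'I_6) (F : 'I_6 -> R) : \sum_i (i == k)%:R / t * F i = F k / t.
Proof.
rewrite (bigD1 k) //= eqxx mul1r big1 ?addr0 1?mulrC // => i /negbTE ik.
by rewrite ik !mul0r.
Qed.

(** Each of the six x-directions and rho contribute 1/t, in accordance with sqrt |det| being t^7
    times that of g( , rho). *)
Lemma trace_t : \sum_a Gm a a at_ = 7 / t.
Proof.
rewrite sum8 !TE !Z; under eq_bigr do rewrite TE eqxx mul1r.
by rewrite sumr_const card_ord -mulr_natl; field.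
Qed.

Lemma trace_r : \sum_a Gm a a arho = 0.
Proof. by rewrite sum8 !TE !Z; apply: big1 => i _; rewrite TE Nii. Qed.

Lemma trace_x i : \sum_a Gm a a (xi i) = \sum_k L k k i.
Proof. by rewrite sum8 !TE !Z; apply: eq_bigr => k _; rewrite TE. Qed.

(** The third block of the Ricci formula needs only the traced symbols, and the rho-trace is zero
    because [N] has no diagonal entries. *)
Lemma trace_mul j k : \sum_a \sum_p Gm a a p * Gm p j k =
  7 / t * Gm at_ j k + \sum_p (\sum_m L m m p) * Gm (xi p) j k.
Proof.
rewrite exchange_big /=; under eq_bigr do rewrite -mulr_suml.
rewrite sum8 trace_t trace_r mul0r addr0; congr (_ + _).
by apply: eq_bigr => p _; rewrite trace_x.
Qed.

Lemma trace_mul_tt : \sum_a \sum_p Gm a a p * Gm p at_ at_ = 0.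
Proof. by rewrite trace_mul !TE; under eq_bigr do rewrite TE mulr0; rewrite !Z. Qed.

Lemma trace_mul_rr : \sum_a \sum_p Gm a a p * Gm p arho arho = 0.
Proof. by rewrite trace_mul !TE; under eq_bigr do rewrite TE mulr0; rewrite !Z. Qed.

Lemma trace_mul_rt : \sum_a \sum_p Gm a a p * Gm p arho at_ = 0.
Proof. by rewrite trace_mul !TE; under eq_bigr do rewrite TE mulr0; rewrite !Z. Qed.

Lemma trace_mul_rx i : \sum_a \sum_p Gm a a p * Gm p arho (xi i) = 0.
Proof.
rewrite trace_mul !TE !Z; apply: big1 => p _; rewrite TE.
have [Vp|nVp] := boolP (V p); last by rewrite N0 ?nVp ?mulr0.
by rewrite big1 ?mul0r // => m _; exact: Ltr0.
Qed.

Lemma trace_mul_tx i : \sum_a \sum_p Gm a a p * Gm p at_ (xi i) =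
  (\sum_m L m m i) / t.
Proof.
rewrite trace_mul !TE !Z; under eq_bigr do rewrite TE mulrC.
exact: (trN i (fun p => \sum_m L m m p)).
Qed.

Lemma trace_mul_xx i j : \sum_a \sum_p Gm a a p * Gm p (xi i) (xi j) =
  - (7 / 2 * dh i j) + \sum_m \sum_p L m m p * L p i j.
Proof.
rewrite trace_mul TE; congr (_ + _); first by field.
rewrite exchange_big /=; apply: eq_bigr => p _; rewrite mulr_suml.
by apply: eq_bigr => m _; rewrite TE.
Qed.

Lemma quad8 (F : 'I_8 -> 'I_8 -> R) : \sum_a \sum_p F a p =
  (F at_ at_ + F at_ arho + F arho at_ + F arho arho)
  + \sum_i (F at_ (xi i) + F (xi i) at_ + F (xi i) arho + F arho (xi i))
  + \sum_i \sum_j F (xi i) (xi j).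
Proof.
rewrite sum8 (sum8 (F at_)) (sum8 (F arho)) [X in _ + X + _](_ : _ =
  \sum_i (F (xi i) at_ + \sum_j F (xi i) (xi j) + F (xi i) arho)); last first.
  by apply: eq_bigr => i _; rewrite sum8.
by rewrite !big_split /=; ring.
Qed.

(** This is the square of h' contracted twice: [N] maps nonvertical to vertical indices, so its
    square has trace zero. *)
Lemma quad_rr : \sum_a \sum_p Gm a arho p * Gm p a arho = 0.
Proof.
rewrite quad8 !TE !Z; under eq_bigr do rewrite !TE !Z.
rewrite !Z; apply: big1 => i _; apply: big1 => j _; rewrite !TE.
have [Vi|nVi] := boolP (V i); last by rewrite N0 ?nVi ?mul0r.
by rewrite mulrC N0 ?mul0r // Vi orbT.
Qed.

Lemma quad_rt : \sum_a \sum_p Gm a at_ p * Gm p a arho = 0.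
Proof.
rewrite quad8 !TE !Z; under eq_bigr do rewrite !TE !Z.
rewrite !Z; apply: big1 => i _; under eq_bigr do rewrite !TE eq_sym.
by rewrite (trN i (fun j => N j i)) Nii mul0r.
Qed.

Lemma quad_rx i : \sum_a \sum_p Gm a (xi i) p * Gm p a arho = 0.
Proof.
rewrite quad8 !TE !Z; under eq_bigr do rewrite !TE !Z.
rewrite !Z; apply: big1 => m _; apply: big1 => l _; rewrite !TE.
have [Vm|nVm] := boolP (V m); first by rewrite N0 ?mulr0 // Vm orbT.
have [Vl|nVl] := boolP (V l); last by rewrite N0 ?mulr0 // nVl.
by rewrite L0 ?mul0r // Vl orbT.
Qed.

Lemma quad_tt : \sum_a \sum_p Gm a at_ p * Gm p a at_ = 7 / t ^+ 2.
Proof.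
rewrite quad8 !TE !Z; under eq_bigr do rewrite !TE !Z.
rewrite !Z; under eq_bigr => i _.
  under eq_bigr do rewrite !TE eq_sym.
  rewrite (trN i (fun j => (j == i)%:R / t)) eqxx.
over.
by rewrite sumr_const card_ord -[X in _ + X]mulr_natl mulr1n; field.
Qed.

Lemma quad_tx i : \sum_a \sum_p Gm a (xi i) p * Gm p a at_ = (\sum_m L m i m) / t.
Proof.
rewrite quad8 !TE !Z; under eq_bigr do rewrite !TE !Z.
rewrite !Z mulr_suml; apply: eq_bigr => m _.
under eq_bigr do rewrite !TE mulrC.
exact: (trN m (fun p => L m i p)).
Qed.

(** The mixed pairs (t, x), (x, t), (x, rho), (rho, x) each contribute -1/2 h', which explains the
    factor -2. The terms r N h' vanish by the block structure. *)
Lemma quad_xx i j : \sum_a \sum_p Gm a (xi j) p * Gm p a (xi i) =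
  - 2 * dh i j + \sum_m \sum_p L m j p * L p m i.
Proof.
have dhN : \sum_m N m j * dh m i = 0.
  apply: big1 => m _; have [Vm|nVm] := boolP (V m); first by rewrite dh0 ?Vm // mulr0.
  by rewrite N0 ?nVm ?mul0r.
have Nd a b : \sum_m N m a * (- g m b + r * dh m b) = - (2^-1 * dh b a)
    + r * \sum_m N m a * dh m b.
  rewrite -Ng -sumrN mulr_sumr -big_split; apply: eq_bigr => m _ /=.
  by ring.
rewrite quad8 !TE !Z; congr (_ + _); last first.
  by apply: eq_bigr => m _; apply: eq_bigr => p _; rewrite !TE.
have dhN' : \sum_m N m i * dh m j = 0.
  apply: big1 => m _; have [Vm|nVm] := boolP (V m); first by rewrite dh0 ?Vm // mulr0.
  by rewrite N0 ?nVm ?mul0r.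
have tD a b : \sum_m (m == a)%:R / t * - (t / 2 * dh m b) = - (2^-1 * dh a b).
  by rewrite (trN a (fun m => - (t / 2 * dh m b))); field.
under eq_bigr do rewrite !TE.
rewrite !big_split /= Nd dhN.
rewrite [X in X + _ + _ + _](_ : _ = - (2^-1 * dh i j)); last first.
  by rewrite -tD; apply: eq_bigr => m _; rewrite mulrC (dhC j m).
rewrite [X in _ + X + _ + _](_ : _ = - (2^-1 * dh i j)); last first.
  by rewrite dhC -tD; apply: eq_bigr => m _.
rewrite [X in _ + X](_ : _ = - (2^-1 * dh i j)); last first.
  transitivity (\sum_m N m i * (- g m j + r * dh m j)).
    by apply: eq_bigr => m _; rewrite gC (dhC j m) mulrC.
  by rewrite Nd dhN' mulr0 addr0 dhC.
by rewrite mulr0 addr0; field.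
Qed.

End AmbientTable.

Section Restriction.
Variables (R : realType) (n : nat) (V : pred 'I_n) (A B : set 'rV[R]_n).
Hypothesis AB : A `<=` B.

Lemma smooth_sub F : smooth_on B F -> smooth_on A F.
Proof.
move=> sF k; elim: k F sF => [|k IH] F sF.
  by split=> // x /AB Bx; exact: smooth_cont sF Bx.
apply/CkP; split=> [x /AB Bx|i x /AB Bx|i].
- exact: smooth_cont sF Bx.
- exact: smooth_pderivable sF Bx.
- by apply: IH; exact: smooth_pder.
Qed.

Lemma vinv_sub F : vertical_inv V B F -> vertical_inv V A F.
Proof. by move=> [sF F0]; split=> [|c Vc x /AB]; [exact: smooth_sub|exact: F0]. Qed.

Lemma affine_walker_sub g : affine_walker V B g -> affine_walker V A g.
Proof.
move=> [sg gT ug g0 H0 gP gV]; split.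
- by move=> i j; exact: smooth_sub.
- by move=> x /AB; exact: gT.
- by move=> x /AB; exact: ug.
- by move=> i j x Vi Vj /AB; exact: g0.
- by move=> i j x Vi Vj /AB; exact: H0.
- by move=> i j Vj; apply: vinv_sub; exact: gP.
- by move=> c i j Vc; apply: vinv_sub; exact: gV.
Qed.

End Restriction.

(** * The ambient form of a Walker metric with a horizontal deformation *)

Section AmbientMetric.
Variables (R : realType) (V : pred 'I_6) (U : set 'rV[R]_6) (W : set 'rV[R]_8).
Variables (g0 : 'rV[R]_6 -> 'M[R]_6) (h : 'rV[R]_6 -> R -> 'M[R]_6).
Hypothesis oW : open W.
Hypothesis W_gt0 : forall z, W z -> 0 < tpart z.
Hypothesis WU : forall z, W z -> U (xpart z).
Hypothesis wg : affine_walker V U g0.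

Local Notation X := xpart.
Local Notation r := rhopart.
Local Notation t := tpart.
Local Notation hz i j := (fun z => h (X z) (r z) i j).
Local Notation g := (fun x rho => g0 x + h x rho).
Local Notation gz i j := (fun z => g (X z) (r z) i j).
Local Notation G := (ambient_form g).
Local Notation dh i j := (pder arho (hz i j)).

Hypothesis sh : forall i j, smooth_on W (hz i j).
Hypothesis hV : forall c i j z, V c -> W z -> pder (xi c) (hz i j) z = 0.
Hypothesis hT : forall z, W z -> (h (X z) (r z))^T = h (X z) (r z).
Hypothesis hb : forall i j z, V i -> W z -> h (X z) (r z) i j = 0.

Let hbr i j z : V j -> W z -> h (X z) (r z) i j = 0.
Proof. by move=> Vj Wz; rewrite -(hT Wz) mxE hb. Qed.

Let hC i j z : W z -> h (X z) (r z) i j = h (X z) (r z) j i.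
Proof. by move=> Wz; rewrite -{1}(hT Wz) mxE. Qed.

Let t_neq0 z : W z -> t z != 0.
Proof. by move=> /W_gt0; rewrite lt0r => /andP[]. Qed.

Local Notation leaf z := [set y | W (slice z y)].

Let oWz z : open (leaf z).
Proof. exact: open_slice. Qed.

Let in_slice z : W z -> leaf z (X z).
Proof. by move=> Wz /=; rewrite slice_self. Qed.

Lemma walker_slice z : affine_walker V (leaf z) g0.
Proof. by apply: affine_walker_sub wg => y /WU; rewrite xpart_slice. Qed.

(** Freezing t and rho turns the hypotheses on [h], stated through derivatives on R^8, into the
    six-dimensional notion used for perturbations. *)
Lemma horizontal_slice z : horizontal V (leaf z) (fun y => h y (r z)).
Proof.
have E i j : (fun y => h y (r z) i j) = fun y => hz i j (slice z y).
  by apply/funext => y; rewrite xpart_slice rhopart_slice.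
split.
- move=> i j; split; first by rewrite E; exact: (smooth_slice z (sh i j)).
  move=> c Vc y Wy; rewrite -(hV i j Vc Wy) pder_xi xpart_slice.
  apply: pder_ext => y'.
  by rewrite xpart_slice !rhopart_slice.
- by move=> y /hT; rewrite xpart_slice rhopart_slice.
- by move=> i j y Vi /(hb j Vi); rewrite xpart_slice rhopart_slice.
Qed.

Lemma walker_g z : affine_walker V (leaf z) (fun y => g y (r z)).
Proof.
exact: (affine_walkerD (@oWz z) (walker_slice z) (horizontal_slice z)).
Qed.

Lemma pder_tpart a : pder a (@tpart R) = fun=> (at_ == a)%:R.
Proof. exact: pder_coord. Qed.

Lemma pder_rhopart a : pder a (@rhopart R) = fun=> (arho == a)%:R.
Proof. exact: pder_coord. Qed.

Lemma smooth_tpart (A : set 'rV[R]_8) : smooth_on A (@tpart R).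
Proof. exact: smooth_coord. Qed.

Lemma smooth_rhopart (A : set 'rV[R]_8) : smooth_on A (@rhopart R).
Proof. exact: smooth_coord. Qed.

Lemma smooth_xpart F : smooth_on U F -> smooth_on W (fun z => F (X z)).
Proof.
apply: (smooth_comp (@xpart_affine R)); [exact: xpart_cont|exact: xpart_basis|exact: WU].
Qed.

Lemma smooth_gz i j : smooth_on W (gz i j).
Proof.
apply: (smooth_eq (F := fun z => g0 (X z) i j + h (X z) (r z) i j)) => //.
  by move=> z _; rewrite mxE.
by apply: smoothD => //; exact: (smooth_xpart (aw_smooth wg i j)).
Qed.

Lemma smooth_G a b : smooth_on W (fun z => G z a b).
Proof.
have ext F p q : (forall z, G z p q = F z) -> smooth_on W F ->
    smooth_on W (fun z => G z p q).
  by move=> E; apply: smooth_eq => // z _; rewrite E.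
have s0 := smooth_cst W (0 : R).
have st := smooth_tpart W; have sr := smooth_rhopart W.
have s2 : smooth_on W (fun z => 2 * r z) by apply: smoothM => //; exact: smooth_cst.
have sxx i j : smooth_on W (fun z => t z ^+ 2 * gz i j z).
  by apply: smoothM => //; [exact: smoothX|exact: smooth_gz].
elim/ind8: a => [|i|]; elim/ind8: b => [|j|].
- by apply: ext s2 => z; rewrite ambient_formE mx8E.
- by apply: ext s0 => z; rewrite ambient_formE mx8E.
- by apply: ext st => z; rewrite ambient_formE mx8E.
- by apply: ext s0 => z; rewrite ambient_formE mx8E.
- by apply: ext (sxx i j) => z; rewrite ambient_formE mx8E [LHS]mxE.
- by apply: ext s0 => z; rewrite ambient_formE mx8E.
- by apply: ext st => z; rewrite ambient_formE mx8E.
- by apply: ext s0 => z; rewrite ambient_formE mx8E.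
- by apply: ext s0 => z; rewrite ambient_formE mx8E.
Qed.

Lemma sym_gz z : W z -> (g (X z) (r z))^T = g (X z) (r z).
Proof. by move=> Wz; rewrite linearD /= (aw_sym wg) ?hT //; exact: WU. Qed.

Lemma gzC i j z : W z -> gz i j z = gz j i z.
Proof. by move=> /sym_gz E; rewrite -{1}E mxE. Qed.

Lemma sym_G z : W z -> (G z)^T = G z.
Proof.
move=> Wz; rewrite ambient_formE; apply/matrixP => a b; rewrite mxE.
elim/ind8: a => [|i|]; elim/ind8: b => [|j|]; rewrite !mx8E //.
by rewrite [LHS]mxE [RHS]mxE; congr (_ * _); exact: gzC.
Qed.

Lemma unit_gz z : W z -> g (X z) (r z) \in unitmx.
Proof. by move=> Wz; exact: (aw_unit (walker_g z) (in_slice Wz)). Qed.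

Local Notation H k l z := (invmx (g (X z) (r z)) k l).

Lemma invmx_G z : W z -> G z \in unitmx /\ invmx (G z) =
  mx8 0 (t z)^-1 (- (2 * r z) / t z ^+ 2) (t z ^- 2 *: invmx (g (X z) (r z))).
Proof.
move=> Wz; apply: mulmx1_invmx; rewrite ambient_formE.
by apply: mx8_inv; [exact: t_neq0|exact: mulmxV (unit_gz Wz)].
Qed.

Lemma pder_gz_t i j z : pder at_ (gz i j) z = 0.
Proof.
apply: pder_const_along => s.
rewrite !xpart_affine xpart_at scaler0 add0r.
by rewrite /rhopart !mxE mulr0 add0r.
Qed.

Lemma pder_gz_x m i j z :
  pder (xi m) (gz i j) z = pder m (fun y => g y (r z) i j) (X z).
Proof.
rewrite pder_xi; apply: pder_ext => y.
by rewrite xpart_slice rhopart_slice.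
Qed.

Lemma pder_gz_r i j z : W z -> pder arho (gz i j) z = dh i j z.
Proof.
move=> Wz; transitivity (pder arho (fun z => g0 (X z) i j + hz i j z) z).
  by apply: pder_ext => y; rewrite mxE.
have s0 : smooth_on W (fun z => g0 (X z) i j).
  exact: (smooth_xpart (aw_smooth wg i j)).
rewrite pderD; [|exact: smooth_pderivable s0 Wz|exact: smooth_pderivable (sh _ _) Wz].
rewrite [X in X + _](_ : _ = 0) ?add0r //.
by apply: pder_const_along => s; rewrite xpart_affine xpart_arho scaler0 add0r.
Qed.

Lemma dh_sym i j z : W z -> dh i j z = dh j i z.
Proof. by apply: (pder_eq arho oW) => y; exact: hC. Qed.

Lemma dh_block i j z : V i || V j -> W z -> dh i j z = 0.
Proof.
case/orP => Vij; apply: (pder_zero oW) => y Wy; [exact: hb|exact: hbr].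
Qed.

(** * Christoffel symbols of the ambient form *)

Local Notation dG a p q z := (pder a (fun y => G y p q) z).

Let dG_eq F a p q z : (forall y, G y p q = F y) -> dG a p q z = pder a F z.
Proof. by move=> E; apply: pder_ext. Qed.

Let dG_cst a p q z : (forall y, G y p q = 0) -> dG a p q z = 0.
Proof. by move=> /dG_eq ->; rewrite pder_cst. Qed.

Lemma dG_tt a z : dG a at_ at_ z = 2 * (arho == a)%:R.
Proof.
rewrite (dG_eq (F := fun y => 2 * r y)); last by move=> y; rewrite ambient_formE mx8E.
rewrite pderM; [|exact: derivable_cst|]; last first.
  exact: smooth_pderivable (smooth_rhopart setT) _.
by rewrite pder_cst mul0r add0r pder_rhopart.
Qed.

Lemma dG_tr a z : dG a at_ arho z = (at_ == a)%:R.
Proof.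
rewrite (dG_eq (F := @tpart R)) ?pder_tpart // => y.
by rewrite ambient_formE mx8E.
Qed.

Lemma dG_rt a z : dG a arho at_ z = (at_ == a)%:R.
Proof.
rewrite (dG_eq (F := @tpart R)) ?pder_tpart // => y.
by rewrite ambient_formE mx8E.
Qed.

Lemma dG_rr a z : dG a arho arho z = 0.
Proof. by apply: dG_cst => y; rewrite ambient_formE mx8E. Qed.
Lemma dG_tx a i z : dG a at_ (xi i) z = 0.
Proof. by apply: dG_cst => y; rewrite ambient_formE mx8E. Qed.
Lemma dG_xt a i z : dG a (xi i) at_ z = 0.
Proof. by apply: dG_cst => y; rewrite ambient_formE mx8E. Qed.
Lemma dG_rx a i z : dG a arho (xi i) z = 0.
Proof. by apply: dG_cst => y; rewrite ambient_formE mx8E. Qed.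
Lemma dG_xr a i z : dG a (xi i) arho z = 0.
Proof. by apply: dG_cst => y; rewrite ambient_formE mx8E. Qed.

Let dG_xx a i j z : W z -> dG a (xi i) (xi j) z =
  2 * t z * (at_ == a)%:R * gz i j z + t z ^+ 2 * pder a (gz i j) z.
Proof.
move=> Wz; rewrite (dG_eq (F := fun y => t y * t y * gz i j y)); last first.
  by move=> y; rewrite ambient_formE mx8E [LHS]mxE expr2.
have dt : pderivable a (@tpart R) z by exact: smooth_pderivable (smooth_tpart W) Wz.
rewrite (pderM (pderivableM dt dt) (smooth_pderivable (smooth_gz i j) Wz)) (pderM dt dt) pder_tpart.
by rewrite expr2; apply: (congr1 (fun c => c + _)); ring.
Qed.

Lemma dG_xx_t i j z : W z -> dG at_ (xi i) (xi j) z = 2 * t z * gz i j z.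
Proof. by move=> Wz; rewrite dG_xx // pder_gz_t eqxx mulr0 addr0 mulr1. Qed.

Lemma dG_xx_x m i j z : W z -> dG (xi m) (xi i) (xi j) z =
  t z ^+ 2 * pder m (fun y => g y (r z) i j) (X z).
Proof. by move=> Wz; rewrite dG_xx // pder_gz_x ix8 mulr0 mul0r add0r. Qed.

Lemma dG_xx_r i j z : W z -> dG arho (xi i) (xi j) z = t z ^+ 2 * dh i j z.
Proof. by move=> Wz; rewrite dG_xx // pder_gz_r // mulr0 mul0r add0r. Qed.

Local Notation low8 := (lowered_christoffel G).
Let ix := (mulr1, mulr0, addr0, add0r, subr0, subrr, sub0r, oppr0).
Let dG0 := (dG_tt, dG_tr, dG_rt, dG_rr, dG_tx, dG_xt, dG_rx, dG_xr).

Lemma low_tt c z : low8 at_ at_ c z = 0.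
Proof.
by rewrite /lowered_christoffel; elim/ind8: c => [|i|]; rewrite !dG0 ?ix8 /= ?ix.
Qed.

Lemma low_rr c z : low8 arho arho c z = 0.
Proof.
by rewrite /lowered_christoffel; elim/ind8: c => [|i|]; rewrite !dG0 ?ix8 /= ?ix.
Qed.

Lemma low_tr_t z : low8 at_ arho at_ z = 2.
Proof. by rewrite /lowered_christoffel !dG0 !eqxx !mulr1n; ring. Qed.
Lemma low_tr_x i z : low8 at_ arho (xi i) z = 0.
Proof. by rewrite /lowered_christoffel !dG0 /= ?ix8 ?ix. Qed.
Lemma low_tr_r z : low8 at_ arho arho z = 0.
Proof. by rewrite /lowered_christoffel !dG0 /= ?ix. Qed.

Lemma low_tx_t i z : low8 at_ (xi i) at_ z = 0.
Proof. by rewrite /lowered_christoffel !dG0 /= ?ix8 ?ix. Qed.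
Lemma low_tx_x i j z : W z -> low8 at_ (xi i) (xi j) z = 2 * t z * gz i j z.
Proof. by move=> Wz; rewrite /lowered_christoffel !dG0 dG_xx_t // ?ix. Qed.
Lemma low_tx_r i z : low8 at_ (xi i) arho z = 0.
Proof. by rewrite /lowered_christoffel !dG0 /= ?ix8 ?ix. Qed.

Lemma low_rx_t i z : low8 arho (xi i) at_ z = 0.
Proof. by rewrite /lowered_christoffel !dG0 /= ?ix8 ?ix. Qed.
Lemma low_rx_x i j z : W z -> low8 arho (xi i) (xi j) z = t z ^+ 2 * dh i j z.
Proof. by move=> Wz; rewrite /lowered_christoffel !dG0 dG_xx_r // ?ix. Qed.
Lemma low_rx_r i z : low8 arho (xi i) arho z = 0.
Proof. by rewrite /lowered_christoffel !dG0 /= ?ix8 ?ix. Qed.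

Lemma low_xx_t i j z : W z -> low8 (xi i) (xi j) at_ z = - (2 * t z * gz i j z).
Proof. by move=> Wz; rewrite /lowered_christoffel !dG0 dG_xx_t // ?ix. Qed.
Lemma low_xx_r i j z : W z -> low8 (xi i) (xi j) arho z = - (t z ^+ 2 * dh i j z).
Proof. by move=> Wz; rewrite /lowered_christoffel !dG0 dG_xx_r // ?ix. Qed.
Lemma low_xx_x i j l z : W z -> low8 (xi i) (xi j) (xi l) z =
  t z ^+ 2 * lowered_christoffel (fun y => g y (r z)) i j l (X z).
Proof.
by move=> Wz; rewrite /lowered_christoffel !dG_xx_x // -mulrDr -mulrBr.
Qed.

Local Notation Gam := (christoffel G).
Local Notation Gam6 k i j z := (christoffel (fun y => g y (r z)) k i j (X z)).

Definition half_dh (k i : 'I_6) z : R := 2^-1 * \sum_l H k l z * dh i l z.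

Lemma christoffel8E k a b z : Gam k a b z =
  2^-1 * (invmx (G z) k at_ * low8 a b at_ z
          + \sum_l invmx (G z) k (xi l) * low8 a b (xi l) z
          + invmx (G z) k arho * low8 a b arho z).
Proof.
exact: (congr1 (fun c => 2^-1 * c) (sum8 (fun c => invmx (G z) k c * low8 a b c z))).
Qed.

(** The t-row of the inverse has the single nonzero entry 1/t, in the rho-column. *)
Lemma christoffel_t a b z : W z ->
  Gam at_ a b z = 2^-1 * ((t z)^-1 * low8 a b arho z).
Proof.
move=> Wz; rewrite christoffel8E (invmx_G Wz).2 !mx8E mul0r add0r big1 ?add0r //.
by move=> l _; rewrite mx8E mul0r.
Qed.

Lemma christoffel_r a b z : W z -> Gam arho a b z =
  2^-1 * ((t z)^-1 * low8 a b at_ z - 2 * r z / t z ^+ 2 * low8 a b arho z).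
Proof.
move=> Wz; rewrite christoffel8E (invmx_G Wz).2 !mx8E big1 ?addr0 ?mulNr //.
by move=> l _; rewrite mx8E mul0r.
Qed.

Lemma christoffel_x k a b z : W z -> Gam (xi k) a b z =
  2^-1 * \sum_l t z ^- 2 * H k l z * low8 a b (xi l) z.
Proof.
move=> Wz; have ends (u v w c d : R) : u = 0 -> w = 0 -> u * c + v + w * d = v.
  by move=> -> ->; rewrite !mul0r addr0 add0r.
rewrite christoffel8E (invmx_G Wz).2 ends ?mx8_xt ?mx8_xr //.
by apply: (congr1 (fun c => _ * c)); apply: eq_bigr => l _; rewrite mx8E [X in X * _]mxE.
Qed.

Lemma mul_invmx_gz k i z : W z -> \sum_l H k l z * gz i l z = (k == i)%:R.
Proof.
move=> Wz; transitivity ((invmx (g (X z) (r z)) *m g (X z) (r z)) k i).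
  by rewrite mxE; apply: eq_bigr => l _; rewrite gzC.
by rewrite mulVmx ?unit_gz // mxE.
Qed.

Lemma christoffel_table z : W z ->
  ambient_table (t z) (r z) (fun i j => gz i j z) (fun i j => dh i j z)
    (fun k i => half_dh k i z) (fun k i j => Gam6 k i j z) (fun k a b => Gam k a b z).
Proof.
move=> Wz; have t0 := t_neq0 Wz.
have zero k a b : (forall c, low8 a b c z = 0) -> Gam k a b z = 0.
  by move=> l0; rewrite christoffel8E !l0 big1 ?mulr0 ?addr0 ?mulr0 // => l _; rewrite l0 mulr0.
have zerox k a b : (forall l, low8 a b (xi l) z = 0) -> Gam (xi k) a b z = 0.
  by move=> l0; rewrite christoffel_x // big1 ?mulr0 // => l _; rewrite l0 mulr0.
split.
- by move=> k a b; exact: (christoffelC oW sym_G).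
- by move=> k; apply: zero => c; exact: low_tt.
- by move=> k; apply: zero => c; exact: low_rr.
- by rewrite christoffel_t // low_tr_r !mulr0.
- by move=> k; apply: zerox => l; exact: low_tr_x.
- by rewrite christoffel_r // low_tr_t low_tr_r; field.
- by move=> i; rewrite christoffel_t // low_tx_r !mulr0.
- move=> k i; rewrite christoffel_x // -(mul_invmx_gz k i Wz) mulr_suml mulr_sumr.
  by apply: eq_bigr => l _; rewrite low_tx_x //; field.
- by move=> i; rewrite christoffel_r // low_tx_t low_tx_r !mulr0 subrr mulr0.
- by move=> i; rewrite christoffel_t // low_rx_r !mulr0.
- move=> k i; rewrite christoffel_x //; apply: (congr1 (fun c => _ * c)).
  by apply: eq_bigr => l _; rewrite low_rx_x //; field.
- by move=> i; rewrite christoffel_r // low_rx_t low_rx_r !mulr0 subrr mulr0.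
- by move=> i j; rewrite christoffel_t // low_xx_r //; field.
- move=> k i j; rewrite christoffel_x //; apply: (congr1 (fun c => _ * c)).
  by apply: eq_bigr => l _; rewrite low_xx_x // mulrACA (mulVf (expf_neq0 2 t0)) mul1r.
- by move=> i j; rewrite christoffel_r // low_xx_t // low_xx_r //; field.
Qed.

Lemma half_dh0 k i z : ~~ V k || V i -> W z -> half_dh k i z = 0.
Proof.
move=> Vki Wz; rewrite /half_dh big1 ?mulr0 // => l _.
have [Vl|nVl] := boolP (V l); first by rewrite dh_block ?Vl ?orbT ?mulr0.
case/orP: Vki => [nVk|Vi]; last by rewrite dh_block ?Vi ?mulr0.
by rewrite (aw_conull (walker_g z) nVk nVl (in_slice Wz)) mul0r.
Qed.

Lemma half_dh_mul_gz i j z : W z ->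
  \sum_m half_dh m j z * gz m i z = 2^-1 * dh i j z.
Proof.
move=> Wz; have HC k l : H k l z = H l k z.
  exact: (invmx_sym (aw_sym (walker_g z)) k l (in_slice Wz)).
rewrite [RHS](_ : _ = \sum_l 2^-1 * dh j l z * (l == i)%:R); last first.
  rewrite (bigD1 i) //= eqxx mulr1 big1 ?addr0 ?(dh_sym i j Wz) // => l /negbTE li.
  by rewrite li mulr0.
under [RHS]eq_bigr => l _ do rewrite -(mul_invmx_gz l i Wz) mulr_sumr.
rewrite [RHS]exchange_big; apply: eq_bigr => m _.
rewrite /half_dh mulr_sumr mulr_suml; apply: eq_bigr => l _.
by rewrite (HC m l) (gzC m i Wz); ring.
Qed.

(** The sum over l meets h' at nonvertical l only, where [H m l] is constant along the leaves; h'
    inherits its invariance from [h] by exchanging derivatives. *)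
Lemma half_dh_vinv m i z :
  vertical_inv V (leaf z) (fun y => half_dh m i (slice z y)).
Proof.
have sdh l : smooth_on W (dh i l) by exact: smooth_pder.
apply: (vinv_eq (@oWz z) (F := fun y => 2^-1 *
    \sum_l invmx (g y (r z)) m l * dh i l (slice z y))).
  by move=> y _; rewrite /half_dh xpart_slice rhopart_slice.
apply: (vinvM (@oWz z)) (vinv_cst _ _ _) _; apply: (vinv_sum (@oWz z)) => l.
have [Vl|nVl] := boolP (V l).
  apply: (vinv_zero _ (@oWz z)) => y Wy.
  by rewrite dh_block ?Vl ?orbT ?mulr0.
apply: (vinvM (@oWz z)).
  by apply: (aw_inv_vinv (@oWz z) (walker_g z)); right.
split; first exact: (smooth_slice z (sdh l)).
move=> c Vc y Wy.
have <- : pder (xi c) (dh i l) (slice z y) =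
    pder c (fun y => dh i l (slice z y)) y.
  by rewrite pder_xi slice_slice xpart_slice.
rewrite (pderC _ _ oW (sh i l) Wy).
by apply: (pder_zero oW) Wy => w; exact: hV.
Qed.

(** The divergence of h' vanishes term by term: for vertical m by invariance along the leaves, for
    nonvertical m because the component is zero. *)
Lemma pder_half_dh m i z : W z -> pder (xi m) (half_dh m i) z = 0.
Proof.
move=> Wz; have [Vm|nVm] := boolP (V m).
  by rewrite pder_xi; exact: (half_dh_vinv m i z).2 (in_slice Wz).
by apply: (pder_zero oW) Wz => y Wy; apply: half_dh0; rewrite ?nVm.
Qed.

Lemma pder_dh_t i j z : W z -> pder at_ (dh i j) z = 0.
Proof.
move=> Wz; rewrite (pderC _ _ oW (sh i j) Wz).
apply: (pder_zero oW) Wz => y _; apply: pder_const_along => s.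
rewrite xpart_affine xpart_at scaler0 add0r.
by rewrite /rhopart !mxE mulr0 add0r.
Qed.

Lemma pder_christoffel_x m k i j z : W z -> pder (xi m) (Gam (xi k) (xi i) (xi j)) z =
  pder m (christoffel (fun y => g y (r z)) k i j) (X z).
Proof.
move=> Wz; rewrite pder_xi; apply: (pder_eq _ (@oWz z)) (in_slice Wz) => y Wy.
by rewrite (at_xxx (christoffel_table Wy)) rhopart_slice xpart_slice.
Qed.

Lemma pder_christoffel_t i j z : W z ->
  pder at_ (Gam at_ (xi i) (xi j)) z = - (2^-1 * dh i j z).
Proof.
move=> Wz; have sdh : smooth_on W (dh i j) by exact: smooth_pder.
rewrite (pder_eq (G := fun y => - 2^-1 * (t y * dh i j y)) _ oW) //; last first.
  by move=> y Wy; rewrite (at_txx (christoffel_table Wy)); ring.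
have dd := smooth_pderivable (i := at_) sdh Wz.
have dt := smooth_pderivable (i := at_) (smooth_tpart W) Wz.
rewrite (pderM (@pderivable_cst _ _ _ _ _) (pderivableM dt dd)).
rewrite pder_cst (pderM dt dd) pder_tpart eqxx pder_dh_t // mulr0 addr0 mul1r mul0r add0r.
exact: mulNr.
Qed.

(** The symbol is - g + rho h'. The h' from differentiating rho cancels the one from - g. *)
Lemma pder_christoffel_r i j z : W z ->
  pder arho (Gam arho (xi i) (xi j)) z = r z * pder arho (dh i j) z.
Proof.
move=> Wz; have sdh : smooth_on W (dh i j) by exact: smooth_pder.
rewrite (pder_eq (G := fun y => r y * dh i j y - gz i j y) _ oW) //; last first.
  by move=> y Wy; rewrite (at_rxx (christoffel_table Wy)) addrC.
have dd := smooth_pderivable (i := arho) sdh Wz.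
have dr := smooth_pderivable (i := arho) (smooth_rhopart W) Wz.
have dg := smooth_pderivable (i := arho) (smooth_gz i j) Wz.
rewrite (pderB (pderivableM dr dd) dg) (pderM dr dd) pder_rhopart eqxx mul1r pder_gz_r //.
by rewrite addrC addKr.
Qed.

Let ricci_val j k z (a b c d : R) :
  \sum_i pder i (Gam i j k) z = a -> \sum_i pder k (Gam i i j) z = b ->
  \sum_i \sum_p Gam i i p z * Gam p j k z = c ->
  \sum_i \sum_p Gam i k p z * Gam p i j z = d ->
  ricci G z j k = a - b + c - d.
Proof. by move=> ha hb' hc hd; rewrite mxE; exact: ricci_terms_eq. Qed.

Let div0 j k z : W z -> (forall a y, W y -> Gam a j k y = 0) ->
  \sum_a pder a (Gam a j k) z = 0.
Proof. by move=> Wz G0; apply: big1 => a _; apply: (pder_zero oW) Wz; exact: G0. Qed.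

Let trace_r0 k z : W z -> \sum_a pder k (Gam a a arho) z = 0.
Proof.
move=> Wz; rewrite sum8 big1 => [|i _]; last first.
  apply: (pder_zero oW) Wz => y Wy; rewrite (at_C (christoffel_table Wy)).
  by rewrite (at_xrx (christoffel_table Wy)) half_dh0 //; case: (V i).
have -> : pder k (Gam at_ at_ arho) z = 0.
  by apply: (pder_zero oW) Wz => y Wy; exact: (at_ttr (christoffel_table Wy)).
have -> : pder k (Gam arho arho arho) z = 0.
  by apply: (pder_zero oW) Wz => y Wy; exact: (at_rr (christoffel_table Wy)).
by rewrite !addr0.
Qed.

Let trace_t_pder k z : W z ->
  \sum_a pder k (Gam a a at_) z = - (7 / t z ^+ 2 * (at_ == k)%:R).
Proof.
move=> Wz; have t0 := t_neq0 Wz.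
have dt : pderivable k (@tpart R) z by exact: smooth_pderivable (smooth_tpart W) Wz.
have dV : pder k (fun y => (t y)^-1) z = - ((at_ == k)%:R / t z ^+ 2).
  by rewrite pderV // pder_tpart expr2 invfM.
have E a : a != at_ -> pder k (Gam a a at_) z = - ((at_ == k)%:R / t z ^+ 2).
  elim/ind8: a => [//|i _|_]; rewrite -dV; apply: (pder_eq _ oW) => // y Wy;
    rewrite (at_C (christoffel_table Wy)).
    by rewrite (at_xtx (christoffel_table Wy)) eqxx mul1r.
  exact: (at_rtr (christoffel_table Wy)).
have Ett : pder k (Gam at_ at_ at_) z = 0.
  by apply: (pder_zero oW) Wz => y Wy; exact: (at_tt (christoffel_table Wy)).
rewrite sum8 Ett (E arho) // (eq_bigr (fun=> - ((at_ == k)%:R / t z ^+ 2))).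
  by rewrite sumr_const card_ord add0r -[X in X + _]mulr_natl; field.
by move=> i _; exact: E.
Qed.

Section RicciAtPoint.
Variable z : 'rV[R]_8.
Hypothesis Wz : W z.
Let T := christoffel_table Wz.
Let t0 := t_neq0 Wz.
Let N0 k i : ~~ V k || V i -> half_dh k i z = 0 := fun Vki => half_dh0 Vki Wz.
Let L0 k i j (nVk : ~~ V k) (Vij : V i || V j) : Gam6 k i j z = 0 :=
  christoffel_h0 (@oWz z) (walker_g z) nVk Vij (in_slice Wz).
Let Ltr0 i j (Vj : V j) : Gam6 i i j z = 0 :=
  christoffel_trace0 (@oWz z) (walker_g z) i Vj (in_slice Wz).
Let dh0 i j : V i || V j -> dh i j z = 0 := fun Vij => dh_block Vij Wz.
Let dhC i j : dh i j z = dh j i z := dh_sym i j Wz.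
Let gC i j : gz i j z = gz j i z := gzC i j Wz.
Let Ng i j : \sum_m half_dh m j z * gz m i z = 2^-1 * dh i j z := half_dh_mul_gz i j Wz.

Lemma ricci_rr : ricci G z arho arho = 0.
Proof.
rewrite (ricci_val (div0 Wz _) (trace_r0 _ Wz) (trace_mul_rr T t0 N0) (quad_rr T N0)).
  by rewrite !subr0 addr0.
by move=> a y Wy; exact: (at_rr (christoffel_table Wy)).
Qed.

Lemma ricci_rt : ricci G z arho at_ = 0.
Proof.
rewrite (ricci_val (a := 0) _ (trace_r0 _ Wz) (trace_mul_rt T t0 N0) (quad_rt T N0)).
  by rewrite !subr0 addr0.
apply: big1 => a _; elim/ind8: a => [|i|].
- apply: (pder_zero oW) Wz => y Wy; rewrite (at_C (christoffel_table Wy)).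
  exact: (at_ttr (christoffel_table Wy)).
- apply: (pder_zero oW) Wz => y Wy; rewrite (at_C (christoffel_table Wy)).
  exact: (at_xtr (christoffel_table Wy)).
rewrite (pder_eq (G := fun y => (t y)^-1) _ oW) //; last first.
  move=> y Wy; rewrite (at_C (christoffel_table Wy)).
  exact: (at_rtr (christoffel_table Wy)).
rewrite pderV //; last exact: smooth_pderivable (smooth_tpart W) Wz.
by rewrite pder_tpart mul0r oppr0.
Qed.

Lemma ricci_rx i : ricci G z arho (xi i) = 0.
Proof.
rewrite (ricci_val (a := 0) _ (trace_r0 _ Wz) (trace_mul_rx T t0 N0 Ltr0 i)
  (quad_rx T N0 L0 i)); first by rewrite !subr0 addr0.
apply: big1 => a _; elim/ind8: a => [|m|].
- by apply: (pder_zero oW) Wz => y Wy; exact: (at_trx (christoffel_table Wy)).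
- rewrite -(pder_half_dh m i Wz); apply: (pder_eq _ oW) Wz => y Wy.
  exact: (at_xrx (christoffel_table Wy)).
- by apply: (pder_zero oW) Wz => y Wy; exact: (at_rrx (christoffel_table Wy)).
Qed.

(** Minus the t-derivative of the trace 7/t is 7/t^2, which the quadratic block cancels. *)
Lemma ricci_tt : ricci G z at_ at_ = 0.
Proof.
rewrite (ricci_val (div0 Wz _) (trace_t_pder _ Wz) (trace_mul_tt T t0 N0) (quad_tt T t0)).
  by rewrite eqxx mulr1 sub0r opprK addr0 subrr.
by move=> a y Wy; exact: (at_tt (christoffel_table Wy)).
Qed.

Lemma ricci_tx i : ricci G z at_ (xi i) = 0.
Proof.
rewrite (ricci_val (a := 0) _ (trace_t_pder _ Wz) (trace_mul_tx T t0 N0 i) (quad_tx T i)).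
  (* The trace block and the quadratic block are the traced symbols of g( , rho) divided by t; they
     agree by symmetry in the lower indices. *)
  rewrite ix8 mulr0 oppr0 subrr add0r; apply/eqP; rewrite subr_eq0; apply/eqP.
  apply: (congr1 (fun c => c / _)); apply: eq_bigr => m _.
  exact: (christoffelC (@oWz z) (aw_sym (walker_g z)) m m i (in_slice Wz)).
apply: big1 => a _; elim/ind8: a => [|m|].
- by apply: (pder_zero oW) Wz => y Wy; exact: (at_ttx (christoffel_table Wy)).
- rewrite (pder_eq (G := fun y => (m == i)%:R * (t y)^-1) _ oW) //; last first.
    by move=> y Wy; exact: (at_xtx (christoffel_table Wy)).
  have dt : pderivable (xi m) (@tpart R) z.
    exact: smooth_pderivable (smooth_tpart W) Wz.
  have dV : pderivable (xi m) (fun y => (t y)^-1) z by exact: derivableV.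
  rewrite (pderM (@pderivable_cst _ _ _ _ _) dV) pder_cst mul0r add0r pderV //.
  by rewrite pder_tpart mul0r oppr0 mulr0.
- by apply: (pder_zero oW) Wz => y Wy; exact: (at_rtx (christoffel_table Wy)).
Qed.

(** The coefficient of h' is -1/2 from the divergence, -7/2 from the trace block and +2 from the
    quadratic block, hence -2. The remaining terms are Ric of g( , rho). *)
Lemma ricci_xx i j : ricci G z (xi i) (xi j) =
  r z * pder arho (dh i j) z - 2 * dh i j z + ricci g0 (X z) i j.
Proof.
have A : \sum_a pder a (Gam a (xi i) (xi j)) z = - (2^-1 * dh i j z)
    + \sum_m pder m (christoffel (fun y => g y (r z)) m i j) (X z)
    + r z * pder arho (dh i j) z.
  rewrite sum8 pder_christoffel_t // pder_christoffel_r //.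
  apply: (congr1 (fun c => _ + c + _)); apply: eq_bigr => m _.
  exact: pder_christoffel_x.
have B : \sum_a pder (xi j) (Gam a a (xi i)) z =
    \sum_m pder j (christoffel (fun y => g y (r z)) m m i) (X z).
  have Et : pder (xi j) (Gam at_ at_ (xi i)) z = 0.
    by apply: (pder_zero oW) Wz => y Wy; exact: (at_ttx (christoffel_table Wy)).
  have Er : pder (xi j) (Gam arho arho (xi i)) z = 0.
    by apply: (pder_zero oW) Wz => y Wy; exact: (at_rrx (christoffel_table Wy)).
  rewrite sum8 Et Er add0r addr0.
  by apply: eq_bigr => m _; exact: pder_christoffel_x.
have C := trace_mul_xx T t0 N0 i j.
have D := quad_xx T t0 N0 dh0 dhC gC Ng i j.
have alg (a b c d p q s : R) : - (2^-1 * q) + a + s * p - b + (- (7 / 2 * q) + c)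
    - (- 2 * q + d) = s * p - 2 * q + (a - b + c - d) by field.
apply: (etrans (ricci_val A B C D)); apply: (etrans (alg _ _ _ _ _ _ _)).
apply: (congr1 (fun c => _ + c)).
(* At fixed rho the deformation is horizontal, so Ric of g( , rho) is that of [g0]. *)
rewrite -(ricci_perturb (@oWz z) (walker_slice z) (horizontal_slice z) (in_slice Wz)).
by rewrite mxE.
Qed.

End RicciAtPoint.

(** By symmetry six kinds of components suffice; five vanish identically and only the x-block is an
    equation. *)
Lemma ricci_flat_iff : ricci_flat_on W G <-> forall i j z, W z ->
  r z * pder arho (dh i j) z - 2 * dh i j z + ricci g0 (X z) i j = 0.
Proof.
split=> [flat i j z Wz|flat z Wz]; first by rewrite -ricci_xx // flat // mxE.
have sR a b : ricci G z a b = ricci G z b a.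
  by rewrite -{1}(ricci_sym oW smooth_G (fun y Wy => (invmx_G Wy).1) sym_G Wz) mxE.
apply/matrixP => a b; rewrite [RHS]mxE.
elim/ind8: a => [|i|]; elim/ind8: b => [|j|].
- exact: ricci_tt.
- exact: ricci_tx.
- by rewrite sR; exact: ricci_rt.
- by rewrite sR; exact: ricci_tx.
- by rewrite ricci_xx // flat.
- by rewrite sR; exact: ricci_rx.
- exact: ricci_rt.
- exact: ricci_rx.
- exact: ricci_rr.
Qed.

End AmbientMetric.

(** * Bryant's metrics *)

(* The leaves are spanned by d/dx^2, d/dy^1, d/dy^3. *)
Definition vertical6 : pred 'I_6 := fun i => odd i.

Lemma ord6_ind (P : 'I_6 -> Prop) : P ix1 -> P ix2 -> P ix3 -> P iy1 -> P iy2 -> P iy3 ->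
  forall i, P i.
Proof.
move=> P0 P1 P2 P3 P4 P5 [[|[|[|[|[|[|m]]]]]] im] //;
  by rewrite (bool_irrelevance im isT).
Qed.

Section X13.
Variable R : realType.
Implicit Types x : 'rV[R]_6.

Lemma x13_affine (h : R) x y : x13 (h *: x + y) = h *: x13 x + x13 y.
Proof.
by apply/rowP; case=> [[|[|m]] lt2] //=; rewrite !mxE.
Qed.

Lemma x13_delta i : x13 (delta_mx 0 i : 'rV[R]_6) =
  if i == ix1 then delta_mx 0 jx1 else if i == ix3 then delta_mx 0 jx3 else 0.
Proof.
apply/rowP => j; case: j => [[|[|m]] lt2] //=; elim/ord6_ind: i; by rewrite !mxE.
Qed.

Lemma x13_vertical i : vertical6 i -> x13 (delta_mx 0 i : 'rV[R]_6) = 0.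
Proof. by rewrite x13_delta; elim/ord6_ind: i. Qed.

Lemma x13_basis i : x13 (delta_mx 0 i : 'rV[R]_6) = 0 \/
  exists j, x13 (delta_mx 0 i : 'rV[R]_6) = delta_mx 0 j.
Proof.
rewrite x13_delta; case: ifP => _; first by right; exists jx1.
by case: ifP => _; [right; exists jx3|left].
Qed.

Lemma x13_cont : continuous (@x13 R).
Proof.
apply: continuous_rV => j.
have -> : (fun x => x13 x 0 j) = fun x : 'rV[R]_6 => x 0 (if j == jx1 then ix1 else ix3).
  by apply/funext => x; rewrite mxE; case: j => [[|[|m]] lt2].
exact: coord_continuous.
Qed.

Lemma x13_shift_vertical (s : R) c y : vertical6 c -> x13 (s *: delta_mx 0 c + y) = x13 y.
Proof. by move=> Vc; rewrite x13_affine x13_vertical // scaler0 add0r. Qed.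

End X13.

(** * The coframe along the leaves *)

Section Coframe.
Variables (R : realType) (U : set 'rV[R]_6) (f : 'rV[R]_2 -> R).
Hypothesis oU : open U.
Hypothesis sf : smooth_on (@x13 R @` U) f.
Implicit Types x : 'rV[R]_6.
Local Notation vinv := (vertical_inv vertical6 U).

Lemma vinv_x13 F : smooth_on (@x13 R @` U) F -> vinv (fun x => F (x13 x)).
Proof.
move=> sF; split.
  apply: (smooth_comp (@x13_affine R) (@x13_cont R) (@x13_basis R)) sF.
  by move=> x Ux; exists x.
move=> c Vc x _; apply: (pder_comp0 (@x13_affine R)); exact: x13_vertical.
Qed.

Lemma vinv_coord i : ~~ vertical6 i -> vinv (fun x => x 0 i).
Proof.
move=> nVi; split; first exact: smooth_coord.
move=> c Vc x _; rewrite pder_coord; case: eqP => // ic.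
by rewrite ic Vc in nVi.
Qed.

Lemma vinv_f3 : vinv (f_3 f).
Proof. by apply: vinv_x13; exact: smooth_pder. Qed.
Lemma vinv_f33 : vinv (f_33 f).
Proof. by apply: vinv_x13; do 2 apply: smooth_pder. Qed.
Lemma vinv_f13 : vinv (f_13 f).
Proof. by apply: vinv_x13; do 2 apply: smooth_pder. Qed.

Lemma theta1E x i : theta1 x 0 i = (i == iy1)%:R + x 0 ix2 * (i == ix3)%:R.
Proof. by rewrite !mxE. Qed.
Lemma theta2E x i : theta2 f x 0 i = (i == iy2)%:R + f (x13 x) * (i == ix1)%:R.
Proof. by rewrite !mxE. Qed.
Lemma theta3E x i : theta3 x 0 i = (i == iy3)%:R + x 0 ix1 * (i == ix2)%:R.
Proof. by rewrite !mxE. Qed.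
Lemma theta4E x i : theta4 f x 0 i = 3 / 2 * f_3 f x ^+ 2 * (i == ix1)%:R.
Proof. by rewrite !mxE. Qed.
Lemma theta5E x i : theta5 f x 0 i =
  3 / 2 * f_3 f x * (i == ix2)%:R - 2^-1 * f_33 f x * theta1 x 0 i.
Proof. by rewrite !mxE. Qed.
Lemma theta6E x i : theta6 f x 0 i =
  3 / 2 * f_3 f x ^+ 2 * (i == ix3)%:R + 2^-1 * f_13 f x * theta2 f x 0 i.
Proof. by rewrite !mxE. Qed.

Let vE F G : (forall x, F x = G x) -> vinv G -> vinv F.
Proof. by move=> FG; apply: (vinv_eq oU) => y _; rewrite FG. Qed.

Let cst (c : R) : vinv (fun=> c) := vinv_cst vertical6 U c.

Lemma vinv_theta2 i : vinv (fun x => theta2 f x 0 i).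
Proof.
apply: (vE (fun x => theta2E x i)); apply: (vinvD oU); first exact: cst.
by apply: (vinvM oU); [exact: vinv_x13|exact: cst].
Qed.

Let vinv_c2 : vinv (fun x => 3 / 2 * f_3 f x ^+ 2).
Proof.
apply: (vE (G := fun x => 3 / 2 * (f_3 f x * f_3 f x))) => [x|]; first by rewrite expr2.
by apply: (vinvM oU); [exact: cst|apply: (vinvM oU); exact: vinv_f3].
Qed.

Lemma vinv_theta4 i : vinv (fun x => theta4 f x 0 i).
Proof.
by apply: (vE (fun x => theta4E x i)); apply: (vinvM oU); [exact: vinv_c2|exact: cst].
Qed.

Lemma vinv_theta6 i : vinv (fun x => theta6 f x 0 i).
Proof.
apply: (vE (fun x => theta6E x i)); apply: (vinvD oU); apply: (vinvM oU).
- exact: vinv_c2.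
- exact: cst.
- by apply: (vinvM oU); [exact: cst|exact: vinv_f13].
- exact: vinv_theta2.
Qed.

Lemma vinv_theta3 i : vinv (fun x => theta3 x 0 i).
Proof.
apply: (vE (fun x => theta3E x i)); apply: (vinvD oU); first exact: cst.
by apply: (vinvM oU); [exact: vinv_coord|exact: cst].
Qed.

Lemma vinv_theta1 i : vertical6 i -> vinv (fun x => theta1 x 0 i).
Proof.
move=> Vi; apply: (vE (G := fun=> (i == iy1)%:R)); last exact: cst.
move=> x; rewrite theta1E (_ : (i == ix3) = false) ?mulr0 ?addr0 //.
by apply/eqP => E; rewrite E in Vi.
Qed.

Lemma vinv_theta5 i : vertical6 i -> vinv (fun x => theta5 f x 0 i).
Proof.
move=> Vi; apply: (vE (fun x => theta5E x i)); apply: (vinvB oU); apply: (vinvM oU).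
- by apply: (vinvM oU); [exact: cst|exact: vinv_f3].
- exact: cst.
- by apply: (vinvM oU); [exact: cst|exact: vinv_f33].
- exact: vinv_theta1.
Qed.

Lemma theta246_vertical x i : vertical6 i ->
  [/\ theta2 f x 0 i = 0, theta4 f x 0 i = 0 & theta6 f x 0 i = 0].
Proof.
rewrite theta4E theta6E theta2E; elim/ord6_ind: i => // _;
  by rewrite /= !mulr0 ?addr0 ?mulr0 ?addr0.
Qed.

Definition affine_along F := smooth_on U F /\ forall c, vertical6 c -> vinv (pder c F).

Lemma affine_vinv F : vinv F -> affine_along F.
Proof. by move=> vF; split=> [|c _]; [case: vF|exact: vinv_pder]. Qed.

Lemma affineD F G : affine_along F -> affine_along G -> affine_along (fun x => F x + G x).
Proof.
move=> [sF vF] [sG vG]; split; first exact: smoothD.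
move=> c Vc; apply: (vinv_eq oU (F := fun x => pder c F x + pder c G x)).
  move=> y Uy; rewrite pderD //; exact: smooth_pderivable Uy.
by apply: (vinvD oU); [exact: vF|exact: vG].
Qed.

(** One factor has to be constant along the leaves, since a product of two affine functions may be
    quadratic. *)
Lemma affineM F G : affine_along F -> vinv G -> affine_along (fun x => F x * G x).
Proof.
move=> [sF vF] [sG vG]; split; first exact: smoothM.
move=> c Vc; apply: (vinv_eq oU (F := fun x => pder c F x * G x)).
  move=> y Uy; rewrite pderM ?vG ?mulr0 ?addr0 //; exact: smooth_pderivable Uy.
by apply: (vinvM oU); [exact: vF|split].
Qed.

Lemma affine_eq F G : (forall x, F x = G x) -> affine_along G -> affine_along F.
Proof. by move=> FG; rewrite (_ : F = G) //; apply/funext. Qed.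

Lemma affine_theta1 i : affine_along (fun x => theta1 x 0 i).
Proof.
apply: (affine_eq (fun x => theta1E x i)); apply: affineD; first exact/affine_vinv/cst.
apply: affineM; last exact: cst.
split=> [|c Vc]; first exact: smooth_coord.
by rewrite pder_coord; exact: cst.
Qed.

Lemma affine_theta5 i : affine_along (fun x => theta5 f x 0 i).
Proof.
apply: (affine_eq (G := fun x => 3 / 2 * f_3 f x * (i == ix2)%:R
   + theta1 x 0 i * (- 2^-1 * f_33 f x))).
  by move=> x; rewrite theta5E; ring.
apply: affineD; [apply: affine_vinv|apply: affineM; first exact: affine_theta1];
  apply: (vinvM oU); try exact: cst; last exact: vinv_f33.
by apply: (vinvM oU); [exact: cst|exact: vinv_f3].
Qed.

Lemma sprod2E n (a b : 'rV[R]_n) i j :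
  (2 *: sprod a b) i j = a 0 i * b 0 j + b 0 i * a 0 j.
Proof.
rewrite /sprod scalerA divff ?pnatr_eq0 // scale1r mxE; congr (_ + _);
  by rewrite mxE big_ord1 mxE.
Qed.

Lemma bryantE x i j : bryant f x i j =
  (theta1 x 0 i * theta4 f x 0 j + theta4 f x 0 i * theta1 x 0 j)
  + (theta2 f x 0 i * theta5 f x 0 j + theta5 f x 0 i * theta2 f x 0 j)
  + (theta3 x 0 i * theta6 f x 0 j + theta6 f x 0 i * theta3 x 0 j).
Proof. by rewrite /bryant -!sprod2E mxE [X in X + _]mxE. Qed.

Lemma bryant_sym x : (bryant f x)^T = bryant f x.
Proof. by apply/matrixP => i j; rewrite mxE !bryantE; ring. Qed.

Lemma bryant_null x i j : vertical6 i -> vertical6 j -> bryant f x i j = 0.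
Proof.
move=> /(theta246_vertical x) [a2 a4 a6] /(theta246_vertical x) [b2 b4 b6].
by rewrite bryantE a2 a4 a6 b2 b4 b6 !mulr0 !mul0r !addr0.
Qed.

(** Only theta^1 and theta^5 contain x^2, and the metric pairs them with theta^4 and theta^2, which
    are constant along the leaves. *)
Lemma bryant_affine i j : affine_along (fun x => bryant f x i j).
Proof.
apply: (affine_eq (G := fun x =>
  (theta1 x 0 i * theta4 f x 0 j + theta1 x 0 j * theta4 f x 0 i)
  + (theta5 f x 0 j * theta2 f x 0 i + theta5 f x 0 i * theta2 f x 0 j)
  + (theta3 x 0 i * theta6 f x 0 j + theta3 x 0 j * theta6 f x 0 i))).
  by move=> x; rewrite bryantE; ring.
apply: affineD; [apply: affineD|]; apply: affineD; apply: affineM;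
  by [exact: affine_theta1|exact: affine_theta5|exact/affine_vinv/vinv_theta3
     |exact: vinv_theta2|exact: vinv_theta4|exact: vinv_theta6].
Qed.

(** On a vertical index theta^2, theta^4, theta^6 vanish, and theta^1, theta^5 lose the term x^2
    dx^3, the only source of dependence on the leaf. *)
Lemma bryant_mixed i j : vertical6 j -> vinv (fun x => bryant f x i j).
Proof.
move=> Vj; apply: (vE (G := fun x => theta4 f x 0 i * theta1 x 0 j
    + theta2 f x 0 i * theta5 f x 0 j + theta6 f x 0 i * theta3 x 0 j)).
  move=> x; have [b2 b4 b6] := theta246_vertical x Vj.
  by rewrite bryantE b2 b4 b6; ring.
apply: (vinvD oU); [apply: (vinvD oU)|]; apply: (vinvM oU);
  by [exact: vinv_theta1|exact: vinv_theta5|exact: vinv_theta3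
     |exact: vinv_theta2|exact: vinv_theta4|exact: vinv_theta6].
Qed.

End Coframe.

(** * The inverse of Bryant's metric *)

Section DualFrame.
Variables (R : realType) (f : 'rV[R]_2 -> R) (x : 'rV[R]_6).
Hypothesis f3_neq0 : f_3 f x != 0.

Let c1 := 3 / 2 * f_3 f x.
Let c2 := 3 / 2 * f_3 f x ^+ 2.

Definition coframe_mx : 'M[R]_6 := \matrix_(k, j) nth 0 [:: theta1 x 0 j;
  theta2 f x 0 j; theta3 x 0 j; theta4 f x 0 j; theta5 f x 0 j; theta6 f x 0 j] k.

(** The Gram matrix of the metric in the coframe, which pairs theta^k with theta^(k+3). *)
Definition pairing_mx : 'M[R]_6 :=
  \matrix_(k, l) ((k + 3 == l) || (l + 3 == k))%N%:R.

(* Row i expresses the i-th coordinate differential in the coframe. *)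
Definition dual_mx : 'M[R]_6 := \matrix_(i, k) nth 0 (nth [::] [::
  [:: 0; 0; 0; c2^-1; 0; 0];
  [:: 2^-1 * f_33 f x / c1; 0; 0; 0; c1^-1; 0];
  [:: 0; - (2^-1 * f_13 f x / c2); 0; 0; 0; c2^-1];
  [:: 1; x 0 ix2 * (2^-1 * f_13 f x / c2); 0; 0; 0; - (x 0 ix2 / c2)];
  [:: 0; 1; 0; - (f (x13 x) / c2); 0; 0];
  [:: - (x 0 ix1 * (2^-1 * f_33 f x / c1)); 0; 1; 0; - (x 0 ix1 / c1); 0]] i) k.

Lemma sum6 (F : 'I_6 -> R) :
  \sum_k F k = F ix1 + F ix2 + F ix3 + F iy1 + F iy2 + F iy3.
Proof.
rewrite !big_ord_recl big_ord0 addr0 !addrA.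
by congr (F _ + F _ + F _ + F _ + F _ + F _); exact: val_inj.
Qed.

Lemma dual_mulmx : dual_mx *m coframe_mx = 1%:M.
Proof.
apply/matrixP => i j; rewrite mxE sum6 [in RHS]mxE.
have E k : coframe_mx k j = nth 0 [:: theta1 x 0 j;
  theta2 f x 0 j; theta3 x 0 j; theta4 f x 0 j; theta5 f x 0 j; theta6 f x 0 j] k.
  by rewrite mxE.
rewrite !E /= theta5E theta6E theta4E theta3E theta2E theta1E {E}.
rewrite ![dual_mx _ _]mxE /c1 /c2 [RHS](_ : _ = (j == i)%:R); last by rewrite eq_sym.
by elim/ord6_ind: i => /=; field.
Qed.

Lemma bryant_coframe : bryant f x = coframe_mx^T *m pairing_mx *m coframe_mx.
Proof.
apply/matrixP => i j; rewrite bryantE [RHS]mxE sum6.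
have E k l : coframe_mx k l = nth 0 [:: theta1 x 0 l;
  theta2 f x 0 l; theta3 x 0 l; theta4 f x 0 l; theta5 f x 0 l; theta6 f x 0 l] k.
  by rewrite mxE.
have E2 k : (coframe_mx^T *m pairing_mx) i k =
    \sum_l coframe_mx l i * ((l + 3 == k) || (k + 3 == l))%N%:R.
  by rewrite mxE; apply: eq_bigr => l _; rewrite !mxE.
by rewrite !E2 !sum6 !E /= !mulr0 !mulr1 !addr0 !add0r; ring.
Qed.

Lemma pairing_mx_sq : pairing_mx *m pairing_mx = 1%:M.
Proof.
apply/matrixP => i j; rewrite mxE sum6 !mxE.
elim/ord6_ind: i; elim/ord6_ind: j => /=;
  by rewrite ?(mulr0, mulr1, addr0, add0r).
Qed.

(** From g = C^T J C with D C = 1 and J^2 = 1 the inverse is D J D^T. *)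
Lemma bryant_inv : bryant f x \in unitmx /\
  invmx (bryant f x) = dual_mx *m pairing_mx *m dual_mx^T.
Proof.
apply: mulmx1_invmx; have CD := mulmx1C dual_mulmx.
rewrite bryant_coframe -!mulmxA (mulmxA coframe_mx) CD mul1mx.
rewrite (mulmxA pairing_mx) pairing_mx_sq mul1mx -trmx_mul dual_mulmx.
exact: trmx1.
Qed.

(** dx^1, dx^3, dy^2 are combinations of theta^2, theta^4, theta^6, which sit at the odd positions.
    The pairing shifts positions by the odd number 3, so no two of these forms are paired. *)
Lemma bryant_conull i j : ~~ vertical6 i -> ~~ vertical6 j ->
  invmx (bryant f x) i j = 0.
Proof.
have N0 (p k : 'I_6) : ~~ vertical6 p -> ~~ odd k -> dual_mx p k = 0.
  by rewrite mxE; elim/ord6_ind: p => //= _; elim/ord6_ind: k => //=.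
move=> Vi Vj; rewrite bryant_inv.2 mxE big1 // => l _.
have [ol|el] := boolP (odd l); last by rewrite [dual_mx^T _ _]mxE N0 ?mulr0.
rewrite mxE big1 ?mul0r // => k _.
have [ok|ek] := boolP (odd k); last by rewrite N0 ?mul0r.
rewrite [pairing_mx _ _]mxE.
have [/orP[] /eqP kl|_] := boolP ((k + 3 == l) || (l + 3 == k))%N; last by rewrite mulr0.
- by move: ol; rewrite -kl oddD ok.
- by move: ok; rewrite -kl oddD ol.
Qed.

End DualFrame.

(** * Ricci and Schouten tensors of Bryant's metric *)

Section BryantRicci.
Variables (R : realType) (U : set 'rV[R]_6) (f : 'rV[R]_2 -> R).
Hypothesis oU : open U.
Hypothesis sf : smooth_on (@x13 R @` U) f.
Hypothesis f3_neq0 : forall x, U x -> f_3 f x != 0.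
Implicit Types x : 'rV[R]_6.

Lemma bryant_walker : affine_walker vertical6 U (bryant f).
Proof.
split.
- by move=> i j; case: (bryant_affine oU sf i j).
- by move=> x _; exact: bryant_sym.
- by move=> x /f3_neq0 /bryant_inv[].
- by move=> i j x Vi Vj _; exact: bryant_null.
- by move=> i j x Vi Vj /f3_neq0 f30; exact: bryant_conull.
- by move=> i j Vj; exact: bryant_mixed.
- by move=> c i j Vc; case: (bryant_affine oU sf i j) => _; exact.
Qed.

(** The vertical derivative of the metric: dx^3 replaces theta^1 in 2 theta^1 theta^4 and in the
    part - f_33 theta^2 theta^1 of 2 theta^2 theta^5. Translations in y^1 and y^3 are isometries,
    hence the factor selecting x^2. *)
Definition bryant_slope (c : 'I_6) x : 'M[R]_6 :=
  (c == ix2)%:R *: (2 *: sprod (dX R ix3) (theta4 f x)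
                    - f_33 f x *: sprod (theta2 f x) (dX R ix3)).

Lemma bryant_slopeE c y i j : bryant_slope c y i j = (c == ix2)%:R *
   ((i == ix3)%:R * theta4 f y 0 j + theta4 f y 0 i * (j == ix3)%:R
    - 2^-1 * f_33 f y * (theta2 f y 0 i * (j == ix3)%:R + (i == ix3)%:R * theta2 f y 0 j)).
Proof.
have dXE k : dX R ix3 0 k = (k == ix3)%:R by rewrite mxE.
have -> : bryant_slope c y = (c == ix2)%:R *: (2 *: sprod (dX R ix3) (theta4 f y)
    - (2^-1 * f_33 f y) *: (2 *: sprod (theta2 f y) (dX R ix3))).
  rewrite [_ *: (2 *: sprod (theta2 f y) _)]scalerA.
  by have -> : 2^-1 * f_33 f y * 2 = f_33 f y by field.
by rewrite -!dXE -!sprod2E [LHS]mxE [X in _ * X]mxE [X in _ + X]mxE [X in - X]mxE.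
Qed.

(** x^1 and x^3 do not move, so [f] and its derivatives are evaluated at the same point and the
    identity holds on all of R^6. *)
Lemma bryant_shift c (s : R) y : vertical6 c ->
  bryant f (s *: delta_mx 0 c + y) = bryant f y + s *: bryant_slope c y.
Proof.
move=> Vc; have x13s := x13_shift_vertical s y Vc.
have c3 : f_3 f (s *: delta_mx 0 c + y) = f_3 f y.
  exact: (congr1 (pder jx3 f) x13s).
have c33 : f_33 f (s *: delta_mx 0 c + y) = f_33 f y.
  exact: (congr1 (pder jx3 (pder jx3 f)) x13s).
have c13 : f_13 f (s *: delta_mx 0 c + y) = f_13 f y.
  exact: (congr1 (pder jx3 (pder jx1 f)) x13s).
have y1 : (s *: delta_mx 0 c + y) 0 ix1 = y 0 ix1.
  by rewrite !mxE; elim/ord6_ind: c Vc {x13s c3 c33 c13} => //= _; rewrite mulr0 add0r.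
have y2 : (s *: delta_mx 0 c + y) 0 ix2 = s * (c == ix2)%:R + y 0 ix2.
  by rewrite !mxE eq_sym.
apply/matrixP => i j; have mxDZ (A B : 'M[R]_6) : (A + s *: B) i j = A i j + s * B i j by rewrite !mxE.
rewrite mxDZ bryant_slopeE !bryantE.
rewrite !theta5E !theta6E !theta4E !theta3E !theta2E !theta1E c3 c33 c13 y1 y2 x13s.
by field.
Qed.

Lemma bryant_slope_horizontal c (s : R) :
  horizontal vertical6 U (fun y => s *: bryant_slope c y).
Proof.
have E i j x : (s *: bryant_slope c x) i j = s * ((c == ix2)%:R *
   ((i == ix3)%:R * theta4 f x 0 j + theta4 f x 0 i * (j == ix3)%:R
    - 2^-1 * f_33 f x * (theta2 f x 0 i * (j == ix3)%:R + (i == ix3)%:R * theta2 f x 0 j))).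
  by rewrite mxE bryant_slopeE.
have c0 (k : R) : vertical_inv vertical6 U (fun=> k) by exact: vinv_cst.
split.
- move=> i j; apply: (vinv_eq oU (fun x _ => esym (E i j x))).
  have t4 k := vinv_theta4 oU sf k; have t2 k := vinv_theta2 oU sf k.
  do 2 (apply: (vinvM oU); first exact: c0).
  apply: (vinvB oU); first by apply: (vinvD oU); apply: (vinvM oU).
  apply: (vinvM oU).
    by apply: (vinvM oU); [exact: c0|exact: vinv_f33].
  by apply: (vinvD oU); apply: (vinvM oU).
- by move=> x _; apply/matrixP => i j; rewrite mxE !E; ring.
move=> i j x Vi _; rewrite E; have [-> -> _] := theta246_vertical f x Vi.
rewrite (_ : (i == ix3) = false) ?(mulr0, mul0r, addr0, subr0) //.
by apply/eqP => i3; rewrite i3 in Vi.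
Qed.

Lemma bryant_ricci_vinv i j : vertical_inv vertical6 U (fun x => ricci (bryant f) x i j).
Proof.
apply: (ricci_vinv oU bryant_walker (A := bryant_slope)) => [c s y|c s] Vc.
  exact: bryant_shift.
exact: bryant_slope_horizontal.
Qed.

Lemma schouten6_bryant x : U x -> schouten6 (bryant f) x = 4^-1 *: ricci (bryant f) x.
Proof.
by move=> Ux; rewrite /schouten6 (scal_walker oU bryant_walker Ux) mul0r scale0r subr0.
Qed.

Lemma schouten6_bryant_horizontal : horizontal vertical6 U (schouten6 (bryant f)).
Proof.
have E i j x : U x -> 4^-1 * ricci (bryant f) x i j = schouten6 (bryant f) x i j.
  by move=> Ux; rewrite schouten6_bryant // [RHS]mxE.
have wb := bryant_walker; split.
- move=> i j; apply: (vinv_eq oU (@E i j)); apply: (vinvM oU); first exact: vinv_cst.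
  exact: bryant_ricci_vinv.
- move=> x Ux; rewrite schouten6_bryant // linearZ /=.
  by rewrite (ricci_sym oU (aw_smooth wb) (aw_unit wb) (aw_sym wb) Ux).
- move=> i j x Vi Ux; rewrite -E // (ricci_vertical oU wb) ?mulr0 ?Vi //.
Qed.

End BryantRicci.

(** * Deformations by S *)

Section Tensor246.
Variables (R : realType) (f : 'rV[R]_2 -> R).
Implicit Types (x : 'rV[R]_6) (s : idx246 -> R).

Definition entry246 (k : idx246) x (i j : 'I_6) : R :=
  let th2 := theta2 f x 0 in let th4 := theta4 f x 0 in let th6 := theta6 f x 0 in
  match k with
  | i22 => th2 i * th2 j
  | i24 => th2 i * th4 j + th4 i * th2 j
  | i26 => th2 i * th6 j + th6 i * th2 j
  | i44 => th4 i * th4 j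
  | i46 => th4 i * th6 j + th6 i * th4 j
  | i66 => th6 i * th6 j
  end.

(** Enumerates the six coefficients so that the tensor becomes one indexed sum; the default [i22] of
    [nth] is never reached. *)
Definition idx246_of (m : 'I_6) : idx246 := nth i22 [:: i22; i24; i26; i44; i46; i66] m.

Lemma sprodE n (a b : 'rV[R]_n) i j :
  sprod a b i j = 2^-1 * (a 0 i * b 0 j + b 0 i * a 0 j).
Proof. by rewrite -sprod2E [X in _ * X]mxE mulrA mulVf ?pnatr_eq0 ?mul1r. Qed.

Lemma tensor246E s x i j : tensor246 f s x i j =
  \sum_(m < 6) s (idx246_of m) * entry246 (idx246_of m) x i j.
Proof.
have lin (a1 a2 a3 a4 a5 a6 : R) (M1 M2 M3 M4 M5 M6 : 'M[R]_6) :
    (a1 *: M1 + a2 *: M2 + a3 *: M3 + a4 *: M4 + a5 *: M5 + a6 *: M6) i j =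
    a1 * M1 i j + a2 * M2 i j + a3 * M3 i j + a4 * M4 i j + a5 * M5 i j + a6 * M6 i j.
  by rewrite !mxE.
rewrite /tensor246 lin !sprodE sum6 /idx246_of /=.
by field.
Qed.

Lemma tensor246_vertical s x i j : vertical6 i -> tensor246 f s x i j = 0.
Proof.
move=> Vi; rewrite tensor246E big1 // => m _; apply/eqP; rewrite mulf_eq0; apply/orP.
right; apply/eqP; have [t2 t4 t6] := theta246_vertical f x Vi.
by case: (idx246_of m); rewrite /entry246 /= ?t2 ?t4 ?t6 ?mul0r ?addr0.
Qed.

Lemma tensor246_sym s x : (tensor246 f s x)^T = tensor246 f s x.
Proof.
apply/matrixP => i j; rewrite mxE !tensor246E; apply: eq_bigr => m _.
by congr (_ * _); case: (idx246_of m); rewrite /entry246 /=; ring.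
Qed.

Lemma tensor246_lin s1 s2 (a b : R) x i j :
  a * tensor246 f s1 x i j + b * tensor246 f s2 x i j =
  tensor246 f (fun k => a * s1 k + b * s2 k) x i j.
Proof.
rewrite !tensor246E !mulr_sumr -big_split /=; apply: eq_bigr => m _.
by ring.
Qed.

(** The six products are linearly independent because theta^2, theta^4, theta^6 are, as soon as f_3
    is nonzero. *)
Lemma tensor246_inj s x : f_3 f x != 0 -> tensor246 f s x = 0 -> forall k, s k = 0.
Proof.
move=> f30 T0; have c0 : 3 / 2 * f_3 f x ^+ 2 != 0.
  by rewrite mulf_neq0 ?expf_neq0 // mulf_neq0 ?invr_eq0 ?pnatr_eq0.
have E i j : \sum_(m < 6) s (idx246_of m) * entry246 (idx246_of m) x i j = 0.
  by rewrite -tensor246E T0 mxE.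
(* This order makes the system triangular: dx^3 occurs only in theta^6, and among the other two dy^2
   occurs only in theta^2. The entries give s66, s26, s22, s46, s24, s44 in turn. *)
have E33 := E ix3 ix3; have E32 := E ix3 iy2; have E22 := E iy2 iy2.
have E31 := E ix3 ix1; have E12 := E ix1 iy2; have E11 := E ix1 ix1.
move: E33 E32 E22 E31 E12 E11; rewrite !sum6 /idx246_of /entry246 /=.
rewrite !theta6E !theta4E !theta2E /=.
rewrite !(mulr0, mul0r, addr0, add0r, mulr1, mul1r).
set c := 3 / 2 * _ in c0 *; set d := 2^-1 * _.
have reg (u v : R) : v != 0 -> u * v = 0 -> u = 0.
  by move=> v0 /eqP; rewrite mulf_eq0 (negbTE v0) orbF => /eqP.
move=> /(reg _ _ (mulf_neq0 c0 c0)) s66; rewrite s66 ?(mul0r, addr0, add0r).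
move=> /(reg _ _ c0) s26; rewrite s26 ?(mul0r, addr0, add0r).
move=> s22; rewrite s22 ?(mul0r, addr0, add0r).
move=> /(reg _ _ (mulf_neq0 c0 c0)) s46; rewrite s46 ?(mul0r, addr0, add0r).
move=> /(reg _ _ c0) s24; rewrite s24 ?(mul0r, addr0, add0r).
move=> /(reg _ _ (mulf_neq0 c0 c0)) s44.
by case.
Qed.

End Tensor246.

Section X13rho.
Variable R : realType.
Implicit Types (x : 'rV[R]_6) (z : 'rV[R]_8) (rho : R).

Definition x13rho8 z : 'rV[R]_3 := x13rho (xpart z) (rhopart z).

Lemma x13rho8E z j : x13rho8 z 0 j = z 0 (nth at_ [:: xi ix1; xi ix3; arho] j).
Proof. by rewrite mxE !xpartE; case: j => [[|[|[|m]]] lt3]. Qed.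

Lemma x13rho8_affine (h : R) z1 z2 : x13rho8 (h *: z1 + z2) = h *: x13rho8 z1 + x13rho8 z2.
Proof.
apply/rowP => j; have lin (u v : 'rV[R]_3) : (h *: u + v) 0 j = h * u 0 j + v 0 j.
  by rewrite !mxE.
by rewrite lin !x13rho8E !mxE.
Qed.

Lemma x13rho8_arho : x13rho8 (delta_mx 0 arho) = delta_mx 0 krho.
Proof.
apply/rowP => j; rewrite x13rho8E !mxE.
by case: j => [[|[|[|m]]] lt3] //=; rewrite ix8.
Qed.

Lemma x13rho8_vertical c : vertical6 c -> x13rho8 (delta_mx 0 (xi c)) = 0.
Proof.
move=> Vc; apply/rowP => j; rewrite x13rho8E !mxE.
by case: j => [[|[|[|m]]] lt3] //=; rewrite ?ix8 //; elim/ord6_ind: c Vc.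
Qed.

Lemma x13rho8_basis a : x13rho8 (delta_mx 0 a) = 0 \/
  exists j, x13rho8 (delta_mx 0 a) = delta_mx 0 j.
Proof.
elim/ind8: a => [|i|]; last by right; exists krho; exact: x13rho8_arho.
  left; apply/rowP => j; rewrite x13rho8E !mxE.
  by case: j => [[|[|[|m]]] lt3].
have [Vi|] := boolP (vertical6 i); first by left; exact: x13rho8_vertical.
elim/ord6_ind: i => // _.
- right; exists (@Ordinal 3 0 isT); apply/rowP => j; rewrite x13rho8E !mxE.
  by case: j => [[|[|[|m]]] lt3].
- right; exists (@Ordinal 3 1 isT); apply/rowP => j; rewrite x13rho8E !mxE.
  by case: j => [[|[|[|m]]] lt3].
left; apply/rowP => j; rewrite x13rho8E !mxE.
by case: j => [[|[|[|m]]] lt3].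
Qed.

Lemma x13rho8_cont : continuous x13rho8.
Proof.
apply: continuous_rV => j.
rewrite (_ : (fun z => _) = fun z : 'rV[R]_8 => z 0 (nth at_ [:: xi ix1; xi ix3; arho] j)).
  exact: coord_continuous.
by apply/funext => z; rewrite x13rho8E.
Qed.

End X13rho.

(** * Ricci-flatness as a system of equations for the coefficients *)

Section AmbientS.
Variables (R : realType) (U : set 'rV[R]_6) (D : set 'rV[R]_3) (f : 'rV[R]_2 -> R).
Hypothesis oU : open U.
Hypothesis DU : rho_region U D.
Hypothesis sf : smooth_on (@x13 R @` U) f.
Hypothesis f3_neq0 : forall x, U x -> f_3 f x != 0.
Local Notation W := (region8 U D).

Lemma region8_open : open W.
Proof.
have [oD _ _ _] := DU.
have -> : W = [set z | 0 < tpart z] `&` (@xpart R @^-1` U) `&` (@x13rho8 R @^-1` D).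
  by apply/seteqP; split=> z /=; [case=> ? ? ?; split|case=> [[]]].
apply: openI; first apply: openI.
- apply: (@open_comp _ _ (@tpart R) [set y | 0 < y]); last exact: open_gt.
  by move=> z _; exact: coord_continuous.
- by apply: open_comp => // z _; exact: xpart_cont.
- by apply: open_comp => // z _; exact: x13rho8_cont.
Qed.

Let oW := region8_open.
Let W_gt0 z : W z -> 0 < tpart z. Proof. by case. Qed.
Let WU z : W z -> U (xpart z). Proof. by case. Qed.
Let WD z : W z -> D (x13rho8 z). Proof. by case. Qed.

Lemma smooth_x13rho8 F : smooth_on D F -> smooth_on W (fun z => F (x13rho8 z)).
Proof.
apply: (smooth_comp (@x13rho8_affine R)); first exact: x13rho8_cont.
  exact: x13rho8_basis.
exact: WD.
Qed.

Lemma pder_x13rho8_v (F : 'rV[R]_3 -> R) c z : vertical6 c -> pder (xi c) (fun z => F (x13rho8 z)) z = 0.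
Proof.
move=> Vc; apply: (pder_comp0 (@x13rho8_affine R)); exact: x13rho8_vertical.
Qed.

Lemma pder_x13rho8_r (F : 'rV[R]_3 -> R) z :
  pder arho (fun z => F (x13rho8 z)) z = pder krho F (x13rho8 z).
Proof. exact: (pder_comp (@x13rho8_affine R) F z (@x13rho8_arho R)). Qed.

Lemma pder_xpart_v (F : 'rV[R]_6 -> R) c z : vertical_inv vertical6 U F -> vertical6 c -> W z ->
  pder (xi c) (fun z => F (xpart z)) z = 0.
Proof.
move=> [_ F0] Vc Wz; rewrite -(F0 c Vc _ (WU Wz)).
exact: (pder_comp (@xpart_affine R) F z (xpart_xi R c)).
Qed.

Lemma pder_xpart_r (F : 'rV[R]_6 -> R) z : pder arho (fun z => F (@xpart R z)) z = 0.
Proof. exact: (pder_comp0 (@xpart_affine R) F z (xpart_arho R)). Qed.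

Lemma vinv_entry246 k i j : vertical_inv vertical6 U (fun x => entry246 f k x i j).
Proof.
have t2 m := vinv_theta2 oU sf m; have t4 m := vinv_theta4 oU sf m.
have t6 m := vinv_theta6 oU sf m.
by case: k; rewrite /entry246 /=;
  first [apply: (vinvM oU)|apply: (vinvD oU); apply: (vinvM oU)].
Qed.

Local Notation T s i j := (fun z => tensor246 f (fun k => s k (x13rho8 z)) (xpart z) i j).

Section TensorField.
Variable S : idx246 -> 'rV[R]_3 -> R.
Hypothesis sS : forall k, smooth_on D (S k).

Let termE i j z : \sum_m S (idx246_of m) (x13rho8 z) * entry246 f (idx246_of m) (xpart z) i j =
  T S i j z.
Proof. exact/esym/tensor246E. Qed.

Let sterm m i j : smooth_on W (fun z =>
  S (idx246_of m) (x13rho8 z) * entry246 f (idx246_of m) (xpart z) i j).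
Proof.
apply: smoothM => //; first exact: smooth_x13rho8.
exact: (smooth_xpart WU (vinv_smooth (vinv_entry246 _ i j))).
Qed.

Lemma smooth_tensor i j : smooth_on W (T S i j).
Proof.
apply: (smooth_eq oW (fun z _ => termE i j z)).
by apply: smooth_sum => // m _; exact: sterm.
Qed.

Let pder_tensor a i j z : W z -> pder a (T S i j) z = \sum_m
  (pder a (fun z => S (idx246_of m) (x13rho8 z)) z * entry246 f (idx246_of m) (xpart z) i j
   + S (idx246_of m) (x13rho8 z) * pder a (fun z => entry246 f (idx246_of m) (xpart z) i j) z).
Proof.
move=> Wz; rewrite -(pder_eq a oW (fun z _ => termE i j z) Wz).
rewrite (pder_sum a oW Wz (fun m => sterm m i j)); apply: eq_bigr => m _.
rewrite pderM //; first exact: smooth_pderivable (smooth_x13rho8 (sS _)) Wz.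
exact: smooth_pderivable (smooth_xpart WU (vinv_smooth (vinv_entry246 _ i j))) Wz.
Qed.

Lemma pder_tensor_v c i j z : vertical6 c -> W z -> pder (xi c) (T S i j) z = 0.
Proof.
move=> Vc Wz; rewrite pder_tensor // big1 // => m _.
rewrite pder_x13rho8_v // (pder_xpart_v (vinv_entry246 _ i j) Vc Wz).
by rewrite mul0r mulr0 addr0.
Qed.

Lemma pder_tensor_r i j z : W z ->
  pder arho (T S i j) z = T (fun k => pder krho (S k)) i j z.
Proof.
move=> Wz; rewrite pder_tensor // /= tensor246E; apply: eq_bigr => m _.
rewrite pder_x13rho8_r (pder_xpart_r (fun x => entry246 f _ x i j)).
by rewrite mulr0 addr0.
Qed.

End TensorField.

Definition deformation (S : idx246 -> 'rV[R]_3 -> R) x (rho : R) : 'M[R]_6 :=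
  (2 * rho) *: schouten6 (bryant f) x + S_tensor f S x rho.

Lemma g_fS_deformation S :
  g_fS f S = ambient_form (fun x rho => bryant f x + deformation S x rho).
Proof.
apply/funext => z; rewrite /g_fS /ambient_form /deformation.
by rewrite (addrA (bryant f _)).
Qed.

Local Notation P i j := (fun x => schouten6 (bryant f) x i j).
Let hP := schouten6_bryant_horizontal oU sf f3_neq0.
Let sP i j : smooth_on W (fun z => schouten6 (bryant f) (xpart z) i j) :=
  smooth_xpart WU (vinv_smooth (hor_inv hP i j)).

Section Deformation.
Variable S : idx246 -> 'rV[R]_3 -> R.
Hypothesis sS : forall k, smooth_on D (S k).
Local Notation h := (deformation S).
Local Notation hz i j := (fun z => h (xpart z) (rhopart z) i j).

Lemma deformationE i j z : h (xpart z) (rhopart z) i j =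
  2 * rhopart z * schouten6 (bryant f) (xpart z) i j + T S i j z.
Proof.
have lin (a : R) (A B : 'M[R]_6) : (a *: A + B) i j = a * A i j + B i j by rewrite !mxE.
exact: lin.
Qed.

Let s2r : smooth_on W (fun z => 2 * rhopart z).
Proof. by apply: smoothM => //; [exact: smooth_cst|exact: smooth_rhopart]. Qed.

Let s2rP i j : smooth_on W (fun z => 2 * rhopart z * schouten6 (bryant f) (xpart z) i j).
Proof. exact: (smoothM oW s2r (sP i j)). Qed.

Lemma smooth_deformation i j : smooth_on W (hz i j).
Proof.
apply: (smooth_eq oW (fun z _ => esym (deformationE i j z))).
exact: (smoothD oW (s2rP i j) (smooth_tensor sS i j)).
Qed.

Lemma pder_deformation a i j z : W z -> pder a (hz i j) z =
  2 * (arho == a)%:R * schouten6 (bryant f) (xpart z) i j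
  + 2 * rhopart z * pder a (fun z => schouten6 (bryant f) (xpart z) i j) z
  + pder a (T S i j) z.
Proof.
move=> Wz; rewrite (pder_eq a oW (fun z _ => deformationE i j z) Wz).
have dr := smooth_pderivable (i := a) (smooth_rhopart W) Wz.
rewrite (pderD (smooth_pderivable (s2rP i j) Wz)
  (smooth_pderivable (smooth_tensor sS i j) Wz)).
rewrite (pderM (smooth_pderivable s2r Wz) (smooth_pderivable (sP i j) Wz)).
by rewrite (pderM (@pderivable_cst _ _ _ _ _) dr) pder_cst mul0r add0r pder_rhopart.
Qed.

Lemma deformation_vertical c i j z : vertical6 c -> W z -> pder (xi c) (hz i j) z = 0.
Proof.
move=> Vc Wz; rewrite pder_deformation // ix8 (pder_tensor_v sS i j Vc Wz).
by rewrite (pder_xpart_v (hor_inv hP i j) Vc Wz) !mulr0 mul0r !addr0.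
Qed.

Lemma deformation_sym z : W z ->
  (h (xpart z) (rhopart z))^T = h (xpart z) (rhopart z).
Proof.
move=> Wz; rewrite /deformation linearD linearZ /= (hor_sym hP (WU Wz)).
by congr (_ + _); exact: tensor246_sym.
Qed.

Lemma deformation_block i j z : vertical6 i -> W z -> h (xpart z) (rhopart z) i j = 0.
Proof.
move=> Vi Wz; rewrite deformationE (hor_block hP j Vi (WU Wz)) mulr0 add0r.
exact: tensor246_vertical.
Qed.

Lemma deformation_dr i j z : W z -> pder arho (hz i j) z =
  2 * schouten6 (bryant f) (xpart z) i j + T (fun k => pder krho (S k)) i j z.
Proof.
move=> Wz; rewrite pder_deformation // (pder_tensor_r sS) //.
by rewrite (pder_xpart_r (P i j)) eqxx mulr1 mulr0 addr0.
Qed.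

Lemma deformation_drr i j z : W z -> pder arho (pder arho (hz i j)) z =
  T (fun k => pder krho (pder krho (S k))) i j z.
Proof.
move=> Wz; rewrite (pder_eq arho oW (fun z => @deformation_dr i j z) Wz).
have sS' k : smooth_on D (pder krho (S k)) by exact: smooth_pder.
have s2P : smooth_on W (fun z => 2 * schouten6 (bryant f) (xpart z) i j).
  by apply: smoothM => //; exact: smooth_cst.
rewrite (pderD (smooth_pderivable s2P Wz) (smooth_pderivable (smooth_tensor sS' i j) Wz)).
rewrite (pder_tensor_r sS') //.
rewrite (pderM (@pderivable_cst _ _ _ _ _) (smooth_pderivable (sP i j) Wz)).
by rewrite pder_cst (pder_xpart_r (P i j)) mul0r mulr0 addr0 add0r.
Qed.

Let flatP := ricci_flat_iff oW W_gt0 WU (bryant_walker oU sf f3_neq0)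
  smooth_deformation deformation_vertical deformation_sym deformation_block.

(** The part 2 rho P has no second derivative, and its first one gives -4P, which cancels Ric =
    4P. *)
Lemma ricci_flat_tensor : ricci_flat_on W (g_fS f S) <->
  forall z, W z -> tensor246 f (fun k => rhopart z * pder krho (pder krho (S k)) (x13rho8 z)
    - 2 * pder krho (S k) (x13rho8 z)) (xpart z) = 0.
Proof.
have E i j z : W z ->
    rhopart z * pder arho (pder arho (hz i j)) z - 2 * pder arho (hz i j) z
      + ricci (bryant f) (xpart z) i j =
    tensor246 f (fun k => rhopart z * pder krho (pder krho (S k)) (x13rho8 z)
      - 2 * pder krho (S k) (x13rho8 z)) (xpart z) i j.
  move=> Wz; rewrite deformation_drr // deformation_dr //.
  rewrite (schouten6_bryant oU sf f3_neq0 (WU Wz)).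
  have lin := tensor246_lin f (fun k => pder krho (pder krho (S k)) (x13rho8 z))
    (fun k => pder krho (S k) (x13rho8 z)) (rhopart z) (- 2) (xpart z) i j.
  have alg (u a b c p : R) : p = 4^-1 * c ->
    u * a - 2 * (2 * p + b) + c = u * a + - 2 * b by move=> ->; field.
  apply: (etrans _ (etrans lin _)).
    by apply: alg; move: (ricci _ _) => M; rewrite mxE.
  apply: (congr1 (fun s => tensor246 f s (xpart z) i j)); apply/funext => k.
  by rewrite mulNr.
rewrite g_fS_deformation flatP; split=> [flat z Wz|flat i j z Wz].
  by apply/matrixP => i j; rewrite -E // [RHS]mxE; exact: flat.
by rewrite E // flat // mxE.
Qed.

Lemma ricci_flat_pde : ricci_flat_on W (g_fS f S) <-> forall k, rho_pde D (S k).
Proof.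
have [_ DE _ _] := DU.
rewrite ricci_flat_tensor; split=> [flat k q Dq|pde z Wz].
  have [x Ux qE] := DE q Dq.
  (* A point of the domain above [q], chosen with t = 1. *)
  pose z : 'rV[R]_8 := x *m (xmx R)^T + (delta_mx 0 at_ + q 0 krho *: delta_mx 0 arho).
  have tz : tpart z = 1.
    have lin (u v : 'rV[R]_8) a : (u + (v + a *: delta_mx 0 arho)) 0 at_ = u 0 at_ + v 0 at_.
      by rewrite !mxE mulr0 addr0.
    by rewrite /tpart lin trX_at mxE add0r.
  have rz : rhopart z = q 0 krho.
    have lin (u v : 'rV[R]_8) a : (u + (v + a *: delta_mx 0 arho)) 0 arho =
      u 0 arho + (v 0 arho + a) by rewrite !mxE mulr1.
    by rewrite /rhopart lin trX_arho mxE !add0r.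
  have xz : xpart z = x.
    rewrite /xpart mulmxDl -mulmxA trX_mulX mulmx1 mulmxDl -scalemxAl.
    by rewrite -/(xpart _) -/(xpart (delta_mx 0 arho)) xpart_at xpart_arho scaler0 !addr0.
  have zq : x13rho8 z = q by rewrite /x13rho8 xz rz -qE.
  have Wz : W z by split; rewrite ?tz ?xz // -/(x13rho _ _) rz -qE.
  have := tensor246_inj (f3_neq0 (WU Wz)) (flat z Wz) k.
  by rewrite rz zq.
apply/matrixP => i j; rewrite tensor246E [RHS]mxE big1 // => m _.
have := pde (idx246_of m) _ (WD Wz).
rewrite {1}/x13rho8 mxE /= => ->; exact: mul0r.
Qed.

Hypothesis S0 : forall k, initial_condition D (S k).

Lemma g_fS_ambient : (forall k, rho_pde D (S k)) -> ambient_metric U (bryant f) W (g_fS f S).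
Proof.
move=> pde; have [_ _ D0 _] := DU.
have wb := bryant_walker oU sf f3_neq0.
split.
- split=> [|z [] //|z t0 Ux r0]; first exact: oW.
  by split=> //; rewrite r0; exact: D0.
- rewrite g_fS_deformation; split.
  + exact: (smooth_G oW WU wb smooth_deformation).
  + exact: (sym_G WU wb deformation_sym).
  + move=> z Wz; exact: (invmx_G oW W_gt0 WU wb smooth_deformation
      deformation_vertical deformation_sym deformation_block Wz).1.
- exact/ricci_flat_pde.
exists (fun x rho => bryant f x + deformation S x rho); split.
  (* At rho = 0 the Schouten term vanishes through its factor, and [S] by the initial condition. *)
  move=> x Ux; rewrite /deformation mulr0 scale0r add0r.
  apply/matrixP => i j; rewrite mxE /S_tensor tensor246E big1 ?addr0 // => m _.
  by rewrite S0 ?mul0r //; [exact: D0|rewrite mxE].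
by move=> z _; rewrite g_fS_deformation.
Qed.

End Deformation.
End AmbientS.

(** * The equation in rho *)

Section RhoPde.
Variables (R : realType) (U : set 'rV[R]_6) (D : set 'rV[R]_3).
Hypothesis oU : open U.
Hypothesis DU : rho_region U D.
Implicit Types (x : 'rV[R]_6) (rho : R) (q : 'rV[R]_3).

Let oD : open D. Proof. by case: DU. Qed.

Local Notation rho_ := (fun q : 'rV[R]_3 => q 0 krho).
Local Notation d F := (pder krho F).

Let srho : smooth_on D rho_. Proof. exact: smooth_coord. Qed.

Let d_rho q : d rho_ q = 1.
Proof. by rewrite pder_coord eqxx. Qed.

Let d_rhoM F q : smooth_on D F -> D q ->
  d (fun q => q 0 krho * F q) q = F q + q 0 krho * d F q.
Proof.
move=> sF Dq.
rewrite (pderM (smooth_pderivable srho Dq) (smooth_pderivable sF Dq)).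
by rewrite d_rho mul1r.
Qed.

Let d_cM (c : R) F q : smooth_on D F -> D q -> d (fun q => c * F q) q = c * d F q.
Proof.
move=> sF Dq; rewrite (pderM (@pderivable_cst _ _ _ _ _) (smooth_pderivable sF Dq)).
by rewrite pder_cst mul0r add0r.
Qed.

Let d_eq0 F q : (forall q, D q -> F q = 0) -> D q -> d F q = 0.
Proof. exact: (pder_zero oD). Qed.

(** Written as nested products by rho, so that the rule for one factor rho is applied three
    times. *)
Let d_cube F q : smooth_on D F -> (forall q, D q -> d F q = 0) -> D q ->
  d (fun q => q 0 krho ^+ 3 * F q) q = 3 * q 0 krho ^+ 2 * F q.
Proof.
move=> sF F0 Dq.
have s1 : smooth_on D (fun q => q 0 krho * F q) by exact: smoothM.
have s2 : smooth_on D (fun q => q 0 krho * (q 0 krho * F q)) by exact: smoothM.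
have -> : (fun q => q 0 krho ^+ 3 * F q) =
    fun q => q 0 krho * (q 0 krho * (q 0 krho * F q)).
  by apply/funext => y; ring.
by rewrite !d_rhoM // F0 //; ring.
Qed.

Let d_sq F q : smooth_on D F -> (forall q, D q -> d F q = 0) -> D q ->
  d (fun q => 3 * q 0 krho ^+ 2 * F q) q = 6 * q 0 krho * F q.
Proof.
move=> sF F0 Dq.
have s1 : smooth_on D (fun q => q 0 krho * F q) by exact: smoothM.
have s2 : smooth_on D (fun q => q 0 krho * (q 0 krho * F q)) by exact: smoothM.
have -> : (fun q => 3 * q 0 krho ^+ 2 * F q) =
    fun q => 3 * (q 0 krho * (q 0 krho * F q)).
  by apply/funext => y; ring.
by rewrite d_cM // !d_rhoM // F0 //; ring.
Qed.

(* Differentiating rho S'' = 2 S' gives rho S''' = S'', then rho S'''' = 0. *)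
Lemma rho_pde_cubic S x rho : smooth_on D S -> initial_condition D S -> rho_pde D S ->
  U x -> D (x13rho x rho) ->
  S (x13rho x rho) = rho ^+ 3 * (6^-1 * d (d (d S)) (x13rho x 0)).
Proof.
move=> sS S0 pde Ux Dr; have [_ _ D0 _] := DU.
have s1 := smooth_pder krho sS; have s2 := smooth_pder krho s1.
have s3 := smooth_pder krho s2; have s4 := smooth_pder krho s3.
have sr F : smooth_on D F -> smooth_on D (fun q => q 0 krho * F q).
  by move=> sF; exact: smoothM.
have sc c F : smooth_on D F -> smooth_on D (fun q => c * F q).
  by move=> sF; apply: smoothM => //; exact: smooth_cst.
have alg3 (a b u : R) : b + u * a - 2 * b = 0 -> u * a - b = 0.
  by move=> e; apply: etrans e; ring.
have alg4 (a b u : R) : b + u * a - b = 0 -> u * a = 0.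
  by move=> e; apply: etrans e; ring.
(* With rho S''' = S'' and rho S'' = 2 S' one gets S' = rho^2 S'''/2, the derivative of rho^3 S'''/6
   for constant S'''. *)
have algG (a b c u : R) : u * a - b = 0 -> u * b - 2 * c = 0 ->
    c - 3 * u ^+ 2 * (6^-1 * a) = 0.
  move=> /eqP; rewrite subr_eq0 => /eqP <- /eqP; rewrite subr_eq0 => /eqP e.
  have -> : c = 2^-1 * (u * (u * a)) by rewrite e; field.
  by field.
have E3 q : D q -> q 0 krho * d (d (d S)) q - d (d S) q = 0.
  move=> Dq; have := d_eq0 pde Dq.
  rewrite (pderB (smooth_pderivable (sr _ s2) Dq) (smooth_pderivable (sc 2 _ s1) Dq)).
  rewrite (d_rhoM s2 Dq) (d_cM 2 s1 Dq); exact: alg3.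
have E4 q : D q -> q 0 krho * d (d (d (d S))) q = 0.
  move=> Dq; have := d_eq0 E3 Dq.
  rewrite (pderB (smooth_pderivable (sr _ s3) Dq) (smooth_pderivable s2 Dq)).
  rewrite (d_rhoM s3 Dq); exact: alg4.
have E5 q : D q -> d (d (d (d S))) q + q 0 krho * d (d (d (d (d S)))) q = 0.
  by move=> Dq; have := d_eq0 E4 Dq; rewrite (d_rhoM s4 Dq).
have D4 q : D q -> d (d (d (d S))) q = 0.
  (* Off rho = 0 the factor rho is cancelled in [E4]. At rho = 0 that equation is empty, but its
     derivative [E5] reduces to the claim. *)
  move=> Dq; have [r0|r0] := eqVneq (q 0 krho) 0.
    by have := E5 q Dq; rewrite r0 mul0r addr0.
  by have /eqP := E4 q Dq; rewrite mulf_eq0 (negbTE r0) => /eqP.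
have s6 := sc 6^-1 _ s3.
have D6 q : D q -> d (fun q => 6^-1 * d (d (d S)) q) q = 0.
  by move=> Dq; rewrite (d_cM _ s3 Dq) D4 // mulr0.
(* The error of the cubic formula has zero rho-derivative and vanishes at rho = 0, hence on the
   whole fibre. *)
pose G q := S q - q 0 krho ^+ 3 * (6^-1 * d (d (d S)) q).
have sc3 : smooth_on D (fun q => q 0 krho ^+ 3 * (6^-1 * d (d (d S)) q)).
  by apply: smoothM => //; exact: smoothX.
have G0 q : D q -> d G q = 0.
  move=> Dq; rewrite (pderB (smooth_pderivable sS Dq) (smooth_pderivable sc3 Dq)).
  by rewrite (d_cube s6 D6 Dq); exact: algG (E3 q Dq) (pde q Dq).
have sG : smooth_on D G by exact: smoothB.
have x0 r : (x13rho x r) 0 krho = r by rewrite mxE.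
have Gx0 : G (x13rho x 0) = 0.
  by rewrite /G (S0 _ (D0 x Ux) (x0 0)) (x0 0) expr0n /= mul0r subr0.
have := etrans (fiber_const DU sG G0 Ux Dr) Gx0.
rewrite /G (x0 rho) => /eqP; rewrite subr_eq0 => /eqP e; apply: (etrans e).
apply: (congr1 (fun c => rho ^+ 3 * (6^-1 * c))).
exact: (fiber_const DU s3 D4 Ux Dr).
Qed.

Definition proj13 q : 'rV[R]_2 := \row_j q 0 (widen_ord (leqnSn 2) j).

Lemma proj13_x13rho x rho : proj13 (x13rho x rho) = x13 x.
Proof. by apply/rowP => j; rewrite !mxE; case: j => [[|[|m]] lt2]. Qed.

Lemma proj13_affine (h : R) p q : proj13 (h *: p + q) = h *: proj13 p + proj13 q.
Proof. by apply/rowP => j; rewrite !mxE. Qed.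

Lemma proj13_krho : proj13 (delta_mx 0 krho) = 0.
Proof. by apply/rowP => j; rewrite !mxE; case: j => [[|[|m]] lt2]. Qed.

Lemma proj13_basis i : proj13 (delta_mx 0 i) = 0 \/
  exists j, proj13 (delta_mx 0 i) = delta_mx 0 j.
Proof.
case: i => [[|[|[|m]]] lt3] //.
- by right; exists jx1; apply/rowP => j; rewrite !mxE; case: j => [[|[|m]] lt2].
- by right; exists jx3; apply/rowP => j; rewrite !mxE; case: j => [[|[|m]] lt2].
- by left; apply/rowP => j; rewrite !mxE; case: j => [[|[|m]] lt2].
Qed.

Lemma proj13_cont : continuous proj13.
Proof.
apply: continuous_rV => j.
rewrite (_ : (fun q => _) = fun q : 'rV[R]_3 => q 0 (widen_ord (leqnSn 2) j)).
  exact: coord_continuous.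
by apply/funext => q; rewrite mxE.
Qed.

Lemma smooth_proj13 Q : smooth_on (@x13 R @` U) Q -> smooth_on D (fun q => Q (proj13 q)).
Proof.
have [_ DE _ _] := DU.
apply: (smooth_comp proj13_affine proj13_cont proj13_basis).
by move=> q /DE[x Ux ->]; exists x => //; rewrite proj13_x13rho.
Qed.

Definition cubic (Q : 'rV[R]_2 -> R) q : R := q 0 krho ^+ 3 * Q (proj13 q).

Lemma cubic_solution Q : smooth_on (@x13 R @` U) Q ->
  [/\ smooth_on D (cubic Q), initial_condition D (cubic Q) & rho_pde D (cubic Q)].
Proof.
move=> sQ; have sp := smooth_proj13 sQ.
have d0 q : D q -> d (fun q => Q (proj13 q)) q = 0.
  by move=> _; apply: (pder_comp0 proj13_affine); exact: proj13_krho.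
split.
- by apply: smoothM => //; exact: smoothX.
- by move=> q _ r0; rewrite /cubic r0 expr0n mul0r.
move=> q Dq.
rewrite (pder_eq krho oD (fun q => @d_cube _ q sp d0) Dq) (d_cube sp d0 Dq).
by rewrite (d_sq sp d0 Dq); ring.
Qed.

(** The section rho = 0 of [proj13], along which Q is read off from the third derivative of S. *)
Definition embed13 (p : 'rV[R]_2) : 'rV[R]_3 := \row_j nth 0 [:: p 0 jx1; p 0 jx3; 0] j.

Lemma embed13_x13 x : embed13 (x13 x) = x13rho x 0.
Proof. by apply/rowP => j; rewrite !mxE; case: j => [[|[|[|m]]] lt3]. Qed.

Lemma embed13_affine (h : R) (p r : 'rV[R]_2) :
  embed13 (h *: p + r) = h *: embed13 p + embed13 r.
Proof.
by apply/rowP => j; rewrite !mxE; case: j => [[|[|[|m]]] lt3] //=; rewrite mulr0 addr0.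
Qed.

Lemma embed13_basis i : embed13 (delta_mx 0 i) = 0 \/
  exists j, embed13 (delta_mx 0 i) = delta_mx 0 j.
Proof.
right; case: i => [[|[|m]] lt2] //.
- exists (@Ordinal 3 0 isT).
  by apply/rowP => j; rewrite !mxE; case: j => [[|[|[|m]]] lt3].
- exists (@Ordinal 3 1 isT).
  by apply/rowP => j; rewrite !mxE; case: j => [[|[|[|m]]] lt3].
Qed.

Lemma embed13_cont : continuous embed13.
Proof.
apply: continuous_rV => -[[|[|[|m]]] lt3] //.
- rewrite (_ : (fun p => _) = fun p : 'rV[R]_2 => p 0 jx1); first exact: coord_continuous.
  by apply/funext => p; rewrite mxE.
- rewrite (_ : (fun p => _) = fun p : 'rV[R]_2 => p 0 jx3); first exact: coord_continuous.
  by apply/funext => p; rewrite mxE.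
- rewrite (_ : (fun p => _) = fun=> 0); first exact: cst_continuous.
  by apply/funext => p; rewrite mxE.
Qed.

Lemma smooth_embed13 F : smooth_on D F ->
  smooth_on (@x13 R @` U) (fun p => F (embed13 p)).
Proof.
have [_ _ D0 _] := DU.
apply: (smooth_comp embed13_affine embed13_cont embed13_basis).
by move=> _ [x Ux <-]; rewrite embed13_x13; exact: D0.
Qed.

Variable f : 'rV[R]_2 -> R.

Lemma S_tensor_cubic (S : idx246 -> 'rV[R]_3 -> R) (Q : idx246 -> 'rV[R]_2 -> R) x rho :
  (forall k, S k (x13rho x rho) = rho ^+ 3 * Q k (x13 x)) ->
  S_tensor f S x rho = rho ^+ 3 *: Q_tensor f Q x.
Proof.
move=> SQ; apply/matrixP => i j; rewrite /S_tensor /Q_tensor.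
have Z (c : R) (A : 'M[R]_6) : (c *: A) i j = c * A i j by rewrite mxE.
rewrite Z !tensor246E mulr_sumr; apply: eq_bigr => m _.
by rewrite SQ mulrA.
Qed.

(** The difference of the two tensors is again of the form [tensor246], so its coefficients vanish
    by [tensor246_inj]. *)
Lemma S_tensor_cubicP (S : idx246 -> 'rV[R]_3 -> R) (Q : idx246 -> 'rV[R]_2 -> R) x rho :
  f_3 f x != 0 -> S_tensor f S x rho = rho ^+ 3 *: Q_tensor f Q x ->
  forall k, S k (x13rho x rho) = rho ^+ 3 * Q k (x13 x).
Proof.
move=> f30 SQ k; apply/eqP; rewrite -subr_eq0; apply/eqP.
have -> : S k (x13rho x rho) - rho ^+ 3 * Q k (x13 x) =
  1 * S k (x13rho x rho) + - rho ^+ 3 * Q k (x13 x) by rewrite mul1r mulNr.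
move: k; apply: (@tensor246_inj _ f _ x f30); apply/matrixP => i j.
rewrite -tensor246_lin -/(S_tensor f S x rho) SQ mul1r [RHS]mxE.
have Z (c : R) (A : 'M[R]_6) : (c *: A) i j = c * A i j by rewrite mxE.
by rewrite Z /Q_tensor mulNr subrr.
Qed.

End RhoPde.

Theorem theorem4p1 (R : realType) (U : set 'rV[R]_6) (D : set 'rV[R]_3)
    (f : 'rV[R]_2 -> R)
    (U_open : open U)
    (D_region : rho_region U D)
    (f_smooth : smooth_on (@x13 R @` U) f)
    (f_3_neq0 : forall x, U x -> f_3 f x != 0) :
  [/\
    forall S : idx246 -> 'rV[R]_3 -> R,
      (forall k, smooth_on D (S k)) ->
      (forall k, initial_condition D (S k)) ->
      ambient_metric_of_class U (conformal_class U (bryant f))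
        (region8 U D) (g_fS f S)
      <-> (forall k, rho_pde D (S k)),
    forall S : idx246 -> 'rV[R]_3 -> R,
      (forall k, [/\ smooth_on D (S k), initial_condition D (S k)
                   & rho_pde D (S k)])
      <-> exists Q : idx246 -> 'rV[R]_2 -> R,
            (forall k, smooth_on (@x13 R @` U) (Q k)) /\
            (forall x rho, U x -> D (x13rho x rho) ->
               S_tensor f S x rho = rho ^+ 3 *: Q_tensor f Q x)
  & forall Q : idx246 -> 'rV[R]_2 -> R,
      (forall k, smooth_on (@x13 R @` U) (Q k)) ->
      ambient_metric U (bryant f) (region8 U D) (g_fQ f Q)].
Proof.
have [oD DE D0 _] := D_region.
split=> [S sS S0|S|Q sQ].
- split=> [[g0 _ [_ _ flat _]]|pde].
    exact/(ricci_flat_pde U_open D_region f_smooth f_3_neq0 sS).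
  exists (bryant f); last exact: g_fS_ambient.
  exists (fun=> 0); split; first exact: smooth_cst.
  by move=> x _; rewrite mulr0 expR0 scale1r.
- split=> [sol|[Q [sQ SQ]] k].
    pose d3 k := pder krho (pder krho (pder krho (S k))).
    (* Q is the third Taylor coefficient of S in rho at rho = 0. *)
    exists (fun k p => 6^-1 * d3 k (embed13 p)); split=> [k|x rho Ux Dr].
      have sd : smooth_on D (fun q => 6^-1 * d3 k q).
        have [sS _ _] := sol k; apply: smoothM => //; first exact: smooth_cst.
        by do 3 apply: smooth_pder.
      exact: (smooth_embed13 D_region sd).
    apply: S_tensor_cubic => k; have [sS S0 pde] := sol k.
    by rewrite embed13_x13; exact: (rho_pde_cubic D_region).
  have [sC C0 Cpde] := cubic_solution D_region (sQ k).
  (* The tensor identity determines each S on all of [D], since every point of [D] lies over some x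
     in [U]. Smoothness and the equation then transfer from the cubic because [D] is open. *)
  have E q : D q -> cubic (Q k) q = S k q.
    move=> Dq; have [x Ux qE] := DE q Dq.
    rewrite qE /cubic proj13_x13rho mxE /= (S_tensor_cubicP (f_3_neq0 x Ux) (SQ _ _ Ux _)) //.
    by rewrite -qE.
  split; first exact: smooth_eq oD E sC.
    by move=> q Dq q0; rewrite -E // C0.
  move=> q Dq; rewrite -(Cpde q Dq) (pder_eq krho oD E Dq).
  by rewrite (pder_eq krho oD (fun q => pder_eq krho oD E (x := q)) Dq).
have sol k := cubic_solution D_region (sQ k).
(* The metric built from Q is the one built from S = rho^3 Q, so the third claim is an instance of
   [g_fS_ambient]. *)
have -> : g_fQ f Q = g_fS f (fun k => cubic (Q k)).
  apply: (congr1 (@ambient_form R)); apply/funext => x; apply/funext => rho.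
  apply: (congr1 (fun M => _ + M)); symmetry; apply: S_tensor_cubic => k.
  by rewrite /cubic proj13_x13rho mxE.
by apply: g_fS_ambient => // k; have [] := sol k.
Qed.
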